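(* Let $a\colon V_\infty\to(0,\infty)$ satisfy $0<a_-=\inf_{V_\infty}a\le\sup_{V_\infty}a=a_+<\infty$. Let $f\colon V\times\mathbb{R}\to\mathbb{R}$ be an $L^1$-Carathéodory function with primitive $F(\boldsymbol{x},u)=\int_0^u f(\boldsymbol{x},s)\,ds$. Assume that: (1) $\lim_{u\to0}\frac{F(\boldsymbol{x},u)}{|u|^2}=\infty$ uniformly with respect to $\mu$-a.e. $\boldsymbol{x}\in V$; (2) there exist $R>0$ and $\alpha<\frac{a_-R^2}{162}$ such that $F(\boldsymbol{x},u)\le\alpha$ for all $u\in[-R,R]$ and $\mu$-a.e. $\boldsymbol{x}\in V$; (3) there exist $\theta>2$ and $M_0>0$ such that $0<\theta F(\boldsymbol{x},u)\le uf(\boldsymbol{x},u)$ for all $u\in(-\infty,-M_0]\cup[M_0,\infty)$ and $\mu$-a.e. $\boldsymbol{x}\in V$. Then the problem $$-\Delta_a u(\boldsymbol{x})\ni f(\boldsymbol{x},u(\boldsymbol{x}))\ \text{ for }\boldsymbol{x}\in V\setminus V_0,\qquad u(\boldsymbol{x})=0\ \text{ for }\boldsymbol{x}\in V_0,$$ has at least two (distinct) nonzero solutions in $H_0^1(V)$.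
   Context: Sierpiński gasket. Let $\boldsymbol{p}_1,\boldsymbol{p}_2,\boldsymbol{p}_3$ be the vertices of an equilateral triangle in $\mathbb{R}^2$ and $\boldsymbol{F}_i(\boldsymbol{x})=\frac{\boldsymbol{x}+\boldsymbol{p}_i}{2}$, $i\in\{1,2,3\}$. $V$ is the unique nonempty compact set with $V=\boldsymbol{F}_1(V)\cup\boldsymbol{F}_2(V)\cup\boldsymbol{F}_3(V)$, $V_0=\{\boldsymbol{p}_1,\boldsymbol{p}_2,\boldsymbol{p}_3\}$, and $\mu$ is the normalized Hausdorff measure on $V$ ($\mu(V)=1$). Let $\Sigma_n=\{1,2,3\}^n$, $\Sigma_\infty=\bigcup_{n\ge1}\Sigma_n$; for $\omega=(\omega_1,\dots,\omega_n)\in\Sigma_n$ put $\boldsymbol{F}_\omega=\boldsymbol{F}_{\omega_1}\circ\cdots\circ\boldsymbol{F}_{\omega_n}$ and $\boldsymbol{p}_\omega=\boldsymbol{F}_{\omega_1\ldots\omega_{n-1}}(\boldsymbol{p}_{\omega_n})$ (so $\boldsymbol{p}_{\omega i}=\boldsymbol{F}_\omega(\boldsymbol{p}_i)$). Let $V_\infty=\{\boldsymbol{p}_\omega:\omega\in\Sigma_\infty\}$. Energy. For $u\in C(V)$, $\mathcal{E}(u)=\lim_{n\to\infty}(5/3)^n\sum_{\omega\in\Sigma_n}\sum_{1\le i<j\le3}|u(\boldsymbol{p}_{\omega i})-u(\boldsymbol{p}_{\omega j})|^2\in[0,\infty]$ (the sequence is nondecreasing). $H_0^1(V)=\{u\in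 C(V):\mathcal{E}(u)<\infty,\ u=0\text{ on }V_0\}$ is a Hilbert space with norm $\|u\|_{H_0^1}=\sqrt{\mathcal{E}(u)}$. Weighted energy. For $u\in H_0^1(V)$, $\mathcal{E}_a(u)=\limsup_{n\to\infty}(5/3)^n\sum_{\omega\in\Sigma_n}\sum_{1\le i<j\le3}\frac{a(\boldsymbol{p}_{\omega i})+a(\boldsymbol{p}_{\omega j})}{2}|u(\boldsymbol{p}_{\omega i})-u(\boldsymbol{p}_{\omega j})|^2$. The (possibly multivalued) weighted Laplacian $-\Delta_a$ is the convex subdifferential of $\frac12\mathcal{E}_a$ on $H_0^1(V)$. $L^1$-Carathéodory: $f(\cdot,u)$ is measurable for every $u\in\mathbb{R}$; $f(\boldsymbol{x},\cdot)$ is continuous for $\mu$-a.e. $\boldsymbol{x}$; for every $M>0$ there is $f_M\in L^1(V;\mathbb{R}_+)$ with $|f(\boldsymbol{x},u)|\le f_M(\boldsymbol{x})$ for $\mu$-a.e. $\boldsymbol{x}$ and all $u\in[-M,M]$. Solution: $u\in H_0^1(V)$ is a solution of the problem if it is a critical point of $I=\psi+\Phi$, with $\psi=\frac12\mathcal{E}_a$ and $\Phi(u)=-\int_V F(\boldsymbol{x},u(\boldsymbol{x}))\,d\mu$, in the sense that $-\Phi'(u)\in\partial\psi(u)$, i.e. $\frac12\mathcal{E}_a(v)-\frac12\mathcal{E}_a(u)-\int_V f(\boldsymbol{x},u(\boldsymbol{x}))(v(\boldsymbol{x})-u(\boldsymbol{x}))\,d\mu(\boldsymbol{x})\ge0$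 for all $v\in H_0^1(V)$. *)

(* Defs.v *)
(* MathComp-Analysis development: R is an arbitrary realType. *)
From HB Require Import structures.
From mathcomp Require Export all_boot all_order all_algebra.
From mathcomp Require Export all_classical all_reals all_analysis.

Set Implicit Arguments.
Unset Strict Implicit.
Unset Printing Implicit Defensive.

Export Order.TTheory GRing.Theory Num.Theory.
Export numFieldNormedType.Exports.

Local Open Scope classical_set_scope.
Local Open Scope ring_scope.

(* The plane carries the product topology and the product (hence Borel)
   sigma-algebra.  The library's norm on pairs is the sup norm, so the Euclidean
   distance, which matters for "equilateral", is given explicitly. *)
Notation plane R := (measurableTypeR R * measurableTypeR R)%type.

Definition edist {R : realType} (x y : plane R) : R :=
  Num.sqrt ((x.1 - y.1) ^+ 2 + (x.2 - y.2) ^+ 2).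

(* The value at set0 is 0, not ereal_sup set0 = -oo. *)
Definition ediam {R : realType} (A : set (plane R)) : \bar R :=
  maxe 0%E (ereal_sup [set (edist z.1 z.2)%:E | z in A `*` A]).

Definition hausdorff_pre {R : realType} (s delta : R) (A : set (plane R)) :
    \bar R :=
  ereal_inf [set (\sum_(0 <= k <oo) (ediam (U k) `^ s))%E | U in
    [set U : nat -> set (plane R) |
       A `<=` \bigcup_k U k /\ forall k, (ediam (U k) <= delta%:E)%E]].

(* Hausdorff (outer) measure of dimension s > 0. *)
Definition hausdorff {R : realType} (s : R) (A : set (plane R)) : \bar R :=
  ereal_sup [set hausdorff_pre s delta A | delta in [set d : R | 0 < d]].

Section Gasket.
Context {R : realType}.
Implicit Types (p : 'I_3 -> plane R) (u v : plane R -> R).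

Definition equilateral p : Prop :=
  exists2 l : R, 0 < l & forall i j, i != j -> edist (p i) (p j) = l.

Definition contr p (i : 'I_3) (x : plane R) : plane R :=
  ((x.1 + (p i).1) / 2, (x.2 + (p i).2) / 2).

Definition is_gasket p (V : set (plane R)) : Prop :=
  [/\ V !=set0, compact V & V = \bigcup_(i in [set: 'I_3]) (contr p i @` V)].

Definition contr_word p (w : seq 'I_3) (x : plane R) : plane R :=
  foldr (contr p) x w.

(* vertex p w i is the point indexed by the nonempty word w i, w being possibly
   empty. *)
Definition vertex p (w : seq 'I_3) (i : 'I_3) : plane R := contr_word p w (p i).

Definition V0 p : set (plane R) := range p.

Definition Vinf p : set (plane R) :=
  [set vertex p wi.1 wi.2 | wi in [set: seq 'I_3 * 'I_3]].

(* The gasket has dimension ln 3 / ln 2.  "Normalized" means rescaled to total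
   mass 1; mu lives on the Borel sets of the plane and is concentrated on V. *)
Definition is_normalized_hausdorff (V : set (plane R))
    (mu : {measure set (plane R) -> \bar R}) : Prop :=
  mu V = 1%E /\
  exists2 c : R, 0 < c & forall A, measurable A ->
    mu A = (c%:E * hausdorff (ln 3 / ln 2) (A `&` V))%E.

Definition edge_sum p (n : nat) (e : plane R -> plane R -> R) : R :=
  \sum_(w : n.-tuple 'I_3) \sum_(i < 3) \sum_(j < 3 | (i < j)%N)
     e (vertex p w i) (vertex p w j).

Definition energy p u : \bar R :=
  limn (fun n => ((5 / 3) ^+ n *
    edge_sum p n (fun x y => `|u x - u y| ^+ 2))%:E).

Definition weighted_energy p (a : plane R -> R) u : \bar R :=
  limn_esup (fun n => ((5 / 3) ^+ n *
    edge_sum p n (fun x y => (a x + a y) / 2 * `|u x - u y| ^+ 2))%:E).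

(* An element of C(V) is represented by a function on the plane whose restriction
   to V is continuous; only its values on V matter. *)
Definition H01 p (V : set (plane R)) u : Prop :=
  [/\ {within V, continuous u}, (energy p u < +oo)%E
    & forall x, V0 p x -> u x = 0].

(* Measurability on D with respect to the completion of mu. *)
Definition ae_measurable (mu : {measure set (plane R) -> \bar R})
    (D : set (plane R)) (g : plane R -> R) : Prop :=
  exists2 h : plane R -> R, measurable_fun D h & g = h %[ae mu in D].

Definition L1_caratheodory (mu : {measure set (plane R) -> \bar R})
    (V : set (plane R)) (f : plane R -> R -> R) : Prop :=
  [/\ forall t, ae_measurable mu V (f ^~ t),
      {ae mu, forall x, V x -> continuous (f x)}
    & forall M, 0 < M -> exists fM : plane R -> R,
        [/\ mu.-integrable V (EFin \o fM), forall x, V x -> 0 <= fM x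
          & {ae mu, forall x, V x ->
              forall t, - M <= t <= M -> `|f x t| <= fM x}]].

(* The oriented integral of f x from 0 to t. *)
Definition primitive (f : plane R -> R -> R) (x : plane R) (t : R) : R :=
  if 0 <= t then \int[lebesgue_measure]_(s in `[0, t]) f x s
  else - \int[lebesgue_measure]_(s in `[t, 0]) f x s.

(* - Phi'(u) belongs to the convex subdifferential of psi at u, where
   psi = weighted_energy / 2 on H01 and
   - Phi'(u) is the functional h |-> \int_V f(x, u x) h x. *)
Definition is_solution p (V : set (plane R))
    (mu : {measure set (plane R) -> \bar R}) (a : plane R -> R)
    (f : plane R -> R -> R) u : Prop :=
  H01 p V u /\
  forall v, H01 p V v ->
    (0 <= 2^-1%:E * weighted_energy p a v - 2^-1%:E * weighted_energy p a u
          - \int[mu]_(x in V) (f x (u x) * (v x - u x))%:E)%E.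

End Gasket.

(* Main.v *)
Require Import Defs.
From mathcomp Require Import measurable_realfun ring lra.

Set Implicit Arguments.
Unset Strict Implicit.
Unset Printing Implicit Defensive.

Local Open Scope classical_set_scope.
Local Open Scope ring_scope.

(** Write [psi] for half of the weighted energy and [J u] for the integral of
    [primitive f x (u x)], so that a solution is a point [u] of [H01] at which [dJ u]
    is a subgradient of the convex function [psi].  The proof finds one critical point
    of [I = psi - J] at a negative level and another one at a positive level,
    of mountain pass type; they differ from each other and from 0, whose level is 0.

    The gasket enters through a few facts about the energy norm [N].  Refining the
    graphs does not decrease the graph energy ([genergy_mono_step]), and the energy of
    a cell decays geometrically, so functions in [H01] satisfy [`|u x| <= 5 * N u]
    ([sup_bound]) and their oscillation on cells decays uniformly ([cell_osc]).  Hence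
    [H01] is complete and embeds compactly into the bounded functions ([H01_complete],
    [H01_compact]).  The weighted energy, although it is a limit superior and perhaps
    not a quadratic form, is strongly convex with respect to [N], homogeneous of
    degree two and comparable with [N ^+ 2] ([weighted_form_cvx], [weighted_form_Z],
    [weighted_form_ge], [weighted_form_le]).

    By strong convexity, [psi z - dJ u z] has a unique minimizer [K u]; no weak topology
    is needed for this ([quadratic_minimizer]).  The map [K] is continuous, even from
    the supremum norm to [N], and its fixed points are the critical points.  As [psi]
    is not differentiable there is no gradient flow; instead, moving from [u] towards
    [K u] decreases [I] by an amount controlled by [N (K u - u) ^+ 2] ([descent]), with
    a step length that depends continuously on [u] ([radius_lip]).  This gives a
    continuous map [step], and the orbit of any point along which [I] stays bounded
    below leads to a critical point whose level lies between the bound and the initial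
    level ([orbit_critical]): the superquadraticity condition on [f] bounds the orbit
    ([small_slope_bounded]), and the compact embedding makes it cluster.

    The bound on the primitive for arguments in [-r, r], together with
    [`|u x| <= 5 * N u <= 9 * N u], shows that [I] is at least a positive constant on
    the sphere [N u = r / 9].  Steps decrease [I] along segments, so an orbit that
    starts below this constant cannot cross the sphere.  Starting inside it at a
    negative level gives the first critical point.  For the second one, a point [e0] of
    negative level outside is joined to 0 by a segment; the [n]-th image of the segment
    always meets the sphere, and by compactness of the interval some point of the
    segment has its whole orbit above the barrier ([two_critical_points]).

    Both low points are multiples of a function in [H01] that is positive off the three
    corners, a product of two harmonic functions ([H01_positive]): small multiples by
    the behavior of the primitive at 0, large ones by its superquadratic growth
    ([superquadratic_growth]).  Finally, [J] is strictly differentiable by dominated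
    convergence ([potential_diff]); all conditions that hold almost everywhere are made
    to hold off one null set, which does not affect the integrals
    ([integral_null]). *)

(** * Two critical points separated by a barrier *)

Lemma natSinv_small (R : realType) (e : R) : 0 < e ->
  exists n0, forall n, (n0 <= n)%N -> n.+1%:R^-1 < e :> R.
Proof.
move=> e0; have := near_infty_natSinv_lt (PosNum e0) => -[n0 _ h].
by exists n0 => n nn; exact: h.
Qed.

Lemma seq_cluster (R : realType) (t : nat -> R) : (forall n, 0 <= t n <= 1) ->
  exists s, forall (e : R) n, 0 < e -> exists2 k, (n <= k)%N & `|t k - s| < e.
Proof.
move=> t01.
have /(_ (t @ \oo) _)[|s [_ sP]] := @segment_compact R 0 1.
  by exists 0%N => // n _ /=; rewrite in_itv/=.
exists s => e n e0.
have [||_ [[k nk <-]]] := sP (t @` [set k | (n <= k)%N]) (ball s e).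
- by exists n => // k nk /=; exists k.
- exact: nbhsx_ballx.
by rewrite /ball/= distrC => h; exists k.
Qed.

Section CriticalPoints.
Context {R : realType} {X : lmodType R}.
Variables (H : set X) (N S psi J : X -> R) (dJ : X -> X -> R) (m M C : R).

(** [N] is the energy norm and [S] the supremum norm.  The functional [psi] is the
    nonsmooth part: it is known through convexity and homogeneity only.  The smooth
    part [J] is differentiable in the strong sense that its difference quotients
    converge uniformly near each point. *)

Hypotheses (H0 : H 0) (HD : forall u v, H u -> H v -> H (u + v))
  (HZ : forall (t : R) u, H u -> H (t *: u)).
Hypotheses (N_ge0 : forall u, 0 <= N u)
  (ND : forall u v, H u -> H v -> N (u + v) <= N u + N v)
  (NZ : forall (t : R) u, H u -> N (t *: u) = `|t| * N u).
Hypotheses (S_ge0 : forall u, 0 <= S u)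
  (SD : forall u v, H u -> H v -> S (u + v) <= S u + S v)
  (SZ : forall (t : R) u, H u -> S (t *: u) = `|t| * S u)
  (C_gt0 : 0 < C) (SN : forall u, H u -> S u <= C * N u).
Hypothesis N_complete : forall u : nat -> X, (forall k, H (u k)) ->
  (forall e : R, 0 < e -> exists k0, forall k l, (k0 <= k)%N -> (k0 <= l)%N ->
     N (u k - u l) < e) ->
  exists2 v, H v & forall e : R, 0 < e -> exists k0, forall k, (k0 <= k)%N ->
     N (u k - v) < e.
Hypotheses (m_gt0 : 0 < m)
  (psi_cvx : forall u v (t : R), H u -> H v -> 0 <= t <= 1 ->
     psi ((1 - t) *: u + t *: v) <=
       (1 - t) * psi u + t * psi v - t * (1 - t) * m * N (u - v) ^+ 2)
  (psiZ : forall (t : R) u, H u -> psi (t *: u) = t ^+ 2 * psi u)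
  (psi_ge : forall u, H u -> m * N u ^+ 2 <= psi u)
  (psi_le : forall u, H u -> psi u <= M * N u ^+ 2).
Hypotheses (dJD : forall u h k, H u -> H h -> H k ->
     dJ u (h + k) = dJ u h + dJ u k)
  (dJZ : forall u t h, H u -> H h -> dJ u (t *: h) = t * dJ u h)
  (dJ_bounded : forall u, H u -> exists L, forall h, H h -> `|dJ u h| <= L * S h)
  (J_diff : forall u, H u -> forall e : R, 0 < e -> exists2 r : R, 0 < r &
     forall v w, H v -> H w -> S (v - u) < r -> S (w - u) < r ->
       `|J v - J w - dJ u (v - w)| <= e * S (v - w)).

Let HB u v : H u -> H v -> H (u - v).
Proof. by move=> Hu Hv; rewrite -scaleN1r; apply: HD => //; apply: HZ. Qed.

Let NN u : H u -> N (- u) = N u.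
Proof. by move=> Hu; rewrite -scaleN1r NZ// normrN1 mul1r. Qed.

Let NBC u v : H u -> H v -> N (u - v) = N (v - u).
Proof. by move=> Hu Hv; rewrite -opprB NN//; apply: HB. Qed.

Let NB u v w : H u -> H v -> H w -> N (u - w) <= N (u - v) + N (v - w).
Proof.
move=> Hu Hv Hw; rewrite -[u - w](@subrKA _ v).
by rewrite ND//; apply: HB.
Qed.

Let SBd u v w : H u -> H v -> H w -> S (u - w) <= S (u - v) + S (v - w).
Proof.
move=> Hu Hv Hw; rewrite -[u - w](@subrKA _ v).
by rewrite SD//; apply: HB.
Qed.

Let N0 : N 0 = 0.
Proof. by rewrite -(scale0r (0 : X)) NZ// normr0 mul0r. Qed.

Let S0 : S 0 = 0.
Proof. by rewrite -(scale0r (0 : X)) SZ// normr0 mul0r. Qed.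

Let dJB u h k : H u -> H h -> H k -> dJ u (h - k) = dJ u h - dJ u k.
Proof.
move=> Hu Hh Hk; rewrite -scaleN1r dJD//; last exact: HZ.
by rewrite dJZ// mulN1r.
Qed.

Let psi_ge0 u : H u -> 0 <= psi u.
Proof.
by move=> Hu; rewrite (le_trans _ (psi_ge Hu))// mulr_ge0// ?sqr_ge0// ltW.
Qed.

(** A substitute for the triangle inequality: [u + h] lies on the segment from
    [u / (1 - t)] to [h / t], and [psi] is convex and homogeneous of degree two. *)
Lemma psi_perturb u h (t : R) : H u -> H h -> 0 < t < 1 ->
  psi (u + h) <= psi u / (1 - t) + psi h / t.
Proof.
move=> Hu Hh /andP[t0 t1].
have t1' : 0 < 1 - t by lra.
have -> : u + h = (1 - t) *: ((1 - t)^-1 *: u) + t *: (t^-1 *: h).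
  by rewrite !scalerA !mulfV ?gt_eqF// !scale1r.
apply: le_trans (psi_cvx _ _ _) _; [exact: HZ|exact: HZ|by rewrite !ltW|].
rewrite !psiZ//.
have -> : (1 - t) * ((1 - t)^-1 ^+ 2 * psi u) = psi u / (1 - t).
  by field; rewrite gt_eqF.
have -> : t * (t^-1 ^+ 2 * psi h) = psi h / t by field; rewrite gt_eqF.
rewrite gerBl; apply: mulr_ge0; last exact: sqr_ge0.
by apply: mulr_ge0; [apply: mulr_ge0|]; apply: ltW.
Qed.

Let psi_leM u : H u -> psi u <= `|M| * N u ^+ 2.
Proof.
move=> Hu; apply: le_trans (psi_le Hu) _.
by rewrite ler_wpM2r ?sqr_ge0// ler_norm.
Qed.

Lemma psi_continuous u (e : R) : H u -> 0 < e -> exists2 r : R, 0 < r &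
  forall w, H w -> N (w - u) < r -> `|psi w - psi u| <= e.
Proof.
move=> Hu e0; have P0 := psi_ge0 Hu.
(* [t] is so small that [psi u / (1 - t)] exceeds [psi u] by a fraction of [e]. *)
set D := 4 * (psi u + 1) + 2 * e.
have D0 : 0 < D by rewrite /D; lra.
set t : R := e / D; have t0 : 0 < t by rewrite divr_gt0.
have tD : t * D = e by rewrite mulfVK// gt_eqF.
have t12 : t < 1 / 2 by rewrite ltr_pdivrMr// /D; lra.
have tP : 4 * (t * psi u) <= e.
  have : t * (psi u * 4) <= t * D by rewrite ler_pM2l// /D; lra.
  by rewrite tD; lra.
set r : R := Num.min 1 (t * e / (2 * (`|M| + 1))).
have M1 : 0 < 2 * (`|M| + 1) by have := normr_ge0 M; lra.
have r0 : 0 < r by rewrite lt_min ltr01 divr_gt0// mulr_gt0.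
exists r => // w Hw wu.
have key h : H h -> N h < r -> psi h / t <= e / 2.
  move=> Hh hr; rewrite ler_pdivrMr//.
  have Nh0 := N_ge0 h.
  have h1 : N h <= 1 by move: hr; rewrite lt_min => /andP[/ltW].
  have h2 : N h * (2 * (`|M| + 1)) <= t * e.
    by rewrite -ler_pdivlMr//; move: hr; rewrite lt_min => /andP[_ /ltW].
  have := psi_leM Hh; have M0 := normr_ge0 M.
  have h3 : `|M| * N h * N h <= `|M| * N h by rewrite ler_piMr// mulr_ge0.
  nra.
have Hwu : H (w - u) by exact: HB.
have Huw : H (u - w) by exact: HB.
have A : psi w <= psi u / (1 - t) + e / 2.
  rewrite -{1}(subrK u w) addrC.
  apply: le_trans (@psi_perturb u (w - u) t Hu Hwu _) _; first by apply/andP; split; lra.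
  by rewrite lerD2l key.
have B : psi u <= psi w / (1 - t) + e / 2.
  rewrite -{1}(subrK w u) addrC.
  apply: le_trans (@psi_perturb w (u - w) t Hw Huw _) _; first by apply/andP; split; lra.
  by rewrite lerD2l key// NBC.
have t1 : 0 < 1 - t by lra.
have {}A : (1 - t) * psi w <= psi u + (1 - t) * (e / 2).
  have : (1 - t) * psi w <= (1 - t) * (psi u / (1 - t) + e / 2).
    by rewrite ler_pM2l.
  by rewrite mulrDr mulrCA mulfV ?gt_eqF// mulr1.
have {}B : (1 - t) * psi u <= psi w + (1 - t) * (e / 2).
  have : (1 - t) * psi u <= (1 - t) * (psi w / (1 - t) + e / 2).
    by rewrite ler_pM2l.
  by rewrite mulrDr mulrCA mulfV ?gt_eqF// mulr1.
have Pw0 := psi_ge0 Hw.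
rewrite ler_norml; apply/andP; split.
  nra.
have : (1 - t) * (psi w - psi u) <= (1 - t) * e by nra.
by rewrite ler_pM2l.
Qed.

(** The direct method without weak topologies.  By strong convexity the midpoint of
    two almost minimizers would be better than the infimum unless they are close, so
    a minimizing sequence is Cauchy.  The same midpoint inequality, applied to the
    minimizer and to [w], gives the quadratic lower bound. *)
Lemma quadratic_minimizer (l : X -> R) L :
    (forall h k, H h -> H k -> l (h + k) = l h + l k) ->
    (forall (t : R) h, H h -> l (t *: h) = t * l h) ->
    (forall h, H h -> `|l h| <= L * N h) ->
  exists2 z, H z & forall w, H w ->
    m / 2 * N (w - z) ^+ 2 <= psi w - psi z - l (w - z).
Proof.
move=> lD lZ lL.
have lB h k : H h -> H k -> l (h - k) = l h - l k.
  move=> Hh Hk; rewrite -scaleN1r lD//; last exact: HZ.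
  by rewrite lZ// mulN1r.
pose g w := psi w - l w.
have lb w : H w -> - (L ^+ 2 / (4 * m)) <= g w.
  move=> Hw; rewrite /g.
  have h1 := psi_ge Hw; have h2 := lL _ Hw; have h3 := ler_norm (l w).
  have : 0 <= m * (N w - L / (2 * m)) ^+ 2 by rewrite mulr_ge0 ?sqr_ge0// ltW.
  have -> : m * (N w - L / (2 * m)) ^+ 2 =
     m * N w ^+ 2 - L * N w + L ^+ 2 / (4 * m) by field; rewrite gt_eqF.
  lra.
have hi : has_inf (g @` H).
  split; first by exists (g 0), 0.
  by exists (- (L ^+ 2 / (4 * m))) => _ [w Hw <-]; exact: lb.
set G := inf (g @` H).
have Gle w : H w -> G <= g w.
  by move=> Hw; apply: ge_inf; [exact: hi.2|exists w].
have mid z w : H z -> H w -> m / 4 * N (z - w) ^+ 2 <= (g z + g w) / 2 - G.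
  move=> Hz Hw.
  have Hm : H ((1 - 1 / 2) *: z + (1 / 2) *: w) by apply: HD; exact: HZ.
  have := Gle _ Hm; rewrite /g lD ?lZ//; [|exact: HZ|exact: HZ].
  have := @psi_cvx z w (1/2) Hz Hw; have -> : 0 <= (1 / 2 : R) <= 1 by apply/andP; split; lra.
  move=> /(_ isT); lra.
have /choice[z zP] : forall n : nat, exists z, H z /\ g z < G + n.+1%:R^-1.
  move=> n; have [|_ [z Hz <-] zG] := @inf_adherent _ (g @` H) n.+1%:R^-1 _ hi.
    by rewrite invr_gt0.
  by exists z.
have Hz n : H (z n) by case: (zP n).
have zG n : g (z n) < G + n.+1%:R^-1 by case: (zP n).
have [|z0 Hz0 cz] := N_complete Hz.
  move=> e e0; have [|n0 n0P] := @natSinv_small R (m / 4 * e ^+ 2).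
    by rewrite mulr_gt0 ?exprn_gt0// divr_gt0.
  exists n0 => k l0 kn ln.
  have h1 := mid _ _ (Hz k) (Hz l0); have := zG k; have := zG l0.
  have := n0P _ kn; have := n0P _ ln => h2 h3 h4 h5.
  have : m / 4 * N (z k - z l0) ^+ 2 < m / 4 * e ^+ 2.
    by move: h2 h3 h4 h5; move: k.+1%:R^-1 l0.+1%:R^-1 => a b; lra.
  rewrite ltr_pM2l ?divr_gt0// ltr_pXn2r ?nnegrE//; exact: ltW.
have gz0 : g z0 <= G.
  apply/ler_addgt0Pr => e e0.
  have [r r0 rP] := @psi_continuous z0 (e / 3) Hz0 ltac:(lra).
  set r' : R := Num.min r (e / (3 * (`|L| + 1))).
  have L1 : 0 < 3 * (`|L| + 1) by have := normr_ge0 L; lra.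
  have r'0 : 0 < r' by rewrite lt_min r0 divr_gt0.
  have [k1 k1P] := cz _ r'0.
  have [k2 k2P] := @natSinv_small R (e / 3) ltac:(lra).
  set k := maxn k1 k2.
  have kk : N (z k - z0) < r' by apply: k1P; exact: leq_maxl.
  have := k2P k (leq_maxr _ _); have := zG k.
  have := rP _ (Hz k); move: kk; rewrite lt_min => /andP[a b] /(_ a).
  move: b; rewrite ltr_pdivlMr// => b.
  have := lL _ (HB (Hz k) Hz0); rewrite lB// /g.
  have := N_ge0 (z k - z0); have := ler_norm L.
  move=> h1 h2 h3; rewrite ler_norml => /andP[h4 h5] h6 h7.
  have : L * N (z k - z0) <= e / 3 by nra.
  move: h3; rewrite ler_norml => /andP[h8 h9].
  by move: k.+1%:R^-1 h6 h7 => q; lra.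
exists z0 => // w Hw; rewrite lB//.
have := mid _ _ Hw Hz0; rewrite /g in gz0 *; lra.
Qed.

Definition is_minimizer u z := H z /\ forall w, H w ->
  m / 2 * N (w - z) ^+ 2 <= psi w - psi z - dJ u (w - z).

(** The inverse of the subdifferential of [psi], composed with [dJ]: the critical
    points are its fixed points. *)
Definition resolvent u : X := xget 0 (is_minimizer u).
Local Notation K := resolvent.

Lemma resolventP u : H u -> is_minimizer u (K u).
Proof.
move=> Hu; rewrite /resolvent.
suff [z zP] : exists z, is_minimizer u z by apply: xgetI; exact: zP.
have [L LP] := dJ_bounded Hu.
have [h k Hh Hk|t h Hh|h Hh|z Hz zP] := @quadratic_minimizer (dJ u) (`|L| * C).
- exact: dJD.
- exact: dJZ.
- apply: le_trans (LP _ Hh) _; rewrite -mulrA.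
  apply: le_trans (ler_wpM2r (S_ge0 h) (ler_norm L)) _.
  by rewrite ler_wpM2l// SN.
- by exists z; split.
Qed.

Let HK u : H u -> H (K u).
Proof. by move=> /resolventP[]. Qed.

(** Strict differentiability at [u] compares the difference quotients at all points
    near [u] with [dJ u], hence also their limits [dJ v]. *)
Lemma dJ_continuous u (e : R) : H u -> 0 < e -> exists2 r : R, 0 < r &
  forall v, H v -> S (v - u) < r -> forall h, H h ->
    `|dJ v h - dJ u h| <= e * S h.
Proof.
move=> Hu e0; have e20 : 0 < e / 2 by lra.
have [r r0 rP] := J_diff Hu e20; exists r => // v Hv vu h Hh.
have [r' r'0 r'P] := J_diff Hv e20.
set q : R := Num.min r' (r - S (v - u)).
have q0 : 0 < q by rewrite lt_min r'0 subr_gt0.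
have Sh1 : 0 < 2 * (S h + 1) by have := S_ge0 h; lra.
set s : R := q / (2 * (S h + 1)).
have s0 : 0 < s by rewrite divr_gt0.
have ssh : s * S h < q.
  have : s * (2 * (S h + 1)) = q by rewrite mulfVK// gt_eqF.
  have := mulr_ge0 (ltW s0) (S_ge0 h); lra.
have Hsh : H (s *: h) by exact: HZ.
have Hw : H (v + s *: h) by exact: HD.
have E : v + s *: h - v = s *: h by rewrite addrAC subrr add0r.
have Ssh : S (s *: h) = s * S h by rewrite SZ// gtr0_norm.
move: ssh; rewrite lt_min => /andP[ssh1 ssh2].
have A := r'P (v + s *: h) v Hw Hv.
rewrite E Ssh subrr S0 in A; have {A} := A ssh1 r'0.
have B := rP (v + s *: h) v Hw Hv.
have {B} := B _ vu; rewrite E Ssh.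
have h1 : S (v + s *: h - u) < r.
  apply: le_lt_trans (@SBd _ v _ Hw Hv Hu) _; rewrite E Ssh.
  lra.
move=> /(_ h1); rewrite !dJZ// !ler_norml => /andP[a1 a2] /andP[b1 b2].
have : s * (dJ v h - dJ u h) <= s * (e * S h) by lra.
rewrite ler_pM2l// => ->; rewrite andbT.
have : s * (- (e * S h)) <= s * (dJ v h - dJ u h) by lra.
by rewrite ler_pM2l.
Qed.

(** Each of the two minimality inequalities is tested against the other minimizer;
    in their sum the values of [psi] cancel and strong convexity remains. *)
Lemma resolvent_lip u v (c : R) : H u -> H v -> 0 <= c ->
  (forall h, H h -> `|dJ u h - dJ v h| <= c * S h) -> m * N (K u - K v) <= c * C.
Proof.
move=> Hu Hv c0 cP.
have [Hz zP] := resolventP Hu; have [Hw wP] := resolventP Hv.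
have := zP _ Hw; have := wP _ Hz.
rewrite (NBC Hw Hz) !dJB// => h1 h2.
have := cP _ (HB Hz Hw); rewrite !dJB// => /(le_trans (ler_norm _)) h3.
have h4 := ler_wpM2l c0 (SN (HB Hz Hw)).
set n := N (K u - K v) in h1 h2 h4 *.
have n0 : 0 <= n by exact: N_ge0.
have h5 : n * (m * n) <= n * (c * C) by nra.
have [n_gt0|] := ltP 0 n; first by move: h5; rewrite ler_pM2l.
move=> n1; have -> : n = 0 by apply/eqP; rewrite eq_le n1.
by rewrite mulr0; apply: mulr_ge0 => //; exact: ltW.
Qed.

(** The neighborhood is one of the weak norm [S]: this is how the compact embedding
    will produce norm limits. *)
Lemma resolvent_continuous u (e : R) : H u -> 0 < e -> exists2 r : R, 0 < r &
  forall v, H v -> S (v - u) < r -> N (K v - K u) < e.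
Proof.
move=> Hu e0; set c : R := m * e / (2 * C).
have c0 : 0 < c by rewrite divr_gt0// mulr_gt0.
have [r r0 rP] := dJ_continuous Hu c0; exists r => // v Hv vu.
have := resolvent_lip Hv Hu (ltW c0) (rP v Hv vu).
have -> : c * C = m * (e / 2) by rewrite /c; field; rewrite gt_eqF.
rewrite ler_pM2l//; lra.
Qed.

Definition dir u := K u - u.

Let Hdir u : H u -> H (dir u).
Proof. by move=> Hu; apply: HB => //; exact: HK. Qed.

Let SN_lt u (r : R) : H u -> N u < r / C -> S u < r.
Proof.
by move=> Hu; rewrite ltr_pdivlMr// mulrC; exact: le_lt_trans (SN Hu).
Qed.

Lemma dir_continuous u (e : R) : H u -> 0 < e -> exists2 r : R, 0 < r &
  forall v, H v -> N (v - u) < r -> N (dir v - dir u) < e.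
Proof.
move=> Hu e0; have e20 : 0 < e / 2 by lra.
have [r r0 rP] := resolvent_continuous Hu e20.
exists (Num.min (r / C) (e / 2)); first by rewrite lt_min e20 divr_gt0.
move=> v Hv; rewrite lt_min => /andP[h1 h2].
have h3 := rP v Hv (SN_lt (HB Hv Hu) h1).
have -> : dir v - dir u = (K v - K u) + (u - v).
  by rewrite /dir opprB addrACA [RHS]addrACA [- v - _]addrC.
apply: le_lt_trans (ND (HB (HK Hv) (HK Hu)) (HB Hu Hv)) _.
by rewrite (NBC Hu Hv); lra.
Qed.

Definition action u := psi u - J u.
Let I := action.

Lemma J_continuous u (e : R) : H u -> 0 < e -> exists2 r : R, 0 < r &
  forall w, H w -> S (w - u) < r -> `|J w - J u| <= e.
Proof.
move=> Hu e0; have [r r0 rP] := J_diff Hu (ltac:(exact: ltr01) : 0 < 1 :> R).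
have [L LP] := dJ_bounded Hu.
have L1 : 0 < `|L| + 1 by have := normr_ge0 L; lra.
exists (Num.min r (e / (`|L| + 1))); first by rewrite lt_min r0 divr_gt0.
move=> w Hw; rewrite lt_min ltr_pdivlMr// => /andP[h1 h2].
have := rP w u Hw Hu h1; rewrite subrr S0 mul1r => /(_ r0) h3.
have h4 := LP _ (HB Hw Hu).
have h5 := ler_wpM2r (S_ge0 (w - u)) (ler_norm L).
move: h3 h4; rewrite !ler_norml => /andP[? ?] /andP[? ?].
by apply/andP; split; lra.
Qed.

Lemma I_continuous u (e : R) : H u -> 0 < e -> exists2 r : R, 0 < r &
  forall w, H w -> N (w - u) < r -> `|I w - I u| <= e.
Proof.
move=> Hu e0; have e20 : 0 < e / 2 by lra.
have [r r0 rP] := J_continuous Hu e20.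
have [q q0 qP] := psi_continuous Hu e20.
exists (Num.min q (r / C)); first by rewrite lt_min q0 divr_gt0.
move=> w Hw; rewrite lt_min => /andP[h1 h2].
have := qP w Hw h1; have := rP w Hw (SN_lt (HB Hw Hu) h2).
rewrite /I /action !ler_norml => /andP[? ?] /andP[? ?].
by apply/andP; split; lra.
Qed.

Definition critical u := H u /\ forall w, H w -> 0 <= psi w - psi u - dJ u (w - u).

(** [N] need not separate points, so [N (dir u) = 0] stands for [resolvent u = u];
    everything in sight is continuous for [N] and does not see the difference. *)
Lemma dir0_critical u : H u -> N (dir u) = 0 -> critical u.
Proof.
move=> Hu d0; split => // w Hw.
have [Hz zP] := resolventP Hu.
have psiE : psi (K u) = psi u.
  apply/eqP; rewrite eq_le; apply/andP; split; apply/ler_addgt0Pr => e e0;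
    have [r r0 rP] := psi_continuous Hu e0;
    have := rP _ Hz; rewrite -/(dir u) d0 => /(_ r0);
    rewrite ler_norml => /andP[? ?]; lra.
have dJ0 : dJ u (K u - u) = 0.
  have [L LP] := dJ_bounded Hu; have := LP _ (Hdir Hu).
  have : S (dir u) = 0.
    by apply/eqP; rewrite eq_le S_ge0 andbT -[0](mulr0 C) -d0 SN//; exact: Hdir.
  move=> ->; rewrite mulr0 normr_le0 => /eqP; exact.
have dJ0' : dJ u (u - K u) = 0.
  by rewrite -[u - K u]opprB -scaleN1r dJZ ?dJ0 ?mulr0//; exact: Hdir.
have := zP _ Hw; rewrite psiE -[w - K u](@subrKA _ u) (dJD Hu (HB Hw Hu) (HB Hu Hz)).
rewrite dJ0' addr0; apply: le_trans.
by rewrite mulr_ge0 ?sqr_ge0// divr_ge0// ltW.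
Qed.

(** Along the segment from [w] to [resolvent w], the chord inequality for [psi] takes
    the place of a derivative: the slope of the chord of [psi] lies below
    [dJ w (dir w)] by a multiple of [N (dir w) ^+ 2], and [J] grows almost like
    [dJ w].  The estimate is uniform for [w] near [u]. *)
Lemma descent u : H u -> 0 < N (dir u) -> exists2 r : R, 0 < r &
  forall w (s : R), H w -> N (w - u) < r -> 0 <= s <= r ->
    I (w + s *: dir w) <= I w - s * (m / 4 * N (dir w) ^+ 2).
Proof.
move=> Hu; set n := N (dir u) => n0.
set e : R := m * n / (24 * C).
have e0 : 0 < e by rewrite divr_gt0 ?mulr_gt0//; lra.
have [r1 r10 r1P] := J_diff Hu e0.
have [r2 r20 r2P] := dJ_continuous Hu e0.
have [r3 r30 r3P] := dir_continuous Hu (ltac:(lra) : 0 < n / 2).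
set q : R := r1 / C.
have q0 : 0 < q by rewrite divr_gt0.
(* [q / 2] and [q / (4 * n)] keep [w] and [w + s *: dir w] where [J] is almost affine,
   [r2 / C] keeps [dJ w] near [dJ u], and [r3] keeps [N (dir w)] near [n]. *)
exists (Num.min (Num.min (q / 2) (r2 / C)) (Num.min (Num.min r3 (1 : R)) (q / (4 * n)))).
  by rewrite !lt_min !divr_gt0// ?mulr_gt0// r30 ltr01.
move=> w s Hw; rewrite !lt_min !le_min.
move=> /andP[/andP[a1 a2] /andP[/andP[a3 _] _]].
move=> /andP[s0 /andP[/andP[_ _] /andP[/andP[_ s1] s2]]].
have Hd := Hdir Hw.
have nw := r3P w Hw a3.
have n1 : N (dir w) <= 3 / 2 * n.
  have := ND (HB Hd (Hdir Hu)) (Hdir Hu); rewrite subrK -/n; lra.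
have n2 : n / 2 <= N (dir w).
  have := ND (HB (Hdir Hu) Hd) Hd; rewrite subrK (NBC (Hdir Hu) Hd) -/n; lra.
have [Hz zP] := resolventP Hw.
have Hsd : H (s *: dir w) by exact: HZ.
have Hws : H (w + s *: dir w) by exact: HD.
have E : w + s *: dir w - w = s *: dir w by rewrite addrAC subrr add0r.
have sn : s * N (dir w) < q / 2.
  have : s * (4 * n) <= q by rewrite -ler_pdivlMr// mulr_gt0.
  nra.
have h1 : S (w - u) < r1 by apply: SN_lt; [exact: HB|rewrite -/q; lra].
have h2 : S (w + s *: dir w - u) < r1.
  apply: SN_lt; first exact: HB.
  apply: le_lt_trans (NB Hws Hw Hu) _.
  rewrite E NZ// ger0_norm// -/q; lra.
have h3 : S (w - u) < r2 by apply: SN_lt => //; exact: HB.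
have := r1P _ _ Hws Hw h2 h1; rewrite E SZ// (ger0_norm s0) dJZ// => h4.
have h5 := r2P w Hw h3 _ Hd.
have := zP _ Hw.
have -> : w - K w = (-1) *: dir w by rewrite scaleN1r opprB.
rewrite dJZ// NZ// normrN1 mul1r => h6.
have := psi_cvx Hw Hz (_ : 0 <= s <= 1); rewrite s0 s1 => /(_ isT).
have -> : (1 - s) *: w + s *: K w = w + s *: dir w.
  by rewrite scalerBl scale1r /dir scalerBr addrA addrAC.
have h7 : 0 <= s * (1 - s) * m * N (w - K w) ^+ 2.
  by rewrite !mulr_ge0 ?sqr_ge0 ?subr_ge0// ltW.
have h8 := SN Hd.
have h9 : e * S (dir w) <= m / 12 * N (dir w) ^+ 2.
  have : e * S (dir w) <= e * (C * N (dir w)) by rewrite ler_pM2l.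
  have -> : e * (C * N (dir w)) = m / 12 * N (dir w) * (n / 2).
    by rewrite /e; field; rewrite gt_eqF.
  move=> h; apply: le_trans h _; rewrite expr2 [leRHS]mulrA ler_wpM2l//.
  by apply: mulr_ge0 => //; rewrite divr_ge0// ltW.
move=> h10; rewrite /I /action.
move: h4 h5; rewrite !ler_norml => /andP[h4 _] /andP[_ h5].
have := ler_wpM2l s0 h5; have := ler_wpM2l s0 h6; have := ler_wpM2l s0 h9.
have : 0 <= s * (m * N (dir w) ^+ 2) by rewrite !mulr_ge0 ?sqr_ge0// ltW.
lra.
Qed.

Definition admissible u (r : R) := 0 <= r <= 1 /\
  forall w (s : R), H w -> N (w - u) < r -> 0 <= s <= r ->
    I (w + s *: dir w) <= I w - s * (m / 4 * N (dir w) ^+ 2).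

(** The supremum of the admissible radii serves as a step length that depends
    continuously on [u]: it is 1-Lipschitz, since the ball of radius [r - N (w - u)]
    around [w] lies in the ball of radius [r] around [u]. *)
Definition radius u : R := sup [set r | admissible u r].

Let admissible0 u : admissible u 0.
Proof.
split=> [|w s Hw]; first by rewrite lexx ler01.
by move=> /(le_lt_trans (N_ge0 _)); rewrite ltxx.
Qed.

Let has_sup_admissible u : has_sup [set r | admissible u r].
Proof.
by split; [exists 0; exact: admissible0|exists 1 => r [/andP[]]].
Qed.

Let admissible_le u r : admissible u r -> r <= radius u.
Proof. by move=> ur; apply: ub_le_sup => //; exact: (has_sup_admissible u).2. Qed.

Let radius_ge0 u : 0 <= radius u.
Proof. exact/admissible_le/admissible0. Qed.

Let radius_le1 u : radius u <= 1.
Proof.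
apply: ge_sup; first exact: (has_sup_admissible u).1.
by move=> r [/andP[]].
Qed.

Lemma radius_lip u w : H u -> H w -> radius u <= radius w + N (w - u).
Proof.
move=> Hu Hw; apply: ge_sup; first exact: (has_sup_admissible u).1.
move=> r /= [/andP[r0 r1] rP].
have Nwu := N_ge0 (w - u).
have [rN|Nr] := leP r (N (w - u)).
  by apply: le_trans rN _; rewrite lerDr radius_ge0.
rewrite -lerBlDr; apply: admissible_le; split; first by apply/andP; split; lra.
move=> v s Hv vw /andP[s0 sr]; apply: rP => //.
  apply: le_lt_trans (NB Hv Hw Hu) _; lra.
by apply/andP; split; lra.
Qed.

Lemma radius_gt0 u : H u -> 0 < N (dir u) -> 0 < radius u.
Proof.
move=> Hu /(descent Hu)[r r0 rP].
apply: (@lt_le_trans _ _ (Num.min r 1)); first by rewrite lt_min r0 ltr01.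
apply: admissible_le; split.
  by rewrite ge_min lexx orbT andbT le_min ler01 ltW.
move=> w s Hw; rewrite lt_min le_min => /andP[h1 _] /andP[h2 /andP[h3 _]].
by apply: rP => //; rewrite h2.
Qed.

(** Half of the radius, because the supremum need not be admissible. *)
Definition step u := u + (radius u / 2) *: dir u.

Lemma step_descent u s : H u -> 0 <= s <= radius u / 2 ->
  I (u + s *: dir u) <= I u - s * (m / 4 * N (dir u) ^+ 2).
Proof.
move=> Hu /andP[s0 sr].
have [r0|r0] := ltP 0 (radius u); last first.
  have -> : s = 0 by have := radius_ge0 u; lra.
  by rewrite scale0r addr0 mul0r subr0.
have [|r [/andP[ra rb] rP] hr] :=
  @sup_adherent _ [set r | admissible u r] (radius u / 2) _ (has_sup_admissible u).
  by lra.
rewrite -/(radius u) in hr.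
apply: rP => //; first by rewrite subrr N0; lra.
by rewrite s0; lra.
Qed.

Let Hstep u : H u -> H (step u).
Proof. by move=> Hu; apply: HD => //; apply: HZ; exact: Hdir. Qed.

Let Hiter n u : H u -> H (iter n step u).
Proof. by move=> Hu; elim: n => //= n; exact: Hstep. Qed.

Let I_step u : H u -> I (step u) <= I u - radius u / 2 * (m / 4 * N (dir u) ^+ 2).
Proof.
by move=> Hu; apply: step_descent; rewrite // lexx andbT divr_ge0.
Qed.

Let I_step_le u : H u -> I (step u) <= I u.
Proof.
move=> Hu; apply: le_trans (I_step Hu) _; rewrite gerBl.
by rewrite !mulr_ge0 ?sqr_ge0// ltW.
Qed.

Lemma step_continuous u (e : R) : H u -> 0 < e -> exists2 r : R, 0 < r &
  forall v, H v -> N (v - u) < r -> N (step v - step u) < e.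
Proof.
move=> Hu e0; have e30 : 0 < e / 3 by lra.
have [r r0 rP] := dir_continuous Hu e30.
set n := N (dir u); have n0 : 0 <= n := N_ge0 _.
have n1 : 0 < n + 1 by lra.
exists (Num.min r (e / 3 / (n + 1))).
  by rewrite lt_min r0 divr_gt0.
move=> v Hv; rewrite lt_min ltr_pdivlMr// => /andP[h1 h2].
have Hdu := Hdir Hu; have Hdv := Hdir Hv.
have -> : step v - step u = (v - u) + ((radius v / 2) *: (dir v - dir u)
    + (radius v / 2 - radius u / 2) *: dir u).
  by rewrite scalerBl scalerBr subrKA /step opprD addrACA.
have h3 := rP v Hv h1.
have Nvu := N_ge0 (v - u).
apply: le_lt_trans (ND _ _) _; [exact: HB|by apply: HD; apply: HZ => //; exact: HB|].
have h4 : N ((radius v / 2) *: (dir v - dir u)) <= e / 3.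
  rewrite NZ; last exact: HB.
  rewrite ger0_norm ?divr_ge0//.
  have := radius_le1 v; have := radius_ge0 v; have := N_ge0 (dir v - dir u); nra.
have h5 : N ((radius v / 2 - radius u / 2) *: dir u) <= N (v - u) * n.
  rewrite NZ// -/n ler_wpM2r// ler_norml.
  have := radius_lip Hu Hv; have := radius_lip Hv Hu; rewrite (NBC Hu Hv).
  by move=> ? ?; apply/andP; split; lra.
have h6 := ND (HZ (radius v / 2) (HB Hdv Hdu)) (HZ (radius v / 2 - radius u / 2) Hdu).
have h7 : N (v - u) * n + N (v - u) < e / 3 by lra.
lra.
Qed.

Lemma iter_step_continuous k u (e : R) : H u -> 0 < e -> exists2 r : R, 0 < r &
  forall v, H v -> N (v - u) < r -> N (iter k step v - iter k step u) < e.
Proof.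
move=> Hu; elim: k e => [|k IH] e e0; first by exists e.
have [r r0 rP] := step_continuous (Hiter k Hu) e0.
have [q q0 qP] := IH _ r0.
by exists q => // v Hv vu /=; apply: rP; [exact: Hiter|exact: qP].
Qed.

Let I_iter_le u k l : H u -> (k <= l)%N -> I (iter l step u) <= I (iter k step u).
Proof.
move=> Hu /subnK <-; elim: (l - k)%N => //= j.
by apply: le_trans; apply: I_step_le; exact: Hiter.
Qed.

(** If the slopes [N (dir _)] stayed above [e], the length of the orbit would be
    bounded by its loss of [I], so that the orbit would converge.  The limit has a
    positive radius, hence so have the late points of the orbit, and each late step
    loses a fixed amount of [I], although [I >= c]. *)
Lemma orbit_slope_tail u (c e : R) : H u -> 0 < e ->
  (forall k, c <= I (iter k step u)) -> exists k, N (dir (iter k step u)) < e.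
Proof.
move=> Hu e0 Ic; apply: contrapT => /forallNP ne.
have dge k : e <= N (dir (iter k step u)) by have /negP := ne k; rewrite -leNgt.
set y := fun k => iter k step u.
have Hy k : H (y k) by exact: Hiter.
have hi : has_inf [set I (y k) | k in [set: nat]].
  split; first by exists (I (y 0%N)), 0%N.
  by exists c => _ [k _ <-]; exact: Ic.
set L := inf [set I (y k) | k in [set: nat]].
have Lle k : L <= I (y k) by apply: ge_inf; [exact: hi.2|exists k].
have Ladh (r : R) : 0 < r -> exists k, I (y k) < L + r.
  by move=> r0; have [_ [k _ <-]] := inf_adherent r0 hi; exists k.
pose q : R := m * e / 4; have q0 : 0 < q by rewrite divr_gt0// mulr_gt0.
have len1 k : q * N (y k.+1 - y k) <= I (y k) - I (y k.+1).
  have -> : y k.+1 - y k = (radius (y k) / 2) *: dir (y k).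
    by rewrite /y/= /step addrAC subrr add0r.
  rewrite (NZ _ (Hdir (Hy k))) ger0_norm ?divr_ge0//.
  have := I_step (Hy k); rewrite -/(y k.+1).
  have := dge k; rewrite -/(y k) => h1.
  have h2 := radius_ge0 (y k).
  have : q * N (dir (y k)) <= m / 4 * N (dir (y k)) ^+ 2.
    by rewrite /q expr2 mulrA ler_wpM2r// mulrAC ler_wpM2l// divr_ge0// ltW.
  move=> /(ler_wpM2l (ltac:(lra) : 0 <= radius (y k) / 2)); lra.
have len k j : q * N (y (j + k)%N - y k) <= I (y k) - I (y (j + k)%N).
  elim: j => [|j IH]; first by rewrite add0n !subrr N0 mulr0.
  have h1 := len1 (j + k)%N; rewrite -addSn in h1.
  have := NB (Hy (j.+1 + k)%N) (Hy (j + k)%N) (Hy k).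
  by move=> /(ler_wpM2l (ltW q0)); lra.
have tail k l : (k <= l)%N -> q * N (y l - y k) <= I (y k) - L.
  by move=> /subnK <-; apply: le_trans (len _ _) _; rewrite lerD2l lerN2 Lle.
have [|v Hv yv] := N_complete Hy.
  move=> r r0; have [|k kP] := Ladh (q * (r / 2)); first by rewrite mulr_gt0// divr_gt0.
  exists k => i j ki kj.
  have h1 := tail _ _ ki; have := tail _ _ kj.
  have := NB (Hy i) (Hy k) (Hy j); rewrite (NBC (Hy k) (Hy j)) => h2 h3.
  have : q * N (y i - y j) < q * r.
    move: (ler_wpM2l (ltW q0) h2) => ?; lra.
  by rewrite ltr_pM2l.
have dv : e <= N (dir v).
  apply/ler_addgt0Pr => r r0; have [s s0 sP] := dir_continuous Hv r0.
  have [k kP] := yv _ s0; have := sP _ (Hy k) (kP _ (leqnn k)).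
  have := ND (HB (Hdir (Hy k)) (Hdir Hv)) (Hdir Hv); rewrite subrK.
  have := dge k; rewrite -/(y k); lra.
have rv := radius_gt0 Hv (lt_le_trans e0 dv).
have [k1 k1P] := yv _ (ltac:(lra) : 0 < radius v / 2).
pose de : R := radius v / 4 * (m / 4 * e ^+ 2).
have de0 : 0 < de.
  by rewrite /de !mulr_gt0// ?exprn_gt0// divr_gt0.
have [k2 k2P] := Ladh _ de0.
set k := maxn k1 k2.
have h1 : I (y k) < L + de.
  by apply: le_lt_trans k2P; apply: I_iter_le => //; exact: leq_maxr.
have h2 := k1P k (leq_maxl _ _).
have h3 := radius_lip Hv (Hy k).
have h4 := I_step (Hy k); rewrite -/(y k.+1) in h4.
have h5 := Lle k.+1.
have h6 := dge k; rewrite -/(y k) in h6.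
have h7 : m / 4 * e ^+ 2 <= m / 4 * N (dir (y k)) ^+ 2.
  apply: ler_wpM2l; first by rewrite divr_ge0// ltW.
  by rewrite ler_pXn2r ?nnegrE// ltW.
have h8 : de <= radius (y k) / 2 * (m / 4 * N (dir (y k)) ^+ 2).
  rewrite /de ler_pM//; try lra.
  by rewrite mulr_ge0 ?sqr_ge0// divr_ge0// ltW.
lra.
Qed.

Lemma orbit_slope u (c e : R) k0 : H u -> 0 < e ->
  (forall k, c <= I (iter k step u)) ->
  exists2 k, (k0 <= k)%N & N (dir (iter k step u)) < e.
Proof.
move=> Hu e0 Ic.
have [k|k kP] := @orbit_slope_tail (iter k0 step u) c e (Hiter _ Hu) e0.
  by rewrite -iterD.
by exists (k + k0)%N; rewrite ?leq_addl// iterD.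
Qed.

Variables (theta CA : R).
Hypothesis (theta_gt2 : 2 < theta)
  (AR : forall u, H u -> theta * J u <= dJ u u + CA).
Hypothesis compact_embedding : forall (u : nat -> X) (B : R),
  (forall k, H (u k)) -> (forall k, N (u k) <= B) ->
  exists2 v, H v & forall (e : R) n, 0 < e ->
    exists2 k, (n <= k)%N & S (u k - v) < e.

(** One half of Euler's identity for the homogeneous [psi], from comparing [K u] with
    its own multiples. *)
Let dJ_resolvent u : H u -> dJ u (K u) <= 2 * psi (K u).
Proof.
move=> Hu; have [Hz zP] := resolventP Hu.
rewrite leNgt; apply/negP => lt2.
set D := dJ u (K u) - 2 * psi (K u).
have D0 : 0 < D by rewrite subr_gt0.
have P0 := psi_ge0 Hz.
set s : R := D / (2 * (psi (K u) + 1)).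
have s0 : 0 < s by rewrite divr_gt0//; lra.
have sE : s * (2 * (psi (K u) + 1)) = D.
  by rewrite mulfVK// gt_eqF//; lra.
have := zP _ (HZ (1 + s) Hz); rewrite psiZ//.
have -> : (1 + s) *: K u - K u = s *: K u.
  by rewrite scalerDl scale1r addrAC subrr add0r.
rewrite dJZ// => /(le_trans (mulr_ge0 (divr_ge0 (ltW m_gt0) (ler0n _ 2)) (sqr_ge0 _))).
have -> : (1 + s) ^+ 2 * psi (K u) - psi (K u) - s * dJ u (K u)
  = s * (s * psi (K u) - D) by rewrite /D; ring.
rewrite pmulr_rge0//; lra.
Qed.

(** Boundedness of Palais-Smale sequences.  The functional [dJ u] is a subgradient of
    [psi] at [K u] rather than at [u], which costs a comparison of [psi (K u)] with
    [psi u]; [psi_perturb] with [1 - t = 2 / theta] makes it cheap enough to leave a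
    positive multiple of [psi u], as [theta > 2]. *)
Lemma small_slope_bounded B : exists B', forall u, H u -> I u <= B -> N (dir u) <= 1 ->
  N u <= B'.
Proof.
pose t : R := 1 - 2 / theta.
have th2 := theta_gt2; have th0 : 0 < theta by lra.
have t0 : 0 < t by rewrite /t subr_gt0 ltr_pdivrMr// mul1r.
have t1 : t < 1 by rewrite /t gtrBl divr_gt0.
pose Q : R := (theta * B + `|M| / t + CA) / (theta / 2 - 1).
exists (1 + Q / m) => u Hu IB d1.
have [Hz zP] := resolventP Hu; have Hd := Hdir Hu.
have h1 : psi (K u) <= theta / 2 * psi u + `|M| / t.
  have -> : K u = u + dir u by rewrite /dir addrC subrK.
  apply: le_trans (@psi_perturb u (dir u) t Hu Hd _) _; first by rewrite t0.
  have -> : psi u / (1 - t) = theta / 2 * psi u.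
    have -> : 1 - t = 2 / theta by rewrite /t opprB addrC subrK.
    by field; rewrite gt_eqF.
  rewrite lerD2l ler_pM2r ?invr_gt0//.
  apply: le_trans (psi_leM Hd) _.
  by rewrite ler_piMr// -(expr1n _ 2) ler_pXn2r ?nnegrE.
have h2 := dJ_resolvent Hu.
have h3 := zP _ Hu.
have h4 : 0 <= m / 2 * N (u - K u) ^+ 2 by rewrite mulr_ge0 ?sqr_ge0// divr_ge0// ltW.
have h5 := AR Hu.
rewrite dJB// in h3.
rewrite /I /action in IB.
have h6 := psi_ge Hu.
have h7 : (theta / 2 - 1) * psi u <= theta * B + `|M| / t + CA.
  have : theta * (psi u - J u) <= theta * B by rewrite ler_pM2l.
  lra.
have {}h7 : psi u <= Q by rewrite ler_pdivlMr ?[psi u * _]mulrC//; lra.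
have h8 : N u ^+ 2 <= Q / m by rewrite ler_pdivlMr// mulrC; lra.
have := N_ge0 u; nra.
Qed.

(** Some points [w k] of the orbit have slopes tending to zero, hence are bounded,
    and cluster at some [v] in the weak norm.  Then [K (w k)], and with it [w k],
    comes close to [K v] in the energy norm. *)
Lemma orbit_critical u (c : R) : H u -> (forall k, c <= I (iter k step u)) ->
  exists2 z, critical z & c <= I z <= I u.
Proof.
move=> Hu Ic.
have /choice[kap kapP] : forall n : nat, exists k,
    N (dir (iter k step u)) < n.+1%:R^-1.
  move=> n; have [|k _ kP] := @orbit_slope u c n.+1%:R^-1 0 Hu _ Ic.
    by rewrite invr_gt0.
  by exists k.
pose w n := iter (kap n) step u.
have Hw n : H (w n) by exact: Hiter.
have Iw n : I (w n) <= I u by apply: (@I_iter_le u 0).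
have [B BP] := small_slope_bounded (I u).
have wB n : N (w n) <= B.
  apply: BP => //; apply: le_trans (ltW (kapP n)) _.
  by rewrite invf_le1// ler1n.
have [v Hv vP] := compact_embedding Hw wB.
pose z := K v; have Hz : H z := HK Hv.
have wz (e : R) : 0 < e -> exists k, N (w k - z) < e /\ N (dir (w k)) < e.
  move=> e0; have e20 : 0 < e / 2 by lra.
  have [r r0 rP] := resolvent_continuous Hv e20.
  have [n0 n0P] := natSinv_small e20.
  have [k nk kv] := vP r n0 r0; exists k.
  have h1 := rP _ (Hw k) kv; have h2 := n0P _ nk; have h3 := kapP k.
  rewrite -/(w k) in h3.
  have h4 := NB (Hw k) (HK (Hw k)) Hz.
  have h5 : N (w k - K (w k)) = N (dir (w k)) by rewrite /dir NBC//; exact: HK.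
  by move: h2 h3; move: k.+1%:R^-1 => a; split; lra.
have dz : N (dir z) = 0.
  apply/eqP; rewrite eq_le N_ge0 andbT; apply/ler_addgt0Pr => e e0; rewrite add0r.
  have e20 : 0 < e / 2 by lra.
  have [r r0 rP] := dir_continuous Hz e20.
  have [|k [k1 k2]] := wz (Num.min r (e / 2)); first by rewrite lt_min r0.
  move: k1 k2; rewrite !lt_min => /andP[k1 _] /andP[_ k2].
  have := rP _ (Hw k) k1; rewrite NBC; [|exact: Hdir|exact: Hdir].
  have := ND (HB (Hdir Hz) (Hdir (Hw k))) (Hdir (Hw k)); rewrite subrK; lra.
exists z; first exact: dir0_critical.
apply/andP; split; apply/ler_addgt0Pr => e e0;
  have [r r0 rP] := I_continuous Hz e0;
  have [k [k1 _]] := wz _ r0;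
  have := rP _ (Hw k) k1; rewrite ler_norml => /andP[];
  have := Iw k; have := Ic (kap k); rewrite -/(w k); lra.
Qed.

Lemma N_IVT (g : R -> X) (a b r : R) : a <= b -> (forall t, H (g t)) ->
  (forall t (e : R), 0 < e -> exists2 d : R, 0 < d &
     forall s, `|s - t| < d -> N (g s - g t) < e) ->
  Num.min (N (g a)) (N (g b)) <= r <= Num.max (N (g a)) (N (g b)) ->
  exists2 t, a <= t <= b & N (g t) = r.
Proof.
move=> ab Hg gc rP.
have cN : continuous (N \o g).
  move=> t; apply/cvgrPdist_lt => e e0 /=.
  have [d d0 dP] := gc t e e0.
  near=> s.
  have h : N (g s - g t) < e.
    apply: dP; near: s; apply: filterS (nbhsx_ballx t _ d0) => s.
    by rewrite /ball/= distrC.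
  rewrite ltr_norml; apply/andP; split.
    have := ND (HB (Hg s) (Hg t)) (Hg t); rewrite subrK; lra.
  have := ND (HB (Hg t) (Hg s)) (Hg s); rewrite subrK (NBC (Hg t) (Hg s)); lra.
have [||t tab tr] := @IVT R (N \o g) a b r ab => //.
  exact: continuous_subspaceT.
by exists t => //; rewrite in_itv/= in tab.
Unshelve. all: by end_near. Qed.

Variables (rho al : R).
Hypotheses (rho_gt0 : 0 < rho) (al_lt : al < m * rho ^+ 2)
  (J_le : forall u, H u -> N u <= rho -> J u <= al) (J0 : J 0 = 0).

Let beta : R := m * rho ^+ 2 - al.

Let barrier u : H u -> N u = rho -> beta <= I u.
Proof.
move=> Hu Nu; have := psi_ge Hu; have := J_le Hu; rewrite Nu => /(_ (lexx _)).
rewrite /I /action /beta; lra.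
Qed.

(** Between [u] and [step u] the functional [I] does not increase, so this segment
    cannot meet the sphere of radius [rho], where [I >= beta]. *)
Let segment_noncross u : H u -> I u < beta ->
  (N u < rho -> N (step u) < rho) /\ (rho < N u -> rho < N (step u)).
Proof.
move=> Hu Iu.
have Hg t : H (u + t *: dir u) by apply: HD => //; apply: HZ; exact: Hdir.
have nox : ~ (Num.min (N u) (N (step u)) <= rho <= Num.max (N u) (N (step u))).
  move=> rP.
  have [||||t tab tr] := @N_IVT (fun t => u + t *: dir u) 0 (radius u / 2) rho.
  - by rewrite divr_ge0.
  - exact: Hg.
  - move=> t e e0; have d1 : 0 < N (dir u) + 1 by have := N_ge0 (dir u); lra.
    exists (e / (N (dir u) + 1)); first by rewrite divr_gt0.
    move=> s; rewrite ltr_pdivlMr// => h.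
    have -> : u + s *: dir u - (u + t *: dir u) = (s - t) *: dir u.
      by rewrite scalerBl opprD addrACA subrr add0r.
    rewrite NZ; last exact: Hdir.
    have := normr_ge0 (s - t); lra.
  - by rewrite scale0r addr0.
  - have := step_descent Hu tab; have := barrier (Hg t) tr.
    have : 0 <= t * (m / 4 * N (dir u) ^+ 2).
      case/andP: tab => t0 _.
      by rewrite !mulr_ge0 ?sqr_ge0// ltW.
    lra.
split=> h; rewrite ltNge; apply/negP => h'; apply: nox.
  by rewrite ge_min le_max (ltW h) h' orbT.
by rewrite ge_min le_max (ltW h) h' orbT.
Qed.

Let I_iter_lt u k : H u -> I u < beta -> I (iter k step u) < beta.
Proof. by move=> Hu; apply: le_lt_trans; exact: (@I_iter_le u 0). Qed.

Let inside u k : H u -> I u < beta -> N u < rho -> N (iter k step u) < rho.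
Proof.
move=> Hu Iu Nu; elim: k => //= k IH.
by apply: (segment_noncross _ _).1; [exact: Hiter|exact: I_iter_lt|].
Qed.

Let outside u k : H u -> I u < beta -> rho < N u -> rho < N (iter k step u).
Proof.
move=> Hu Iu Nu; elim: k => //= k IH.
by apply: (segment_noncross _ _).2; [exact: Hiter|exact: I_iter_lt|].
Qed.

Let beta_gt0 : 0 < beta. Proof. by rewrite subr_gt0. Qed.

(** The orbit of [u0] stays inside the ball of radius [rho], where [I] is bounded
    below, and leads to a critical point of negative level.

    The orbits of [0] and of [e0] stay on different sides of the sphere.  Hence, for
    every [n], the image under [n] steps of the segment from [0] to [e0] meets the
    sphere: some [t n *: e0] keeps [I >= beta] during [n] steps.  A cluster point of
    [t n] keeps it forever, and its orbit leads to a critical point of level at least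
    [beta].  This replaces the deformation argument of the mountain pass theorem. *)
Lemma two_critical_points u0 e0 :
  H u0 -> N u0 < rho -> I u0 < 0 -> H e0 -> rho < N e0 -> I e0 < 0 ->
  exists u v, [/\ critical u, critical v, I u < 0 & 0 < I v].
Proof.
move=> Hu0 Nu0 Iu0 He0 Ne0 Ie0.
have Iu0b : I u0 < beta by exact: lt_trans beta_gt0.
have Ie0b : I e0 < beta by exact: lt_trans beta_gt0.
have [k|u cu /andP[_ Iu]] := @orbit_critical u0 (- al) Hu0.
  have Hk := Hiter k Hu0.
  have := J_le Hk (ltW (inside k Hu0 Iu0b Nu0)); have := psi_ge0 Hk.
  rewrite /I /action; lra.
have I0 : I 0 = 0.
  by rewrite /I /action J0 subr0 -(scale0r (0 : X)) psiZ// expr0n mul0r.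
have N00 : N 0 = 0 := N0.
have /choice[t tP] : forall n : nat, exists t : R,
    0 <= t <= 1 /\ beta <= I (iter n step (t *: e0)).
  move=> n.
  have [||||t tab tr] := @N_IVT (fun t => iter n step (t *: e0)) 0 1 rho.
  - exact: ler01.
  - by move=> t; apply: Hiter; exact: HZ.
  - move=> t e e1; have [r r0 rP] := iter_step_continuous n (HZ t He0) e1.
    have d1 : 0 < N e0 + 1 by have := N_ge0 e0; lra.
    exists (r / (N e0 + 1)); first by rewrite divr_gt0.
    move=> s; rewrite ltr_pdivlMr// => h; apply: rP; first exact: HZ.
    rewrite -scalerBl NZ//; have := normr_ge0 (s - t); lra.
  - rewrite scale0r scale1r ge_min le_max.
      have h1 : N (iter n step 0) < rho by apply: inside; rewrite ?I0 ?N00.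
    have h2 : rho < N (iter n step e0) by exact: outside.
    by rewrite (ltW h1) (ltW h2) orbT.
  - by exists t; split => //; apply: barrier => //; apply: Hiter; exact: HZ.
have [s sP] := seq_cluster (fun n => (tP n).1).
have [k|v cv /andP[Iv _]] := @orbit_critical (s *: e0) beta (HZ s He0).
  apply/ler_addgt0Pr => e e1.
  have [r r0 rP] := I_continuous (Hiter k (HZ s He0)) e1.
  have [q q0 qP] := iter_step_continuous k (HZ s He0) r0.
  have d1 : 0 < N e0 + 1 by have := N_ge0 e0; lra.
  have [|l kl ls] := sP (q / (N e0 + 1)) k; first by rewrite divr_gt0.
  have h1 : N (t l *: e0 - s *: e0) < q.
    rewrite -scalerBl NZ//; move: ls; rewrite ltr_pdivlMr//.
    have := normr_ge0 (t l - s); lra.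
  have := rP _ (Hiter k (HZ (t l) He0)) (qP _ (HZ (t l) He0) h1).
  have := I_iter_le (HZ (t l) He0) kl; have := (tP l).2.
  by rewrite ler_norml => ? ? /andP[]; lra.
exists u, v; split => //; first exact: le_lt_trans Iu0.
exact: lt_le_trans Iv.
Qed.

End CriticalPoints.

(** * Geometry of the gasket *)

Section Geometry.
Context {R : realType} (p : 'I_3 -> plane R) (V : set (plane R)).
Hypothesis hV : is_gasket p V.

Lemma contrC i j : contr p i (p j) = contr p j (p i).
Proof. by rewrite /contr addrC [X in (_, X / _)]addrC. Qed.

Lemma contr_fix i : contr p i (p i) = p i.
Proof. by rewrite /contr; case: (p i) => a b /=; congr pair; field. Qed.

Lemma contr_inj i : injective (contr p i).
Proof.
move=> [a b] [c d] [] /= /(mulIf _) h /(mulIf _) h'.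
congr pair.
  by apply: (addIr (p i).1); apply: h; rewrite invr_eq0 pnatr_eq0.
by apply: (addIr (p i).2); apply: h'; rewrite invr_eq0 pnatr_eq0.
Qed.

Lemma gasket_contr i x : V x -> V (contr p i x).
Proof. by case: hV => _ _ {2}-> Vx; exists i => //; exists x. Qed.

Lemma gasket_word w x : V x -> V (contr_word p w x).
Proof. by move=> Vx; elim: w => //= i w; exact: gasket_contr. Qed.

Lemma gasket_split x : V x -> exists i y, V y /\ x = contr p i y.
Proof.
by case: hV => _ _ {1}-> [i _ [y Vy <-]]; exists i, y.
Qed.

Lemma gasket_cell n x : V x ->
  exists (w : n.-tuple 'I_3) y, V y /\ x = contr_word p w y.
Proof.
elim: n x => [|n IH] x Vx; first by exists [tuple], x.
have [i [y [Vy ->]]] := gasket_split Vx.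
have [w [z [Vz ->]]] := IH y Vy.
by exists [tuple of i :: w], z.
Qed.

Lemma contr_word_sub w x y : contr_word p w x - contr_word p w y =
  (2^-1 ^+ size w) *: (x - y).
Proof.
elim: w => [|i w IH]; first by rewrite /= scale1r.
have -> : contr_word p (i :: w) x - contr_word p (i :: w) y =
    2^-1 *: (contr_word p w x - contr_word p w y).
  rewrite /= /contr; case: (contr_word p w x) => a b.
  by case: (contr_word p w y) => c d; congr pair => /=; rewrite /GRing.scale/=; field.
by rewrite IH scalerA /= exprS.
Qed.

Lemma gasket_bounded : exists2 B : R, 0 < B & forall x, V x -> `|x| <= B.
Proof.
case: hV => _ /compact_bounded [B [_ BP]] _.
exists (`|B| + 1); first by have := normr_ge0 B; lra.
by apply: BP; have := ler_norm B; lra.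
Qed.

Lemma gasket_closed : closed V.
Proof. by case: hV => _ cV _; apply: compact_closed cV; exact: norm_hausdorff. Qed.

Lemma half_pow_small (e : R) : 0 < e -> exists n, 2^-1 ^+ n < e.
Proof.
move=> e0; have := @cvg_geometric R 1 2^-1; rewrite ger0_norm// invf_lt1// ltr1n.
move=> /(_ isT)/cvgr0Pnorm_lt /(_ _ e0)[n _ /(_ n (leqnn n))].
by rewrite /geometric/= mul1r ger0_norm ?exprn_ge0//; exists n.
Qed.

(** The corner is the limit of the points [contr_word p (nseq n i) x0]. *)
Lemma gasket_corner i : V (p i).
Proof.
have [[x0 Vx0] _ _] := hV.
apply: gasket_closed => U; rewrite nbhs_ballP => -[e /= e0 eU].
have d0 : 0 < `|p i - x0| + 1 by have := normr_ge0 (p i - x0); lra.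
have [n nP] := half_pow_small (divr_gt0 e0 d0).
exists (contr_word p (nseq n i) x0); split; first exact: gasket_word.
apply: eU; rewrite -ball_normE /=.
have fixn : contr_word p (nseq n i) (p i) = p i.
  by elim: n {nP} => //= n ->; exact: contr_fix.
rewrite -{1}fixn contr_word_sub normrZ size_nseq ger0_norm ?exprn_ge0//.
move: nP; rewrite ltr_pdivlMr//; have := normr_ge0 (p i - x0).
have : 0 <= 2^-1 ^+ n :> R by rewrite exprn_ge0.
nra.
Qed.

Lemma gasket_vertex w i : V (vertex p w i).
Proof. exact/gasket_word/gasket_corner. Qed.

Lemma vertex_dense x (e : R) : V x -> 0 < e ->
  exists w, `|x - vertex p w ord0| < e.
Proof.
move=> Vx e0; have [B B0 BP] := gasket_bounded.
have d0 : 0 < 2 * B by lra.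
have [n nP] := half_pow_small (divr_gt0 e0 d0).
have [w [y [Vy ->]]] := gasket_cell n Vx; exists w.
rewrite /vertex contr_word_sub normrZ size_tuple ger0_norm ?exprn_ge0//.
move: nP; rewrite ltr_pdivlMr//; apply: le_lt_trans.
rewrite ler_wpM2l ?exprn_ge0//; apply: le_trans (ler_normB _ _) _.
have := BP _ Vy; have := BP _ (gasket_corner ord0); lra.
Qed.

Lemma contr_word_continuous w : continuous (contr_word p w).
Proof.
move=> x; apply/cvgrPdist_lt => e e0.
near=> y; rewrite contr_word_sub normrZ.
apply: le_lt_trans (_ : `|x - y| < e).
  rewrite ler_piMl// ger0_norm ?exprn_ge0// exprn_ile1 ?invr_ge0//.
  by rewrite invf_le1// ler1n.
by near: y; apply: (@cvgr_dist_lt _ _ _ _ _ id).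
Unshelve. all: by end_near. Qed.

(** The cells of level [n] that miss [x] form a finite union of compact sets, so the
    points of the gasket near [x] share a cell with [x]. *)
Lemma cell_continuous (u : plane R -> R) :
  (forall e : R, 0 < e -> exists n, forall (w : n.-tuple 'I_3) x y,
     V x -> V y -> `|u (contr_word p w x) - u (contr_word p w y)| < e) ->
  {within V, continuous u}.
Proof.
move=> osc; apply/subspace_continuousP => x Vx.
apply/cvgrPdist_lt => e e0; have [n nP] := osc e e0.
pose bad := [set w : n.-tuple 'I_3 | ~ (contr_word p w @` V) x].
have cl : closed (\bigcup_(w in bad) (contr_word p w @` V)).
  apply: closed_bigcup; first exact: finite_finset.
  move=> w _; apply: compact_closed; first exact: norm_hausdorff.
  apply: continuous_compact; last by case: hV.
  by apply: continuous_subspaceT; exact: contr_word_continuous.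
have nx : ~ (\bigcup_(w in bad) (contr_word p w @` V)) x by case.
have := closed_openC cl; rewrite openE => /(_ x nx).
apply: filterS => y ny Vy.
have [w [z [Vz yE]]] := gasket_cell n Vy.
have [wx|wx] := pselect ((contr_word p w @` V) x); last first.
  by exfalso; apply: ny; exists w => //; exists z.
by case: wx => t Vt xE; rewrite -xE yE; exact: nP.
Qed.

End Geometry.

(** * Graph energies *)

Section GraphEnergy.
Context {R : realType} (p : 'I_3 -> plane R).
Implicit Types (u v a : plane R -> R) (e : plane R -> plane R -> R).

Let i0 : 'I_3 := ord0.
Let i1 : 'I_3 := lift ord0 ord0.
Let i2 : 'I_3 := lift ord0 (lift ord0 ord0).

Lemma sum_I3 (F : 'I_3 -> R) : \sum_i F i = F i0 + F i1 + F i2.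
Proof. by rewrite !big_ord_recl big_ord0 addr0 addrA. Qed.

Lemma sum_pairs (F : 'I_3 -> 'I_3 -> R) :
  \sum_(i < 3) \sum_(j < 3 | (i < j)%N) F i j = F i0 i1 + F i0 i2 + F i1 i2.
Proof.
rewrite sum_I3; do !rewrite big_mkcond sum_I3 /=.
by rewrite !add0r !addr0.
Qed.

Lemma I3_cases (P : 'I_3 -> Prop) : P i0 -> P i1 -> P i2 -> forall i, P i.
Proof.
move=> P0 P1 P2 [[|[|[|i]]] hi] //.
- by have -> : Ordinal hi = i0 by exact: val_inj.
- by have -> : Ordinal hi = i1 by exact: val_inj.
- by have -> : Ordinal hi = i2 by exact: val_inj.
Qed.

Lemma edge_sum0 e :
  edge_sum p 0 e = e (p i0) (p i1) + e (p i0) (p i2) + e (p i1) (p i2).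
Proof.
rewrite /edge_sum (big_pred1 [tuple]) ?sum_pairs//.
by move=> w; rewrite [w]tuple0 /= eqxx.
Qed.

Lemma edge_sumS n e : edge_sum p n.+1 e =
  \sum_k edge_sum p n (fun x y => e (contr p k x) (contr p k y)).
Proof.
rewrite /edge_sum [RHS]pair_big_dep/=.
rewrite [LHS](reindex (fun kw : 'I_3 * n.-tuple 'I_3 => [tuple of kw.1 :: kw.2])) //=.
exists (fun w : n.+1.-tuple 'I_3 => (thead w, [tuple of behead w])) => [[k w] _|w _].
  by congr pair; exact: val_inj.
by rewrite [RHS]tuple_eta; exact: val_inj.
Qed.

Lemma ler_edge_sum n e e' :
  (forall (w w' : seq 'I_3) i j, e (vertex p w i) (vertex p w' j) <=
      e' (vertex p w i) (vertex p w' j)) ->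
  edge_sum p n e <= edge_sum p n e'.
Proof.
by move=> h; do 3 apply: ler_sum => ? _; exact: h.
Qed.

Lemma eq_edge_sum n e e' :
  (forall (w w' : seq 'I_3) i j, e (vertex p w i) (vertex p w' j) =
      e' (vertex p w i) (vertex p w' j)) ->
  edge_sum p n e = edge_sum p n e'.
Proof.
by move=> h; do 3 apply: eq_bigr => ? _; exact: h.
Qed.

Lemma edge_sum_lin n (a b c : R) e e' e'' :
  edge_sum p n (fun x y => a * e x y + b * e' x y + c * e'' x y) =
  a * edge_sum p n e + b * edge_sum p n e' + c * edge_sum p n e''.
Proof.
rewrite /edge_sum !mulr_sumr -!big_split; apply: eq_bigr => w _ /=.
rewrite !mulr_sumr -!big_split; apply: eq_bigr => i _ /=.
by rewrite !mulr_sumr -!big_split; apply: eq_bigr => j _.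
Qed.

(** [wgenergy a n u] and [genergy n u] are the terms of the sequences that define
    [weighted_energy] and [energy]. *)
Definition wgenergy a n u : R := (5 / 3) ^+ n *
  edge_sum p n (fun x y => (a x + a y) / 2 * `|u x - u y| ^+ 2).

Definition genergy n u : R :=
  (5 / 3) ^+ n * edge_sum p n (fun x y => `|u x - u y| ^+ 2).

Lemma genergyS n u : genergy n.+1 u =
  5 / 3 * \sum_k genergy n (u \o contr p k).
Proof.
by rewrite /genergy edge_sumS exprS -mulrA -mulr_sumr.
Qed.

Lemma genergy_ge0 n u : 0 <= genergy n u.
Proof.
by rewrite mulr_ge0 ?exprn_ge0//; do 3 apply: sumr_ge0 => ? _; exact: sqr_ge0.
Qed.

(** Refining a single triangle, the sum over the nine small edges is least when each
    midpoint takes the weighted mean, with weights 2/5, 2/5 and 1/5, of the corner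
    values; [dx], [dy], [dz] below are the deviations from these means.  The factor
    5/3 makes the minimum equal to the energy of the triangle. *)
Lemma genergy_mono_step n u : genergy n u <= genergy n.+1 u.
Proof.
elim: n u => [|n IH] u.
  rewrite genergyS sum_I3 /genergy !edge_sum0 /= !expr0 !mul1r.
  rewrite !contr_fix (contrC p i1 i0) (contrC p i2 i0) (contrC p i2 i1).
  rewrite !real_normK ?num_real//.
  set A := u (p i0); set B := u (p i1); set C := u (p i2).
  set x := u (contr p i1 (p i2)); set y := u (contr p i0 (p i2)).
  set z := u (contr p i0 (p i1)).
  pose dx := x - (A + 2 * B + 2 * C) / 5.
  pose dy := y - (2 * A + B + 2 * C) / 5.
  pose dz := z - (2 * A + 2 * B + C) / 5.
  have := sqr_ge0 (dx - dy); have := sqr_ge0 (dy - dz); have := sqr_ge0 (dx - dz).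
  have := sqr_ge0 dx; have := sqr_ge0 dy; have := sqr_ge0 dz.
  rewrite /dx /dy /dz; lra.
by rewrite !genergyS ler_pM2l// ler_sum.
Qed.

Lemma genergy_mono u : {homo (fun n => genergy n u) : m n / (m <= n)%N >-> m <= n}.
Proof.
by apply: homo_leq => [x|y x z|n]; [exact: lexx|exact: le_trans|exact: genergy_mono_step].
Qed.

Lemma genergy_edge (i j : 'I_3) u : `|u (p i) - u (p j)| ^+ 2 <= genergy 0 u.
Proof.
rewrite /genergy edge_sum0 expr0 mul1r.
have h01 := sqr_ge0 `|u (p i0) - u (p i1)|.
have h02 := sqr_ge0 `|u (p i0) - u (p i2)|.
have h12 := sqr_ge0 `|u (p i1) - u (p i2)|.
have e0 : 0 ^+ 2 = 0 :> R by rewrite expr0n.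
move: i j; apply: I3_cases; apply: I3_cases; rewrite ?subrr ?normr0 ?e0;
  rewrite ?(distrC (u (p i1)) (u (p i0))) ?(distrC (u (p i2)) (u (p i0)))
    ?(distrC (u (p i2)) (u (p i1))); lra.
Qed.

Lemma genergy_contr n k u : genergy n (u \o contr p k) <= 3 / 5 * genergy n.+1 u.
Proof.
rewrite genergyS mulrA; have -> : 3 / 5 * (5 / 3) = 1 :> R by field.
rewrite mul1r (bigD1 k)//= lerDl; apply: sumr_ge0 => *; exact: genergy_ge0.
Qed.

Lemma genergy_eq n u v : (forall w i, u (vertex p w i) = v (vertex p w i)) ->
  genergy n u = genergy n v.
Proof. by move=> uv; congr (_ * _); apply: eq_edge_sum => *; rewrite !uv. Qed.

(** Passing to one of the three subcells multiplies the energy bound [C ^+ 2] by 3/5,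
    which is at most [(4 / 5) ^+ 2].  The oscillations along nested cells are thus
    dominated by a geometric series of ratio 4/5, whose sum is 5. *)
Lemma vertex_osc u (C : R) : 0 <= C -> (forall n, genergy n u <= C ^+ 2) ->
  forall w i j, `|u (vertex p w j) - u (p i)| <= 5 * C.
Proof.
move=> + + w; elim: w u C => [|k w IH] u C C0 uC i j.
  have := le_trans (genergy_edge j i u) (uC 0%N).
  by rewrite ler_pXn2r ?nnegrE// => h; apply: le_trans h _; rewrite /=; lra.
have C'0 : 0 <= 4 / 5 * C by lra.
have h1 := IH (u \o contr p k) _ C'0 _ k j.
have h2 : `|u (p k) - u (p i)| <= C.
  by have := le_trans (genergy_edge k i u) (uC 0%N); rewrite ler_pXn2r ?nnegrE.
apply: le_trans (ler_distD (u (p k)) _ _) _.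
have {}h1 : `|u (vertex p (k :: w) j) - u (p k)| <= 5 * (4 / 5 * C).
  have := h1 _; rewrite /= contr_fix; apply.
  move=> n; apply: le_trans (genergy_contr n k u) _.
  have := uC n.+1; have := sqr_ge0 C; rewrite exprMn; nra.
lra.
Qed.

Lemma genergy_word n w u :
  genergy n (u \o contr_word p w) <= (3 / 5) ^+ size w * genergy (size w + n) u.
Proof.
elim: w u n => [|k w IH] u n; first by rewrite expr0 mul1r.
apply: (le_trans (IH (u \o contr p k) n)).
rewrite exprSr -mulrA ler_wpM2l ?exprn_ge0// addSn; exact: genergy_contr.
Qed.

End GraphEnergy.

(** * The energy space *)

Lemma ultrafilter_fmap (T U : Type) (f : T -> U) (F : set_system T) :
  UltraFilter F -> UltraFilter (f @ F).
Proof.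
move=> FU; split; first exact: fmap_proper_filter.
move=> G GG FG; rewrite predeqE => A; split; last exact: FG.
move=> GA; have [//|nA] := in_ultra_setVsetC (f @^-1` A) FU.
have GnA : G (~` A) by exact: FG.
by have [x []] := filter_ex (filterI GA GnA).
Qed.

Lemma cvg_fsum (R : realType) (I : Type) (r : seq I) (P : pred I)
    (F : set_system nat) (f : I -> nat -> R) (l : I -> R) : Filter F ->
  (forall i, P i -> f i k @[k --> F] --> l i) ->
  \sum_(i <- r | P i) f i k @[k --> F] --> \sum_(i <- r | P i) l i.
Proof. by move=> FF fl; apply: cvg_big => //; exact: add_continuous. Qed.

Section EnergySpace.
Context {R : realType} (p : 'I_3 -> plane R) (V : set (plane R)).
Hypothesis hV : is_gasket p V.
Implicit Types (u v : plane R -> R^o).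

Definition energyN u : R := Num.sqrt (fine (energy p u)).
Local Notation N := energyN.
Local Notation H := (H01 p V).

Lemma energy_sup u : energy p u = ereal_sup (range (fun n => (genergy p n u)%:E)).
Proof.
rewrite /energy; apply/cvg_lim => //; apply: ereal_nondecreasing_cvgn => m n mn.
by rewrite lee_fin; exact: genergy_mono.
Qed.

Lemma energy_le u (B : R) : (forall n, genergy p n u <= B) -> (energy p u <= B%:E)%E.
Proof.
move=> uB; rewrite energy_sup; apply: ge_ereal_sup => _ [n _ <-].
by rewrite lee_fin.
Qed.

Lemma energy_ge0 u : (0 <= energy p u)%E.
Proof.
rewrite energy_sup; apply: le_trans (_ : ((genergy p 0 u)%:E <= _)%E).
  by rewrite lee_fin genergy_ge0.
by apply: ereal_sup_ubound; exists 0%N.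
Qed.

Lemma energyN_ge0 u : 0 <= N u. Proof. exact: sqrtr_ge0. Qed.

Lemma energyN_sqr u : N u ^+ 2 = fine (energy p u).
Proof. by rewrite sqr_sqrtr// fine_ge0// energy_ge0. Qed.

Lemma genergy_leN n u : H u -> genergy p n u <= N u ^+ 2.
Proof.
move=> [_ fin _]; rewrite energyN_sqr -lee_fin fineK; last first.
  by rewrite ge0_fin_numE// energy_ge0.
by rewrite energy_sup; apply: ereal_sup_ubound; exists n.
Qed.

Lemma energyN_le u (B : R) : 0 <= B -> (forall n, genergy p n u <= B ^+ 2) -> N u <= B.
Proof.
move=> B0 uB; rewrite -(@ler_pXn2r _ 2)// ?nnegrE ?energyN_ge0// energyN_sqr.
have h := energy_le uB.
rewrite -lee_fin fineK// ge0_fin_numE ?energy_ge0//.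
exact: le_lt_trans h (ltry _).
Qed.

Lemma genergyZ n (t : R) u : genergy p n (t *: u) = t ^+ 2 * genergy p n u.
Proof.
rewrite /genergy mulrCA; congr (_ * _).
have -> : edge_sum p n (fun x y => `|(t *: u) x - (t *: u) y| ^+ 2) =
    edge_sum p n (fun x y => t ^+ 2 * `|u x - u y| ^+ 2 + 0 * 0 + 0 * 0).
  apply: eq_edge_sum => w w' i j; rewrite !mul0r !addr0.
  have -> : (t *: u) (vertex p w i) - (t *: u) (vertex p w' j) =
     t * (u (vertex p w i) - u (vertex p w' j)) by rewrite mulrBr.
  by rewrite normrM exprMn real_normK ?num_real.
by rewrite edge_sum_lin !mul0r !addr0.
Qed.

Lemma sqr_perturb (x y t : R) : 0 < t < 1 ->
  `|x + y| ^+ 2 <= (1 - t)^-1 * `|x| ^+ 2 + t^-1 * `|y| ^+ 2.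
Proof.
move=> /andP[t0 t1]; rewrite !real_normK ?num_real//.
have t1' : 0 < 1 - t by lra.
rewrite -subr_ge0.
have -> : (1 - t)^-1 * x ^+ 2 + t^-1 * y ^+ 2 - (x + y) ^+ 2 =
    (t * x - (1 - t) * y) ^+ 2 / (t * (1 - t)).
  by field; rewrite !gt_eqF.
by rewrite divr_ge0 ?sqr_ge0// mulr_ge0// ltW.
Qed.

Lemma genergy_perturb n u v (t : R) : 0 < t < 1 ->
  genergy p n (u + v) <= genergy p n u / (1 - t) + genergy p n v / t.
Proof.
move=> t01; rewrite /genergy -!mulrA -mulrDr ler_wpM2l ?exprn_ge0//.
have -> : edge_sum p n (fun x y => `|u x - u y| ^+ 2) / (1 - t) +
    edge_sum p n (fun x y => `|v x - v y| ^+ 2) / t =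
    edge_sum p n (fun x y => (1 - t)^-1 * `|u x - u y| ^+ 2 +
      t^-1 * `|v x - v y| ^+ 2 + 0 * 0).
  by rewrite edge_sum_lin mul0r addr0 mulrC; congr (_ + _); rewrite mulrC.
apply: ler_edge_sum => w w' i j; rewrite mul0r addr0.
have -> : (u + v) (vertex p w i) - (u + v) (vertex p w' j) =
    (u (vertex p w i) - u (vertex p w' j)) + (v (vertex p w i) - v (vertex p w' j)).
  by rewrite -[LHS]/(u _ + v _ - (u _ + v _)) opprD addrACA.
exact: sqr_perturb.
Qed.

(** Minkowski's inequality follows from [genergy_perturb] with [t = b / (a + b)];
    [a] and [b] are enlarged by [e / 2] because they may vanish. *)
Lemma genergyD n u v (a b : R) : 0 <= a -> 0 <= b -> genergy p n u <= a ^+ 2 ->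
  genergy p n v <= b ^+ 2 -> genergy p n (u + v) <= (a + b) ^+ 2.
Proof.
move=> a0 b0 ua vb.
suff h (e : R) : 0 < e -> Num.sqrt (genergy p n (u + v)) <= a + b + e.
  rewrite -(@sqr_sqrtr _ (genergy p n (u + v))) ?genergy_ge0//.
  by rewrite ler_pXn2r ?nnegrE ?sqrtr_ge0 ?addr_ge0//; exact/ler_addgt0Pr.
move=> e0; pose a' := a + e / 2; pose b' := b + e / 2.
have a'0 : 0 < a' by rewrite /a'; lra.
have b'0 : 0 < b' by rewrite /b'; lra.
have s0 : 0 < a' + b' by rewrite addr_gt0.
have -> : a + b + e = a' + b' by rewrite /a' /b'; lra.
rewrite -[a' + b'](ger0_norm (ltW s0)) -sqrtr_sqr; apply: ler_wsqrtr.
have [|] := pselect (0 < b' / (a' + b') < 1); last first.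
  by case; rewrite divr_gt0//= ltr_pdivrMr// mul1r ltrDr.
move=> /(genergy_perturb n u v) /le_trans; apply.
have -> : 1 - b' / (a' + b') = a' / (a' + b') by field; rewrite gt_eqF.
have ua' : genergy p n u <= a' ^+ 2.
  by apply: le_trans ua _; rewrite ler_pXn2r ?nnegrE ?(ltW a'0)// /a'; lra.
have vb' : genergy p n v <= b' ^+ 2.
  by apply: le_trans vb _; rewrite ler_pXn2r ?nnegrE ?(ltW b'0)// /b'; lra.
have -> : (a' + b') ^+ 2 = a' ^+ 2 / (a' / (a' + b')) + b' ^+ 2 / (b' / (a' + b')).
  by field; rewrite !gt_eqF.
by apply: lerD; rewrite ler_pM2r// invr_gt0 divr_gt0.
Qed.

Lemma H01_0 : H (0 : plane R -> R^o).
Proof.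
split => //.
  apply/subspace_continuousP => x _; exact: cvg_cst.
apply: le_lt_trans (_ : (0%:E < _)%E); last exact: ltry.
apply: energy_le => n; rewrite -(scale0r (0 : plane R -> R^o)) genergyZ.
by rewrite expr0n mul0r.
Qed.

Lemma H01D u v : H u -> H v -> H (u + v).
Proof.
move=> Hu Hv; have [cu fu u0] := Hu; have [cv fv v0] := Hv; split.
- by move=> x; apply: cvgD; [exact: cu|exact: cv].
- apply: le_lt_trans (ltry ((N u + N v) ^+ 2)); apply: energy_le => n.
  by apply: genergyD; rewrite ?energyN_ge0 ?genergy_leN.
- by move=> x px; rewrite -[LHS]/(u x + v x) u0// v0// addr0.
Qed.

Lemma H01Z (t : R) u : H u -> H (t *: u).
Proof.
move=> Hu; have [cu fu u0] := Hu; split.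
- by move=> x; apply: cvgM; [exact: cvg_cst|exact: cu].
- apply: le_lt_trans (ltry (t ^+ 2 * N u ^+ 2)); apply: energy_le => n.
  by rewrite genergyZ ler_wpM2l ?sqr_ge0// genergy_leN.
- by move=> x px; rewrite -[LHS]/(t * u x) u0// mulr0.
Qed.

Lemma energyND u v : H u -> H v -> N (u + v) <= N u + N v.
Proof.
move=> Hu Hv; apply: energyN_le => [|n]; first by rewrite addr_ge0 ?energyN_ge0.
by apply: genergyD; rewrite ?energyN_ge0 ?genergy_leN.
Qed.

Lemma energyNZ (t : R) u : H u -> N (t *: u) = `|t| * N u.
Proof.
move=> Hu.
have le (s : R) v : H v -> N (s *: v) <= `|s| * N v.
  move=> Hv; apply: energyN_le => [|n]; first by rewrite mulr_ge0 ?energyN_ge0.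
  by rewrite genergyZ exprMn real_normK ?num_real// ler_wpM2l ?sqr_ge0// genergy_leN.
apply/eqP; rewrite eq_le le//=.
have [->|t0] := eqVneq t 0; first by rewrite normr0 mul0r energyN_ge0.
have := le t^-1 (t *: u) (H01Z t Hu).
rewrite scalerA mulVf// scale1r normfV ler_pdivlMl ?normr_gt0//.
Qed.

(** The bound of [vertex_osc] extends by density of the vertices. *)
Lemma continuous_osc u (C : R) : {within V, continuous u} -> 0 <= C ->
  (forall n, genergy p n u <= C ^+ 2) ->
  forall x i, V x -> `|u x - u (p i)| <= 5 * C.
Proof.
move=> /subspace_continuousP cu C0 uC x i Vx; apply/ler_addgt0Pr => e e0.
have /cvgrPdist_lt /(_ e e0) := cu x Vx.
rewrite /within /= => /nbhs_ballP [d /= d0 dP].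
have [w wx] := vertex_dense hV Vx d0.
have h1 : `|u x - u (vertex p w ord0)| < e.
  by apply: dP; [rewrite -ball_normE|exact: gasket_vertex].
have h2 := vertex_osc C0 uC w i ord0.
apply: le_trans (ler_distD (u (vertex p w ord0)) _ _) _.
rewrite addrC; apply: lerD => //; exact: ltW.
Qed.

Lemma sup_bound u x : H u -> V x -> `|u x| <= 5 * N u.
Proof.
move=> Hu Vx; have [cu _ u0] := Hu.
have := continuous_osc cu (energyN_ge0 u) (fun n => genergy_leN n Hu) ord0 Vx.
have -> : u (p ord0) = 0 by apply: u0; exists ord0.
by rewrite subr0.
Qed.

Lemma within_comp_word w u : {within V, continuous u} ->
  {within V, continuous (u \o contr_word p w)}.
Proof.
move=> /subspace_continuousP cu; apply/subspace_continuousP => x Vx.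
have VF := gasket_word hV w Vx.
apply: cvg_comp (cu _ VF) => A.
move=> nA; have h := @contr_word_continuous R p w x _ nA.
have {}h : nbhs x (contr_word p w @^-1` [set y | V y -> A y]) := h.
suff : nbhs x [set y | V y -> A (contr_word p w y)] by [].
by apply: filterS h => y yA Vy; apply: yA; exact: gasket_word.
Qed.

(** The restriction of [u] to a cell of level [n] has energy at most
    [(3 / 5) ^+ n * C ^+ 2], hence at most the square of [(4 / 5) ^+ n * C]. *)
Lemma cell_osc u (C : R) : {within V, continuous u} -> 0 <= C ->
  (forall n, genergy p n u <= C ^+ 2) ->
  forall w x y, V x -> V y ->
  `|u (contr_word p w x) - u (contr_word p w y)| <= 10 * ((4 / 5) ^+ size w * C).
Proof.
move=> cu C0 uC w x y Vx Vy.
have C'0 : 0 <= (4 / 5) ^+ size w * C by rewrite mulr_ge0// exprn_ge0.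
have h z : V z -> `|u (contr_word p w z) - u (contr_word p w (p ord0))| <=
    5 * ((4 / 5) ^+ size w * C).
  move=> Vz; have := @continuous_osc (u \o contr_word p w) _ (@within_comp_word w u cu) C'0 _
    z ord0 Vz.
  apply => n.
  apply: le_trans (genergy_word p n w u) _; rewrite [leRHS]exprMn.
  rewrite ler_pM ?exprn_ge0 ?genergy_ge0//.
  by rewrite exprAC lerXn2r ?nnegrE// ?exprn_ge0//; lra.
apply: le_trans (ler_distD (u (contr_word p w (p ord0))) _ _) _.
have := h _ Vx; have := h _ Vy; rewrite (distrC (u (contr_word p w y))); lra.
Qed.

Lemma pow45_small (e B : R) : 0 < e -> 0 <= B -> exists n, (4 / 5) ^+ n * B < e.
Proof.
move=> e0 B0; have B1 : 0 < B + 1 by lra.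
have := @cvg_geometric R 1 (4 / 5).
rewrite ger0_norm//; have -> : (4 / 5 < 1 :> R) by lra.
move=> /(_ isT)/cvgr0Pnorm_lt /(_ _ (divr_gt0 e0 B1))[n _ /(_ n (leqnn n))].
rewrite /geometric/= mul1r ger0_norm ?exprn_ge0// ltr_pdivlMr// => h.
exists n; apply: le_lt_trans h; rewrite ler_wpM2l ?exprn_ge0//; lra.
Qed.

(** Graph energies and the bounds of [cell_osc] involve finitely many values, so they
    pass to pointwise limits.  The uniform oscillation bound makes the limit
    continuous and the convergence uniform. *)
Lemma H01_lim (F : set_system nat) (uk : nat -> plane R -> R^o) u (B : R) :
  ProperFilter F -> 0 <= B -> (forall k, H (uk k)) ->
  (forall k n, genergy p n (uk k) <= B ^+ 2) ->
  (forall x, V x -> uk k x @[k --> F] --> u x) ->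
  [/\ H u, forall n, genergy p n u <= B ^+ 2
    & forall e : R, 0 < e -> \forall k \near F, forall x, V x -> `|uk k x - u x| <= e].
Proof.
move=> FF B0 Hk kB ku.
have uB n : genergy p n u <= B ^+ 2.
  have cE : genergy p n (uk k) @[k --> F] --> genergy p n u.
    apply: cvgM; first exact: cvg_cst.
    rewrite /edge_sum; apply: cvg_fsum => w _; apply: cvg_fsum => i _.
    apply: cvg_fsum => j _; rewrite !expr2.
    have h : `|uk k (vertex p w i) - uk k (vertex p w j)| @[k --> F] -->
        `|u (vertex p w i) - u (vertex p w j)|.
      by apply: cvg_norm; apply: cvgB; apply: ku; exact: gasket_vertex.
    exact: cvgM.
  have h : \forall k \near F, genergy p n (uk k) <= B ^+ 2 by apply: nearW => k; exact: kB.
  exact: (closed_cvg (fun x : R => x <= B ^+ 2) (@closed_le R _) h _ cE).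
have osc w x y : V x -> V y ->
    `|u (contr_word p w x) - u (contr_word p w y)| <= 10 * ((4 / 5) ^+ size w * B).
  move=> Vx Vy.
  have c : `|uk k (contr_word p w x) - uk k (contr_word p w y)| @[k --> F] -->
      `|u (contr_word p w x) - u (contr_word p w y)|.
    by apply: cvg_norm; apply: cvgB; apply: ku; exact: gasket_word.
  apply: (closed_cvg (fun r : R => r <= 10 * ((4 / 5) ^+ size w * B)) _ _ _ c);
    first exact: closed_le.
  apply: nearW => k /=.
  by have [cu _ _] := Hk k; exact: cell_osc.
have Hu : H u.
  split.
  - apply: (cell_continuous hV) => e e0.
    have [n nP] := @pow45_small (e / 10) B ltac:(lra) B0; exists n => w x y Vx Vy.
    by apply: le_lt_trans (osc _ _ _ Vx Vy) _; rewrite size_tuple; lra.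
  - exact: le_lt_trans (energy_le uB) (ltry _).
  - move=> x px; have Vx : V x by case: px => i _ <-; exact: (gasket_corner hV).
    have := ku x Vx.
    have -> : (fun k => uk k x) = (fun=> 0) by apply/funext => k; case: (Hk k) => _ _ ->.
    move=> h; apply/esym.
    by apply: (@cvg_unique _ (@norm_hausdorff R R^o) (fmap (fun=> 0) F)) => //; exact: cvg_cst.
split => // e e0.
(* [2 * (10 * (e / 40)) + e / 2 = e]: two cell oscillations and the vertices. *)
have [n nP] := @pow45_small (e / 40) B ltac:(lra) B0.
have : \forall k \near F, forall w : n.-tuple 'I_3,
    `|uk k (vertex p w ord0) - u (vertex p w ord0)| < e / 2.
  apply: filter_forall => w.
  have /cvgrPdist_lt /(_ (e / 2) ltac:(lra)) := ku _ (gasket_vertex hV w ord0).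
  by apply: filterS => k; rewrite distrC.
apply: filterS => k kP x Vx.
have [w [y [Vy ->]]] := gasket_cell hV n Vx.
have V0 := gasket_corner hV ord0.
have [ck _ _] := Hk k.
have h1 := cell_osc ck B0 (kB k) w Vy V0.
have h2 := osc w _ _ V0 Vy; have := kP w; rewrite /vertex => h3.
rewrite size_tuple in h1 h2.
apply: le_trans (ler_distD (uk k (contr_word p w (p ord0))) _ _) _.
have := ler_distD (u (contr_word p w (p ord0))) (uk k (contr_word p w (p ord0)))
  (u (contr_word p w y)).
lra.
Qed.

Definition supnorm u : R := sup [set `|u x| | x in V].
Local Notation S := supnorm.

Let V_neq0 : exists x, V x. Proof. by case: hV => -[x Vx]; exists x. Qed.

Lemma supnorm_le u (B : R) : (forall x, V x -> `|u x| <= B) -> S u <= B.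
Proof.
move=> uB; have [x Vx] := V_neq0.
by apply: ge_sup => [|_ [y Vy <-]]; [exists `|u x|, x|exact: uB].
Qed.

Lemma le_supnorm u x : H u -> V x -> `|u x| <= S u.
Proof.
move=> Hu Vx; apply: ub_le_sup; last by exists x.
by exists (5 * N u) => _ [y Vy <-]; exact: sup_bound.
Qed.

Lemma supnorm_ge0 u : 0 <= S u.
Proof.
have [hs|hs] := pselect (has_sup [set `|u x| | x in V]); last by rewrite /supnorm sup_out.
have [x Vx] := V_neq0.
by apply: le_trans (normr_ge0 (u x)) _; apply: ub_le_sup; [exact: hs.2|exists x].
Qed.

Lemma supnormN u : H u -> S u <= 5 * N u.
Proof. by move=> Hu; apply: supnorm_le => x; exact: sup_bound. Qed.

Lemma supnormD u v : H u -> H v -> S (u + v) <= S u + S v.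
Proof.
move=> Hu Hv; apply: supnorm_le => x Vx.
by apply: le_trans (ler_normD _ _) _; rewrite lerD// le_supnorm.
Qed.

Lemma supnormZ (t : R) u : H u -> S (t *: u) = `|t| * S u.
Proof.
move=> Hu.
have le (s : R) v : H v -> S (s *: v) <= `|s| * S v.
  move=> Hv; apply: supnorm_le => x Vx.
  by rewrite [`|_|]normrM ler_wpM2l// le_supnorm.
apply/eqP; rewrite eq_le le//=.
have [->|t0] := eqVneq t 0; first by rewrite normr0 mul0r supnorm_ge0.
have := le t^-1 (t *: u) (H01Z t Hu).
by rewrite scalerA mulVf// scale1r normfV ler_pdivlMl ?normr_gt0.
Qed.

Lemma H01B u v : H u -> H v -> H (u - v).
Proof. by move=> Hu Hv; rewrite -scaleN1r; apply: H01D => //; exact: H01Z. Qed.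

Lemma energyNBC u v : H u -> H v -> N (u - v) = N (v - u).
Proof.
by move=> Hu Hv; rewrite -opprB -scaleN1r energyNZ ?normrN1 ?mul1r//; exact: H01B.
Qed.

Lemma energyN_bounded u v : H u -> H v -> N u <= N (u - v) + N v.
Proof. by move=> Hu Hv; have := energyND (H01B Hu Hv) Hv; rewrite subrK. Qed.

(** [H01_lim] is used twice: for the sequence, which puts the limit [v] in the space,
    and for the differences [u l - u k], which bounds the energy of [v - u k]. *)
Lemma H01_complete (u : nat -> plane R -> R^o) : (forall k, H (u k)) ->
  (forall e : R, 0 < e -> exists k0, forall k l, (k0 <= k)%N -> (k0 <= l)%N ->
     N (u k - u l) < e) ->
  exists2 v, H v & forall e : R, 0 < e -> exists k0, forall k, (k0 <= k)%N ->
     N (u k - v) < e.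
Proof.
move=> Hu cau.
have ptc x : V x -> cvgn (fun k => u k x).
  move=> Vx; apply/cauchy_cvgP; apply: cauchy_exP => e e0.
  have [k0 kP] := cau (e / 5) ltac:(lra).
  exists (u k0 x); exists k0 => // k /= k0k; rewrite -ball_normE /=.
  have := sup_bound (H01B (Hu k0) (Hu k)) Vx; have := kP _ _ (leqnn k0) k0k.
  have -> : (u k0 - u k) x = u k0 x - u k x by [].
  lra.
pose v x := limn (fun k => u k x).
have [k1 k1P] := cau 1 ltr01.
have uv x : V x -> u (k + k1)%N x @[k --> \oo] --> v x.
  by move=> Vx; have := ptc x Vx; rewrite -(cvg_shiftn k1).
pose B := 1 + N (u k1).
have B0 : 0 <= B by rewrite addr_ge0// energyN_ge0.
have [|||Hv _ _] := @H01_lim (\oo) (fun k => u (k + k1)%N) v B _ B0.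
- by move=> k; exact: Hu.
- move=> k n; apply: le_trans (genergy_leN n (Hu _)) _.
  rewrite ler_pXn2r ?nnegrE ?energyN_ge0//.
  apply: le_trans (energyN_bounded (Hu _) (Hu k1)) _.
  by rewrite lerD2r ltW// k1P// leq_addl.
- exact: uv.
exists v => // e e0.
have [k0 kP] := cau (e / 2) ltac:(lra); exists k0 => k k0k.
have e20 : 0 <= e / 2 by lra.
have [|||Hw wB _] := @H01_lim (\oo) (fun l => u (l + k0)%N - u k) (v - u k) (e / 2) _ e20.
- by move=> l; exact: H01B.
- move=> l n; apply: le_trans (genergy_leN n (H01B (Hu _) (Hu _))) _.
  by rewrite ler_pXn2r ?nnegrE ?energyN_ge0// ltW// kP// leq_addl.
- move=> x Vx; apply: cvgB; last exact: cvg_cst.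
  by have := ptc x Vx; rewrite -(cvg_shiftn k0).
rewrite energyNBC//; apply: le_lt_trans (energyN_le e20 wB) _; lra.
Qed.

(** Along an ultrafilter every bounded real sequence converges, so that [H01_lim]
    applies without a diagonal extraction of subsequences. *)
Lemma H01_compact (u : nat -> plane R -> R^o) (B : R) :
  (forall k, H (u k)) -> (forall k, N (u k) <= B) ->
  exists2 v, H v & forall (e : R) n, 0 < e ->
    exists2 k, (n <= k)%N & S (u k - v) < e.
Proof.
move=> Hu uB.
have B0 : 0 <= B by apply: le_trans (uB 0%N); exact: energyN_ge0.
have [G [GU ooG]] := @ultraFilterLemma nat \oo _.
have ptc x : V x -> exists l : R, u k x @[k --> G] --> l.
  move=> Vx; have := @segment_compact R (- (5 * B)) (5 * B); rewrite compact_ultra.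
  move=> /(_ (u k x @[k --> G]) _)[||l [_ gl]]; last by exists l.
  - exact: ultrafilter_fmap.
  - suff : G [set k | `[- (5 * B), 5 * B]%classic (u k x)] by [].
    apply: filterE => k /=; rewrite in_itv/= -ler_norml.
    by apply: le_trans (sup_bound (Hu k) Vx) _; rewrite ler_pM2l.
have /choice[v vP] : forall x, exists l : R, V x -> u k x @[k --> G] --> l.
  move=> x; have [Vx|nVx] := pselect (V x); last by exists 0.
  by have [l lP] := ptc x Vx; exists l.
have [||Hv _ uni] := @H01_lim G u v B _ B0 Hu.
- move=> k n; apply: le_trans (genergy_leN n (Hu _)) _.
  by rewrite ler_pXn2r ?nnegrE ?energyN_ge0.
- exact: vP.
exists v => // e n e0.
have [k [kn ke]] : exists k, (n <= k)%N /\ forall x, V x -> `|u k x - v x| <= e / 2.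
  have /filter_ex [k [h1 h2]] : G ([set k | (n <= k)%N] `&`
      [set k | forall x, V x -> `|u k x - v x| <= e / 2]).
    by apply: filterI; [apply: ooG; exists n|apply: uni; lra].
  by exists k.
exists k => //; apply: le_lt_trans (_ : e / 2 < e); last lra.
exact: supnorm_le.
Qed.

End EnergySpace.

(** * The weighted energy *)

Section LimSup.
Context {R : realType}.
Implicit Types (s : nat -> R) (c : R).

Lemma limn_esup_le s c n0 : (forall n, (n0 <= n)%N -> s n <= c) ->
  (limn_esup (fun n => (s n)%:E) <= c%:E)%E.
Proof.
move=> sc; apply: (@le_trans _ _ (ereal_sup [set (s n)%:E | n in [set n | (n0 <= n)%N]])).
  by apply: ereal_inf_lbound; exists [set n | (n0 <= n)%N] => //; exists n0.
by apply: ge_ereal_sup => _ [n nn <-]; rewrite lee_fin; exact: sc.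
Qed.

Lemma limn_esup_ge s c n0 : (forall n, (n0 <= n)%N -> c <= s n) ->
  (c%:E <= limn_esup (fun n => (s n)%:E))%E.
Proof.
move=> sc; apply: le_ereal_inf_tmp => _ [A [k _ kA] <-].
apply: (@le_trans _ _ (s (maxn k n0))%:E).
  by rewrite lee_fin sc// leq_maxr.
by apply: ereal_sup_ubound; exists (maxn k n0) => //; apply: kA; exact: leq_maxl.
Qed.

Lemma limn_esup_near s c (e : R) : limn_esup (fun n => (s n)%:E) = c%:E -> 0 < e ->
  exists n0, forall n, (n0 <= n)%N -> s n <= c + e.
Proof.
move=> sc e0.
have : (limn_esup (fun n => (s n)%:E) < (c + e)%:E)%E by rewrite sc lte_fin ltrDl.
move=> /ereal_inf_lt[_ [A [k _ kA] <-] lt].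
exists k => n kn; rewrite -lee_fin; apply: le_trans (ltW lt).
by apply: ereal_sup_ubound; exists n => //; exact: kA.
Qed.

End LimSup.

Section WeightedEnergy.
Context {R : realType} (p : 'I_3 -> plane R) (V : set (plane R)).
Variables (a : plane R -> R) (am ap : R).
Hypothesis (am_gt0 : 0 < am) (a_ge : forall x, Vinf p x -> am <= a x)
  (a_le : forall x, Vinf p x -> a x <= ap).
Local Notation N := (energyN p).
Local Notation H := (H01 p V).
Implicit Types (u v : plane R -> R^o).

Definition weighted_form u : R := fine (weighted_energy p a u).
Local Notation Ea := weighted_form.
Local Notation q n u := (wgenergy p a n u).

Let Vinf_vertex w i : Vinf p (vertex p w i).
Proof. by exists (w, i). Qed.

Let edge_sumZ n (c : R) e : edge_sum p n (fun x y => c * e x y) = c * edge_sum p n e.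
Proof.
have := edge_sum_lin p n c 0 0 e e e; rewrite !mul0r !addr0 => <-.
by apply: eq_edge_sum => *; rewrite !mul0r !addr0.
Qed.

Lemma wgenergy_ge n u : am * genergy p n u <= q n u.
Proof.
rewrite mulrCA ler_wpM2l ?exprn_ge0// -edge_sumZ; apply: ler_edge_sum => w w' i j.
rewrite ler_wpM2r ?sqr_ge0//.
by have := a_ge (Vinf_vertex w i); have := a_ge (Vinf_vertex w' j); lra.
Qed.

Lemma wgenergy_le n u : q n u <= ap * genergy p n u.
Proof.
rewrite [leRHS]mulrCA ler_wpM2l ?exprn_ge0// -edge_sumZ.
apply: ler_edge_sum => w w' i j; rewrite ler_wpM2r ?sqr_ge0//.
by have := a_le (Vinf_vertex w i); have := a_le (Vinf_vertex w' j); lra.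
Qed.

Let ap_ge0 : 0 <= ap.
Proof.
have h := a_ge (Vinf_vertex [::] ord0); have := a_le (Vinf_vertex [::] ord0).
by have := am_gt0; lra.
Qed.

Lemma weighted_energy_le u : H u -> (weighted_energy p a u <= (ap * N u ^+ 2)%:E)%E.
Proof.
move=> Hu; apply: (@limn_esup_le _ _ _ 0) => n _.
by apply: le_trans (wgenergy_le n u) _; rewrite ler_wpM2l ?ap_ge0// (genergy_leN _ Hu).
Qed.

Lemma genergy_near u (e : R) : 0 < e ->
  exists n0, forall n, (n0 <= n)%N -> N u ^+ 2 - e <= genergy p n u.
Proof.
move=> e0.
suff [n0 n0P] : exists n, N u ^+ 2 - e <= genergy p n u.
  by exists n0 => n nn; apply: le_trans n0P _; exact: genergy_mono.
apply: contrapT => /forallNP h.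
have hl n : genergy p n u <= N u ^+ 2 - e.
  by apply/ltW; rewrite ltNge; apply/negP; exact: h.
have := energy_le hl; rewrite energyN_sqr => h'.
have fin : energy p u \is a fin_num.
  rewrite ge0_fin_numE ?energy_ge0//; exact: le_lt_trans h' (ltry _).
by move: h'; rewrite -{1}(fineK fin) lee_fin; lra.
Qed.

Lemma weighted_energy_ge u : ((am * N u ^+ 2)%:E <= weighted_energy p a u)%E.
Proof.
apply/lee_addgt0Pr => e e0; have ea0 : 0 < e / am by rewrite divr_gt0.
have [n0 n0P] := genergy_near u ea0.
rewrite -leeBlDr// -EFinB.
apply: (@limn_esup_ge _ _ _ n0) => n nn.
apply: le_trans (wgenergy_ge n u).
have -> : am * N u ^+ 2 - e = am * (N u ^+ 2 - e / am) by field; rewrite gt_eqF.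
by rewrite ler_pM2l// n0P.
Qed.

Lemma weighted_energy_fin u : H u -> weighted_energy p a u = (Ea u)%:E.
Proof.
move=> Hu; rewrite fineK// ge0_fin_numE.
  exact: le_lt_trans (weighted_energy_le Hu) (ltry _).
apply: le_trans (weighted_energy_ge u).
by rewrite lee_fin mulr_ge0 ?sqr_ge0// ltW.
Qed.

Lemma weighted_form_ge u : H u -> am * N u ^+ 2 <= Ea u.
Proof. by move=> Hu; rewrite -lee_fin -weighted_energy_fin// weighted_energy_ge. Qed.

Lemma weighted_form_le u : H u -> Ea u <= ap * N u ^+ 2.
Proof. by move=> Hu; rewrite -lee_fin -weighted_energy_fin// weighted_energy_le. Qed.

Lemma wgenergyZ n (t : R) u : q n (t *: u) = t ^+ 2 * q n u.
Proof.
rewrite [RHS]mulrCA -edge_sumZ; congr (_ * _).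
apply: eq_edge_sum => w w' i j; rewrite [RHS]mulrCA; congr (_ * _).
rewrite -[(t *: u) _]/(t * u _) -[(t *: u) (vertex p w' j)]/(t * u _) -mulrBr.
by rewrite normrM exprMn real_normK ?num_real.
Qed.

Lemma wgenergy_cvx n u v (t : R) : q n ((1 - t) *: u + t *: v) =
  (1 - t) * q n u + t * q n v - t * (1 - t) * q n (u - v).
Proof.
rewrite /wgenergy [(1 - t) * _]mulrCA [t * (_ * _)]mulrCA [t * (1 - t) * _]mulrCA.
rewrite -mulrDr -mulrBr; congr (_ * _).
rewrite -mulNr -edge_sum_lin; apply: eq_edge_sum => w w' i j.
set x := vertex p w i; set y := vertex p w' j.
rewrite !real_normK ?num_real//.
rewrite -[((1 - t) *: u + t *: v) x]/((1 - t) * u x + t * v x).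
rewrite -[((1 - t) *: u + t *: v) y]/((1 - t) * u y + t * v y).
rewrite -[(u - v) x]/(u x - v x) -[(u - v) y]/(u y - v y).
ring.
Qed.

Lemma weighted_form_near u (e : R) : H u -> 0 < e ->
  exists n0, forall n, (n0 <= n)%N -> q n u <= Ea u + e.
Proof. by move=> /weighted_energy_fin; exact: limn_esup_near. Qed.

Lemma weighted_form_leP u (c : R) n0 : H u ->
  (forall n, (n0 <= n)%N -> q n u <= c) -> Ea u <= c.
Proof.
by move=> Hu uc; rewrite -lee_fin -weighted_energy_fin//; exact: limn_esup_le uc.
Qed.

(** A limit superior of quadratic forms need not be a quadratic form, but the identity
    [wgenergy_cvx] of each level survives as an inequality: the form of [u - v] is
    bounded below by [am] times the graph energy, which converges. *)
Lemma weighted_form_cvx u v (t : R) : H u -> H v -> 0 <= t <= 1 ->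
  Ea ((1 - t) *: u + t *: v) <=
    (1 - t) * Ea u + t * Ea v - t * (1 - t) * am * N (u - v) ^+ 2.
Proof.
move=> Hu Hv /andP[t0 t1]; apply/ler_addgt0Pr => e e0.
have am0 := am_gt0.
pose d := e / (1 + am).
have d0 : 0 < d by rewrite divr_gt0//; lra.
have dE : d + am * d = e by rewrite /d; field; rewrite gt_eqF//; lra.
have [n1 n1P] := weighted_form_near Hu d0.
have [n2 n2P] := weighted_form_near Hv d0.
have [n3 n3P] := genergy_near (u - v) d0.
apply: (@weighted_form_leP _ _ (maxn n1 (maxn n2 n3))).
  by apply: H01D => //; exact: H01Z.
move=> n; rewrite !geq_max => /andP[/n1P h1 /andP[/n2P h2 /n3P h3]].
rewrite wgenergy_cvx.
have h4 := wgenergy_ge n (u - v).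
have h5 : am * (N (u - v) ^+ 2 - d) <= am * genergy p n (u - v) by rewrite ler_pM2l.
set X := q n u in h1 *; set Y := q n v in h2 *; set Z := q n (u - v) in h4 *.
have h6 : am * N (u - v) ^+ 2 - am * d <= Z by lra.
have t1' : 0 <= 1 - t by lra.
have h7 : (1 - t) * X <= (1 - t) * (Ea u + d) by rewrite ler_wpM2l.
have h8 : t * Y <= t * (Ea v + d) by rewrite ler_wpM2l.
have tt : 0 <= t * (1 - t) by rewrite mulr_ge0.
have h9 := ler_wpM2l tt h6.
have amd : 0 <= am * d by rewrite mulr_ge0// ltW.
have h10 : t * (1 - t) * (am * d) <= am * d.
  by rewrite ler_piMl// mulr_ile1//; lra.
nra.
Qed.

Lemma weighted_form_Z (t : R) u : H u -> Ea (t *: u) = t ^+ 2 * Ea u.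
Proof.
move=> Hu.
have le (s : R) v : H v -> Ea (s *: v) <= s ^+ 2 * Ea v.
  move=> Hv; apply/ler_addgt0Pr => e e0.
  have d0 : 0 < s ^+ 2 + 1 by have := sqr_ge0 s; lra.
  have [n0 n0P] := weighted_form_near Hv (divr_gt0 e0 d0).
  apply: (@weighted_form_leP _ _ n0) => [|n nn]; first exact: H01Z.
  rewrite wgenergyZ; apply: le_trans (ler_wpM2l (sqr_ge0 s) (n0P _ nn)) _.
  rewrite mulrDr lerD2l mulrCA ler_piMr ?(ltW e0)// ler_pdivrMr//; lra.
apply/eqP; rewrite eq_le le//=.
have [->|t0] := eqVneq t 0.
  have H0 : H (0 *: u) by exact: H01Z.
  rewrite expr0n mul0r; apply: le_trans (weighted_form_ge H0).
  by rewrite mulr_ge0 ?sqr_ge0// ltW.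
have := le t^-1 (t *: u) (H01Z t Hu).
by rewrite scalerA mulVf// scale1r exprVn ler_pdivlMl// exprn_even_gt0.
Qed.

End WeightedEnergy.

(** * A bump function made of harmonic functions *)

Section Junctions.
Context {R : realType} (p : 'I_3 -> plane R) (V : set (plane R)).
Hypotheses (hp : equilateral p) (hV : is_gasket p V).

(** Points of [P] lie in the cells [iii...i] of all levels, which shrink to the corner
    [p i]. *)
Lemma corner_unique (i : 'I_3) (P : set (plane R)) : P `<=` V ->
  (forall x, P x -> exists2 y, P y & x = contr p i y) -> forall x, P x -> x = p i.
Proof.
move=> PV Pi x Px; have [B B0 BP] := gasket_bounded hV.
have key n : forall y, P y -> `|y - p i| <= 2^-1 ^+ n * (2 * B).
  elim: n => [|n IH] y Py.
    rewrite expr0 mul1r; apply: le_trans (ler_normB _ _) _.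
    have := BP _ (PV _ Py); have := BP _ (gasket_corner hV i); lra.
  have [z Pz ->] := Pi y Py.
  have := contr_word_sub p [:: i] z (p i); rewrite /= contr_fix => ->.
  rewrite normrZ expr1 ger0_norm// exprS -mulrA ler_wpM2l//; exact: IH.
apply/eqP; rewrite -subr_eq0 -normr_le0; apply/ler_addgt0Pr => e e0; rewrite add0r.
have B2 : 0 < 2 * B by lra.
have [n nP] := half_pow_small (divr_gt0 e0 B2).
apply: le_trans (key n _ Px) _; apply: ltW.
by move: nP; rewrite ltr_pdivlMr.
Qed.

Let dot (x y : plane R) : R := x.1 * y.1 + x.2 * y.2.
Let centroid : plane R :=
  (((p ord0).1 + (p (lift ord0 ord0)).1 + (p (lift ord0 (lift ord0 ord0))).1) / 3,
  ((p ord0).2 + (p (lift ord0 ord0)).2 + (p (lift ord0 (lift ord0 ord0))).2) / 3).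

(** For an equilateral triangle the barycentric coordinate [i] is an affine function
    of the scalar product with [p i - centroid].  Being affine is stated for midpoints
    only, which is how the contractions act. *)
Lemma barycentric : exists bc : 'I_3 -> plane R -> R,
  [/\ forall i j, bc i (p j) = (i == j)%:R,
      forall x, \sum_i bc i x = 1,
      forall i x y, bc i ((x.1 + y.1) / 2, (x.2 + y.2) / 2) = (bc i x + bc i y) / 2
    & forall i, exists B : R, forall x, V x -> `|bc i x| <= B].
Proof.
have [l l0 lP] := hp.
have d2 i j : i != j -> ((p i).1 - (p j).1) ^+ 2 + ((p i).2 - (p j).2) ^+ 2 = l ^+ 2.
  by move=> /lP <-; rewrite /edist sqr_sqrtr// addr_ge0 ?sqr_ge0.
have := d2 ord0 (lift ord0 ord0) isT.
have := d2 ord0 (lift ord0 (lift ord0 ord0)) isT.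
have := d2 (lift ord0 ord0) (lift ord0 (lift ord0 ord0)) isT.
set p0 := p ord0; set p1 := p (lift ord0 ord0); set p2 := p (lift ord0 (lift ord0 ord0)).
move=> d12 d02 d01.
exists (fun i x => 1 / 3 + 2 / l ^+ 2 * dot (x - centroid) (p i - centroid)); split.
- have key (s t : R) : s * l ^+ 2 = t * 6 -> 1 / 3 + 2 / l ^+ 2 * t = 1 / 3 + s / 3.
    move=> st; congr (_ + _).
    have -> : t = s * l ^+ 2 / 6 by rewrite st mulfK.
    by field; rewrite gt_eqF.
  have sym (a b : plane R) : dot (a - centroid) (b - centroid) = dot (b - centroid) (a - centroid).
    by rewrite /dot mulrC [X in _ + X]mulrC.
  (* The vectors from the centroid to the corners have scalar products [l ^+ 2 / 3] on
     the diagonal and [- l ^+ 2 / 6] off it. *)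
  have q00 : 2 * l ^+ 2 = dot (p0 - centroid) (p0 - centroid) * 6.
    have -> : 2 * l ^+ 2 = (2 * l ^+ 2 * 2 + 2 * l ^+ 2 * 2 - l ^+ 2 * 2) / 3 by field.
    by rewrite -{1}d01 -{1}d02 -d12 /dot /centroid /=; field.
  have q11 : 2 * l ^+ 2 = dot (p1 - centroid) (p1 - centroid) * 6.
    have -> : 2 * l ^+ 2 = (2 * l ^+ 2 * 2 + 2 * l ^+ 2 * 2 - l ^+ 2 * 2) / 3 by field.
    by rewrite -{1}d01 -{1}d12 -d02 /dot /centroid /=; field.
  have q22 : 2 * l ^+ 2 = dot (p2 - centroid) (p2 - centroid) * 6.
    have -> : 2 * l ^+ 2 = (2 * l ^+ 2 * 2 + 2 * l ^+ 2 * 2 - l ^+ 2 * 2) / 3 by field.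
    by rewrite -{1}d02 -{1}d12 -d01 /dot /centroid /=; field.
  have q01 : -1 * l ^+ 2 = dot (p0 - centroid) (p1 - centroid) * 6.
    have -> : -1 * l ^+ 2 = (- 5 * l ^+ 2 + l ^+ 2 + l ^+ 2) / 3 by field.
    by rewrite -{1}d01 -{1}d02 -d12 /dot /centroid /=; field.
  have q02 : -1 * l ^+ 2 = dot (p0 - centroid) (p2 - centroid) * 6.
    have -> : -1 * l ^+ 2 = (- 5 * l ^+ 2 + l ^+ 2 + l ^+ 2) / 3 by field.
    by rewrite -{1}d02 -{1}d01 -d12 /dot /centroid /=; field.
  have q12 : -1 * l ^+ 2 = dot (p1 - centroid) (p2 - centroid) * 6.
    have -> : -1 * l ^+ 2 = (- 5 * l ^+ 2 + l ^+ 2 + l ^+ 2) / 3 by field.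
    by rewrite -{1}d12 -{1}d01 -d02 /dot /centroid /=; field.
  have q10 := q01; rewrite sym in q10.
  have q20 := q02; rewrite sym in q20.
  have q21 := q12; rewrite sym in q21.
  have e1 : 1 / 3 + 2 / 3 = 1 :> R by field.
  have e0 : 1 / 3 + -1 / 3 = 0 :> R by field.
  apply: I3_cases; apply: I3_cases; rewrite -?/p0 -?/p1 -?/p2;
    rewrite ?(key _ _ q00) ?(key _ _ q11) ?(key _ _ q22) ?(key _ _ q01) ?(key _ _ q02)
      ?(key _ _ q12) ?(key _ _ q10) ?(key _ _ q20) ?(key _ _ q21) ?e1 ?e0//.
- move=> x; rewrite sum_I3 -/p0 -/p1 -/p2 /dot /centroid /=.
  by field; rewrite gt_eqF.
- by move=> i x y; rewrite /dot /=; field; rewrite gt_eqF.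
- move=> i; have [B B0 BP] := gasket_bounded hV.
  set g := p i - centroid.
  exists (1 / 3 + `|2 / l ^+ 2| * (`|g.1| * (B + `|centroid.1|)
    + `|g.2| * (B + `|centroid.2|))) => x Vx.
  apply: le_trans (ler_normD _ _) _; rewrite ger0_norm// lerD2l normrM ler_wpM2l//.
  have := BP _ Vx; rewrite [`|x|]/Num.norm/= ge_max => /andP[x1 x2].
  have g1 : `|(x - centroid).1| <= B + `|centroid.1|.
    by apply: le_trans (ler_normB x.1 centroid.1) _; rewrite lerD2r.
  have g2 : `|(x - centroid).2| <= B + `|centroid.2|.
    by apply: le_trans (ler_normB x.2 centroid.2) _; rewrite lerD2r.
  rewrite /dot; apply: le_trans (ler_normD _ _) _.
  by apply: lerD; rewrite normrM mulrC ler_wpM2l.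
Qed.

(** Barycentric coordinates are nonnegative on the gasket and the coordinate [i] is at
    least 1/2 on the cell [i].  At a common point of the cells [i] and [j] both
    coordinates are therefore 1/2, which leaves the midpoint of [p i] and [p j]. *)
Lemma junction i j y z : i != j -> V y -> V z -> contr p i y = contr p j z ->
  y = p j /\ z = p i.
Proof.
have [bc [bcp bc1 bcmid bcB]] := barycentric.
have bcF k l x : bc k (contr p l x) = (bc k x + (k == l)%:R) / 2.
  by rewrite /contr bcmid bcp.
have bc_ge0 k x : V x -> 0 <= bc k x.
  move=> Vx; have [B BP] := bcB k.
  have B0 : 0 <= B by apply: le_trans (BP _ Vx).
  have key n : forall x, V x -> - (2^-1 ^+ n * B) <= bc k x.
    elim: n => [|n IH] {}x {}Vx.
      by rewrite expr0 mul1r; have := BP _ Vx; rewrite ler_norml => /andP[].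
    have [l [t [Vt ->]]] := gasket_split hV Vx.
    rewrite bcF exprS -mulrA; have := IH _ Vt.
    have : 0 <= (k == l)%:R :> R by rewrite ler0n.
    lra.
  rewrite -oppr_le0; apply/ler_addgt0Pr => e e0; rewrite add0r.
  have B1 : 0 < B + 1 by lra.
  have [n nP] := half_pow_small (divr_gt0 e0 B1).
  have := key n _ Vx; move: nP; rewrite ltr_pdivlMr//.
  have : 0 <= 2^-1 ^+ n :> R by rewrite exprn_ge0.
  move: (2^-1 ^+ n) => q; lra.
have bc_le1 k x : V x -> bc k x <= 1.
  by move=> Vx; rewrite -(bc1 x) (bigD1 k)//= lerDl sumr_ge0// => *; exact: bc_ge0.
have corner k x : V x -> bc k x = 1 -> x = p k.
  move=> Vx xk; apply: (@corner_unique k [set x | V x /\ bc k x = 1]) => // [t []//|t /= [Vt tk]].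
  have [l [t' [Vt' tE]]] := gasket_split hV Vt.
  have := tk; rewrite tE bcF; have [kl|nkl] := eqVneq k l => h.
    have {}h : (bc k t' + 1) / 2 = 1 := h.
    by exists t'; [split => //; lra|rewrite kl].
  have {}h : (bc k t' + 0) / 2 = 1 := h.
  by have := bc_le1 k _ Vt'; lra.
move=> ij Vy Vz yz.
have := congr1 (bc i) yz; have := congr1 (bc j) yz; rewrite !bcF !eqxx.
rewrite (negbTE ij) eq_sym (negbTE ij) /= !(mulr0n, mulr1n) => h1 h2.
have := bc_ge0 i _ Vy; have := bc_ge0 j _ Vz; have := bc_le1 j _ Vy; have := bc_le1 i _ Vz.
by move=> *; split; apply: corner => //; lra.
Qed.

Lemma corner_inj : injective p.
Proof.
move=> i j pij; apply/eqP/negPn/negP => ij.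
have [l l0 /(_ _ _ ij)] := hp; rewrite /edist pij !subrr expr0n /= addr0 sqrtr0.
by move=> h; rewrite -h ltxx in l0.
Qed.

End Junctions.

Section Harmonic.
Context {R : realType} (p : 'I_3 -> plane R) (V : set (plane R)).
Hypotheses (hp : equilateral p) (hV : is_gasket p V).

(** Corner values on the cell [i] of the harmonic function with corner values [v]; at
    the midpoint of [p i] and [p j] this is [(2 * v i + 2 * v j + v k) / 5]. *)
Definition subdivide (i : 'I_3) (v : 'I_3 -> R) (j : 'I_3) : R :=
  if i == j then v i else (v i + v j + \sum_k v k) / 5.

Let spread (v : 'I_3 -> R) (c : R) := forall j k, `|v j - v k| <= c.

Let spread_ge0 v c : spread v c -> 0 <= c.
Proof. by move=> /(_ ord0 ord0); rewrite subrr normr0. Qed.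

Let spread_subdivide i v c : spread v c -> spread (subdivide i v) (4 / 5 * c).
Proof.
move=> vc; have c0 := spread_ge0 vc; move=> j k; move: i j k.
have h k l : - c <= v k - v l <= c by rewrite -ler_norml vc.
have /andP[? ?] := h ord0 (lift ord0 ord0).
have /andP[? ?] := h ord0 (lift ord0 (lift ord0 ord0)).
have /andP[? ?] := h (lift ord0 ord0) (lift ord0 (lift ord0 ord0)).
by do 3 apply: I3_cases; rewrite /subdivide !sum_I3 /= ler_norml; apply/andP; split; lra.
Qed.

Let spread_ex v : exists c, spread v c.
Proof.
exists (\sum_j \sum_k `|v j - v k|) => j k.
rewrite (bigD1 j)//= (bigD1 k)//= -addrA lerDl addr_ge0 ?sumr_ge0// => *.
by rewrite sumr_ge0.
Qed.

Let subdivide_bound i v (lo hi : R) : (forall j, lo <= v j <= hi) ->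
  forall j, lo <= subdivide i v j <= hi.
Proof.
move=> h j; have /andP[? ?] := h ord0; have /andP[? ?] := h (lift ord0 ord0).
have /andP[? ?] := h (lift ord0 (lift ord0 ord0)).
have /andP[? ?] := h i; have /andP[? ?] := h j.
by rewrite /subdivide sum_I3; case: ifP => _ //; apply/andP; split; lra.
Qed.

(** A midpoint of two corners lies in two cells; one of them is selected.
    [harmonic_contr] shows that the choice does not matter. *)
Let address_ex : {s : plane R -> 'I_3 * plane R |
  forall x, V x -> V (s x).2 /\ x = contr p (s x).1 (s x).2}.
Proof.
have /choice h : forall x, exists s : 'I_3 * plane R,
    V x -> V s.2 /\ x = contr p s.1 s.2; last by case: h => s sP; exists s.
move=> x; have [Vx|nVx] := pselect (V x); last by exists (ord0, x).
by have [i [y [Vy xy]]] := gasket_split hV Vx; exists (i, y).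
Qed.

Let sel x := (sval address_ex x).1.
Let pre x := (sval address_ex x).2.

Let preV x : V x -> V (pre x).
Proof. by rewrite /pre; case: address_ex => s /= h /h[]. Qed.

Let selK x : V x -> x = contr p (sel x) (pre x).
Proof. by rewrite /pre /sel; case: address_ex => s /= h /h[]. Qed.

Fixpoint harmonic_approx n (v : 'I_3 -> R) x : R :=
  if n is n'.+1 then harmonic_approx n' (subdivide (sel x) v) (pre x) else v ord0.

Let approx_bound n v (lo hi : R) x : (forall j, lo <= v j <= hi) ->
  lo <= harmonic_approx n v x <= hi.
Proof.
by elim: n v x => [|n IH] v x h //=; apply: IH; exact: subdivide_bound.
Qed.

Let spread_bound v c i : spread v c -> forall j, v i - c <= v j <= v i + c.
Proof.
move=> vc j; have := vc i j; rewrite ler_norml => /andP[? ?].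
by apply/andP; split; lra.
Qed.

Let approx_cauchy n m v c x : spread v c ->
  `|harmonic_approx (n + m) v x - harmonic_approx n v x| <= (4 / 5) ^+ n * c.
Proof.
elim: n v c x => [|n IH] v c x vc.
  rewrite add0n expr0 mul1r /= ler_norml.
  have /andP[? ?] := @approx_bound m v _ _ x (spread_bound ord0 vc).
  by apply/andP; split; lra.
by rewrite exprSr -mulrA /=; apply: IH; exact: spread_subdivide.
Qed.

Definition harmonic v x : R := limn (fun n => harmonic_approx n v x).

Let approx_cvg v x : harmonic_approx n v x @[n --> \oo] --> harmonic v x.
Proof.
have [c vc] := spread_ex v.
suff : cvgn (fun n => harmonic_approx n v x : R^o) by [].
apply/cauchy_cvgP; apply: cauchy_exP => e e0.
have [n nP] := pow45_small e0 (spread_ge0 vc).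
exists (harmonic_approx n v x); exists n => // k /= /subnKC <-.
rewrite -ball_normE /= distrC.
by apply: le_lt_trans nP; exact: approx_cauchy.
Qed.

Lemma harmonic_bound v (lo hi : R) x : (forall j, lo <= v j <= hi) ->
  lo <= harmonic v x <= hi.
Proof.
move=> h; have hb n := @approx_bound n v _ _ x h.
apply/andP; split.
  apply: (closed_cvg (fun r : R => lo <= r) (@closed_ge R _) _ _ (@approx_cvg v x)).
  by apply: nearW => n; case/andP: (hb n).
apply: (closed_cvg (fun r : R => r <= hi) (@closed_le R _) _ _ (@approx_cvg v x)).
by apply: nearW => n; case/andP: (hb n).
Qed.

Let harmonic_rec v x : harmonic v x = harmonic (subdivide (sel x) v) (pre x).
Proof.
have h1 := @approx_cvg (subdivide (sel x) v) (pre x).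
have h2 := @approx_cvg v x; rewrite -(cvg_shiftS) in h2.
exact: (cvg_unique _ h2 h1).
Qed.

Let selp j : sel (p j) = j /\ pre (p j) = p j.
Proof.
have Vp := gasket_corner hV j.
have E := selK Vp; have Vq := preV Vp.
have [sj|sj] := eqVneq (sel (p j)) j.
  split => //; apply: (@contr_inj R p j).
  by rewrite -{1}sj -E contr_fix.
have [_ /(corner_inj hp) js] : pre (p j) = p j /\ p j = p (sel (p j)).
  by apply: (junction hp hV sj Vq Vp); rewrite -E contr_fix.
by rewrite -js eqxx in sj.
Qed.

Lemma harmonic_corner v j : harmonic v (p j) = v j.
Proof.
have [c vc] := spread_ex v.
have key n : forall v c, spread v c -> `|harmonic v (p j) - v j| <= (4 / 5) ^+ n * c.
  elim: n => [|n IH] {}v {}c {}vc.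
    rewrite expr0 mul1r ler_norml.
    have /andP[? ?] := harmonic_bound (p j) (spread_bound j vc).
    by apply/andP; split; lra.
  rewrite harmonic_rec; have [-> ->] := selp j.
  have := IH _ _ (spread_subdivide j vc); rewrite {2}/subdivide eqxx.
  by move=> h; rewrite exprSr -[leRHS]mulrA.
apply/eqP; rewrite -subr_eq0 -normr_le0; apply/ler_addgt0Pr => e e0; rewrite add0r.
have [n nP] := pow45_small e0 (spread_ge0 vc).
by apply: le_trans (key n _ _ vc) _; exact: ltW.
Qed.

Lemma harmonic_contr v i y : V y -> harmonic v (contr p i y) = harmonic (subdivide i v) y.
Proof.
move=> Vy; have Vx := gasket_contr hV i Vy.
have E := selK Vx; have Vz := preV Vx.
rewrite harmonic_rec; set s := sel _ in E *; set z := pre _ in E Vz *.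
have [si|si] := eqVneq i s.
  by move: E; rewrite -si => /contr_inj <-.
have [-> ->] := junction hp hV si Vy Vz E.
rewrite !harmonic_corner /subdivide (negbTE si) eq_sym (negbTE si).
by rewrite [v s + _]addrC.
Qed.

Let quad (v : 'I_3 -> R) : R := (v ord0 - v (lift ord0 ord0)) ^+ 2 +
  (v ord0 - v (lift ord0 (lift ord0 ord0))) ^+ 2 +
  (v (lift ord0 ord0) - v (lift ord0 (lift ord0 ord0))) ^+ 2.

(** The values of [subdivide] are the equality case of [genergy_mono_step]. *)
Lemma harmonic_energy n v : genergy p n (harmonic v) = quad v.
Proof.
elim: n v => [|n IH] v.
  by rewrite /genergy edge_sum0 expr0 mul1r !harmonic_corner !real_normK ?num_real.
rewrite genergyS.
have -> : \sum_k genergy p n (harmonic v \o contr p k) = \sum_k quad (subdivide k v).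
  apply: eq_bigr => k _; rewrite -IH; apply: genergy_eq => w i /=.
  by rewrite harmonic_contr//; exact: gasket_vertex.
by rewrite sum_I3 /quad /subdivide !sum_I3 /=; field.
Qed.

Lemma harmonic_continuous v : {within V, continuous (harmonic v)}.
Proof.
have [c vc] := spread_ex v.
have key w : forall v c x y, spread v c -> V x -> V y ->
    `|harmonic v (contr_word p w x) - harmonic v (contr_word p w y)| <=
      (4 / 5) ^+ size w * (2 * c).
  elim: w => [|k w IH] {}v {}c x y {}vc Vx Vy.
    rewrite expr0 mul1r /= ler_norml.
    have /andP[? ?] := harmonic_bound x (spread_bound ord0 vc).
    have /andP[? ?] := harmonic_bound y (spread_bound ord0 vc).
    by apply/andP; split; lra.
  rewrite /= !harmonic_contr; [|exact: gasket_word|exact: gasket_word].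
  apply: le_trans (IH _ _ _ _ (spread_subdivide k vc) Vx Vy) _.
  by rewrite exprS; lra.
have c0 := spread_ge0 vc.
apply: (cell_continuous hV) => e e0.
have [n nP] := @pow45_small R e (2 * c) e0 ltac:(lra).
exists n => w x y Vx Vy; apply: le_lt_trans nP.
by have := key w v c x y vc Vx Vy; rewrite size_tuple.
Qed.

(** Strong maximum principle.  On a cell other than [j] all corner values exceed [v j],
    hence so does the function.  A point of minimum thus lies in the cell [j], where
    the situation recurs with the same minimum at the corner [j]; so its address is
    [jjj...]. *)
Lemma harmonic_strict_min j v x : V x -> (forall i, i != j -> v j < v i) ->
  harmonic v x = v j -> x = p j.
Proof.
move=> Vx vmin hx.
apply: (@corner_unique _ p V hV j [set x | V x /\ exists2 v,
    forall i, i != j -> v j < v i & harmonic v x = v j]).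
- by move=> t [].
- move=> {vmin hx Vx v} {}x /= [Vx [v vmin hx]].
  have vle i : v j <= v i.
    by have [->|ij] := eqVneq i j; [exact: lexx|exact/ltW/vmin].
  have [i [y [Vy xE]]] := gasket_split hV Vx.
  have hy : harmonic (subdivide i v) y = v j by rewrite -harmonic_contr// -xE.
  have sum_gt : 3 * v j < \sum_k v k.
    have [k kj] : exists k, k != j.
      by move: j {vmin hx vle hy}; apply: I3_cases;
        [exists (lift ord0 ord0)|exists ord0|exists ord0].
    move: k j kj vmin vle {hx hy}; do 2 apply: I3_cases => //;
      rewrite sum_I3 => _ vmin vle;
      have h0 := vle ord0; have h1 := vle (lift ord0 ord0);
      have h2 := vle (lift ord0 (lift ord0 ord0));
      first [have := vmin ord0 isT|have := vmin (lift ord0 ord0) isT]; lra.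
  have sub_gt k : k != i -> v j < subdivide i v k.
    move=> ki; rewrite /subdivide eq_sym (negbTE ki).
    by have := vle i; have := vle k; lra.
  have [ij|ij] := eqVneq i j.
    exists y; last by rewrite -ij.
    split => //; exists (subdivide i v); last by rewrite hy ij /subdivide eqxx.
    by move=> k kj; rewrite {1}ij {1}/subdivide eqxx; apply: sub_gt; rewrite ij.
  exfalso.
  have gt k : v j < subdivide i v k.
    have [->|] := eqVneq k i; last exact: sub_gt.
    by rewrite /subdivide eqxx; exact: vmin.
  pose s k := subdivide i v k.
  pose lo := Num.min (s ord0) (Num.min (s (lift ord0 ord0)) (s (lift ord0 (lift ord0 ord0)))).
  pose hi := \sum_k `|s k|.
  have lohi : forall k, lo <= s k <= hi.
    move=> k; apply/andP; split.
      by move: k; apply: I3_cases; rewrite /lo !ge_min lexx ?orbT.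
    rewrite /hi (bigD1 k)//=; apply: le_trans (ler_norm _) _.
    by rewrite lerDl sumr_ge0.
  have /andP[h1 _] := harmonic_bound y lohi.
  have : v j < lo by rewrite /lo !lt_min !gt.
  by move=> h2; move: (lt_le_trans h2 h1); rewrite hy ltxx.
- by split => //; exists v.
Qed.

Let delta (i j : 'I_3) : R := (i == j)%:R.

(** In the cell [i] the corner values are at least 2/5; in any other cell [k] the
    corner [k] carries a strict minimum, to which [harmonic_strict_min] applies. *)
Lemma harmonic_delta_zero i x : V x -> harmonic (delta i) x = 0 -> V0 p x.
Proof.
move=> Vx; have [k [y [Vy ->]]] := gasket_split hV Vx.
rewrite harmonic_contr// => h.
have [ik|ik] := eqVneq i k.
  have b j : 2 / 5 <= subdivide k (delta i) j <= 1.
    by rewrite -ik; move: i j {ik h}; do 2 apply: I3_cases;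
      rewrite /subdivide sum_I3 /delta /=; apply/andP; split; lra.
  by have /andP[] := harmonic_bound y b; rewrite h; lra.
have dk : subdivide k (delta i) k = 0 by rewrite /subdivide eqxx /delta (negbTE ik).
have -> : y = p k.
  apply: (@harmonic_strict_min k (subdivide k (delta i))) => //; last by rewrite h dk.
  move=> j jk; rewrite dk; move: i k j ik jk {h dk}; do 3 apply: I3_cases => //;
    by move=> _ _; rewrite /subdivide sum_I3 /delta /=; lra.
by exists k => //; rewrite contr_fix.
Qed.

(** The harmonic function that is 1 at one corner and 0 at the others vanishes nowhere
    else on the gasket.  The product of two of them also vanishes at the remaining corners, and it
    has finite energy because both factors are bounded. *)
Lemma H01_positive : exists phi : plane R -> R^o,
  [/\ H01 p V phi, forall x, 0 <= phi x & forall x, V x -> phi x = 0 -> V0 p x].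
Proof.
pose h0 := harmonic (delta ord0); pose h1 := harmonic (delta (lift ord0 ord0)).
have d01 i j : 0 <= delta i j <= 1 by rewrite /delta ler0n lern1 leq_b1.
have b0 x : 0 <= h0 x <= 1 by exact: harmonic_bound.
have b1 x : 0 <= h1 x <= 1 by exact: harmonic_bound.
exists (fun x => h0 x * h1 x); split.
- split.
  + by move=> x; apply: cvgM; exact: harmonic_continuous.
  + apply: le_lt_trans (ltry (2 * quad (delta ord0) + 2 * quad (delta (lift ord0 ord0)))).
    apply: energy_le => n.
    rewrite -(harmonic_energy n (delta ord0)) -(harmonic_energy n (delta (lift ord0 ord0))).
    rewrite /genergy !(mulrCA 2) -mulrDr ler_wpM2l ?exprn_ge0//.
    have -> e e' : 2 * edge_sum p n e + 2 * edge_sum p n e' =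
       edge_sum p n (fun x y => 2 * e x y + 2 * e' x y + 0 * 0).
      by rewrite edge_sum_lin mul0r addr0.
    apply: ler_edge_sum => w w' i j; rewrite mul0r addr0 !real_normK ?num_real//.
    rewrite -/h0 -/h1; set x := vertex _ _ _; set y := vertex _ _ _.
    have /andP[? ?] := b0 x; have /andP[? ?] := b0 y.
    have /andP[? ?] := b1 x; have /andP[? ?] := b1 y.
    have -> : h0 x * h1 x - h0 y * h1 y = h1 x * (h0 x - h0 y) + h0 y * (h1 x - h1 y).
      by ring.
    set d := h0 x - h0 y; set d' := h1 x - h1 y.
    apply: le_trans (_ : 2 * (h1 x * d) ^+ 2 + 2 * (h0 y * d') ^+ 2 <= _).
      by have := sqr_ge0 (h1 x * d - h0 y * d'); nra.
    rewrite !exprMn; apply: lerD; rewrite ler_pM2l// ler_piMl ?sqr_ge0//.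
      by rewrite exprn_ile1.
    by rewrite exprn_ile1.
  + move=> _ [j _ <-]; rewrite /h0 /h1 !harmonic_corner /delta.
    by move: j; apply: I3_cases; rewrite /= ?mul0r ?mulr0.
- by move=> x; have /andP[? _] := b0 x; have /andP[? _] := b1 x; rewrite mulr_ge0.
- move=> x Vx /eqP; rewrite mulf_eq0 => /orP[] /eqP; exact: harmonic_delta_zero.
Qed.

End Harmonic.

(** * Null sets and the primitive *)

Section BorelPlane.
Context {R : realType}.

Lemma open_measurable_plane (U : set (plane R)) : open U -> measurable U.
Proof.
move=> oU.
pose B (q : rat * rat * rat) : set (plane R) :=
  `]ratr q.1.1 - ratr q.2, ratr q.1.1 + ratr q.2[%classic `*`
  `]ratr q.1.2 - ratr q.2, ratr q.1.2 + ratr q.2[%classic.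
pose F q := if `[< B q `<=` U >] then B q else set0.
have -> : U = \bigcup_q F q.
  apply/seteqP; split=> [[a b] Uab|x [q _]]; last first.
    by rewrite /F; case: asboolP => // BU; exact: BU.
  move: (oU); rewrite openE => /(_ _ Uab) /nbhs_ballP[e /= e0 eU].
  have e20 : 0 < e / 2 by lra.
  have [r /[!in_itv]/= /andP[r0 re]] := rat_in_itvoo e20.
  have [qa /[!in_itv]/= /andP[a1 a2]] := @rat_in_itvoo R (a - ratr r) a ltac:(lra).
  have [qb /[!in_itv]/= /andP[b1 b2]] := @rat_in_itvoo R (b - ratr r) b ltac:(lra).
  have BU : B (qa, qb, r) `<=` U.
    move=> [c d] [/=]; rewrite !in_itv/= => /andP[c1 c2] /andP[d1 d2].
    apply: eU; split; rewrite /ball/= ltr_norml; apply/andP; split; lra.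
  exists (qa, qb, r) => //; rewrite /F; case: asboolP => // _.
  by split; rewrite /= in_itv/=; apply/andP; split; lra.
apply: countable_bigcupT_measurable => // q; rewrite /F.
case: asboolP => _ //; apply: measurableX; exact: measurable_itv.
Qed.

Lemma closed_measurable_plane (A : set (plane R)) : closed A -> measurable A.
Proof. by move/closed_openC/open_measurable_plane/measurableC; rewrite setCK. Qed.

Lemma within_continuous_measurable (D : set (plane R)) (f : plane R -> R) :
  measurable D -> {within D, continuous f} -> measurable_fun D f.
Proof.
move=> mD /continuousP cf; apply: (measurability _ (RGenOpens.measurableE R)).
move=> _ [_ [a [b ->] <-]].
have /open_subspaceP [W Wop WD] := cf _ (@interval_open R (BRight a) (BLeft b) isT isT).
rewrite setIC -WD; apply: measurableI => //; exact: open_measurable_plane.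
Qed.

(** The singleton of [x] covers itself with diameter 0, and [0 `^ s] is 0 unless [s = 0]. *)
Lemma hausdorff_set1 (s : R) (x : plane R) (A : set (plane R)) : s != 0 ->
  A `<=` [set x] -> (hausdorff s A <= 0)%E.
Proof.
move=> s0 Ax; apply: ge_ereal_sup => _ [d d0 <-].
have diam0 : ediam [set x] = 0%E.
  apply/eqP; rewrite eq_le; apply/andP; split; last by rewrite /ediam le_max lexx.
  rewrite /ediam ge_max lexx /=; apply: ge_ereal_sup => _ [[y z] [/= -> ->] <-].
  by rewrite /edist !subrr expr0n /= addr0 sqrtr0.
apply: ereal_inf_lbound; exists (fun=> [set x]).
  split; first by move=> y /Ax ->; exists 0%N.
  by move=> k; rewrite diam0 lee_fin ltW.
by apply: eseries0 => k _ _; rewrite diam0 poweR0r.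
Qed.

Lemma normalized_hausdorff_set1 (V : set (plane R))
    (mu : {measure set (plane R) -> \bar R}) x :
  is_normalized_hausdorff V mu -> mu [set x] = 0%E.
Proof.
move=> [_ [c c0 cP]].
have mx : measurable [set x].
  apply: closed_measurable_plane; apply: compact_closed; first exact: norm_hausdorff.
  exact: compact_set1.
apply/eqP; rewrite eq_le measure_ge0 andbT cP// mule_ge0_le0//.
  by rewrite lee_fin ltW.
apply: (@hausdorff_set1 _ x) => [|y []//].
by rewrite mulf_neq0// ?invr_eq0 gt_eqF// ln_gt0// ltr1n.
Qed.

End BorelPlane.

Section NullSets.
Context d (T : measurableType d) (R : realType) (mu : {measure set T -> \bar R}).
Import HBNNSimple.

(** The integral of a nonnegative function is a supremum over the simple functions
    below it, and restricting these to the complement of [N] keeps their integrals.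
    Arbitrary [g] matter because the nonlinearity is measurable only up to a null
    set that depends on its second argument. *)
Lemma ge0_integral_null (D N : set T) (g : T -> \bar R) : measurable N ->
  mu N = 0%E -> (forall x, 0 <= g x)%E ->
  (\int[mu]_(x in D) g x = \int[mu]_(x in D `\` N) g x)%E.
Proof.
move=> mN N0 g0; rewrite !ge0_integralE//.
apply/eqP; rewrite eq_le; apply/andP; split; apply: ge_ereal_sup => _ [h hg <-].
  have -> : sintegral mu h = sintegral mu (h \_ (~` N)).
    rewrite -integral_nnsfun; last exact: measurableC.
    rewrite -setTD -(@ge0_negligible_integral _ _ _ mu setT N)//.
    - by rewrite integral_nnsfun// patch_setT.
    - exact/measurable_EFinP.
    - by move=> x _; rewrite lee_fin fun_ge0.
  apply: ereal_sup_ubound; rewrite (mrestrict h (measurableC mN)).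
  exists (proj_nnsfun h (measurableC mN)) => // x; rewrite -mrestrict.
  have := hg x; rewrite !patchE; have [Nx|Nx] := pselect (N x).
    rewrite (memNset (fun k : (~` N) x => k Nx)).
    by rewrite (memNset (fun k : (D `\` N) x => k.2 Nx)).
  rewrite (mem_set (Nx : (~` N) x)); have [Dx|Dx] := pselect (D x).
    by rewrite (mem_set Dx) (mem_set (conj Dx Nx : (D `\` N) x)).
  by rewrite (memNset Dx) (memNset (fun k : (D `\` N) x => Dx k.1)).
apply: ereal_sup_ubound; exists h => // x; apply: le_trans (hg x) _.
rewrite !patchE; case: ifPn => [|_]; first by rewrite inE => -[Dx _]; rewrite mem_set.
by case: ifP.
Qed.

Lemma integral_null (D N : set T) (g : T -> \bar R) : measurable N ->
  mu N = 0%E -> (\int[mu]_(x in D) g x = \int[mu]_(x in D `\` N) g x)%E.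
Proof.
move=> mN N0; rewrite integralE [RHS]integralE.
by congr (_ - _)%E; apply: ge0_integral_null.
Qed.

End NullSets.

Section Primitive.
Context {R : realType}.
Variable g : R -> R.
Hypothesis cg : continuous g.
Local Notation leb := (@lebesgue_measure R).

(** [prim (f x)] is [primitive f x] by definition. *)
Definition prim (t : R) : R :=
  if 0 <= t then \int[leb]_(s in `[0, t]) g s else - \int[leb]_(s in `[t, 0]) g s.

Lemma continuous_itv_integrable (a b : R) : leb.-integrable `[a, b] (EFin \o g).
Proof.
apply: continuous_compact_integrable; first exact: segment_compact.
exact: continuous_subspaceT.
Qed.

Let prim_itv (c s : R) : c < s -> c < 0 ->
  prim s = \int[leb]_(r in `[c, s]) g r - \int[leb]_(r in `[c, 0]) g r.
Proof.
move=> cs c0; rewrite /prim; case: ifPn => [s0|].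
  rewrite (@Rintegral_itvB _ _ (BLeft c) (BRight s) 0).
  - rewrite Rintegral_itv_obnd_cbnd//.
    by apply: integrableS (continuous_itv_integrable 0 s) => //; exact: subset_itv_oc_cc.
  - exact: continuous_itv_integrable.
  - by rewrite bnd_simp ltW.
  - by rewrite bnd_simp.
rewrite -ltNge => s0; rewrite -[RHS]opprB; congr (- _).
rewrite (@Rintegral_itvB _ _ (BLeft c) (BRight 0) s).
- rewrite Rintegral_itv_obnd_cbnd//.
  by apply: integrableS (continuous_itv_integrable s 0) => //; exact: subset_itv_oc_cc.
- exact: continuous_itv_integrable.
- by rewrite bnd_simp ltW.
- by rewrite bnd_simp ltW.
Qed.

Lemma is_derive_prim (t : R) : is_derive t 1 prim (g t).
Proof.
set c : R := Num.min t 0 - 1.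
have mt : Num.min t 0 <= t by rewrite ge_min lexx.
have m0 : Num.min t 0 <= 0 by rewrite ge_min lexx orbT.
have ct : c < t by rewrite /c; lra.
have c0 : c < 0 by rewrite /c; lra.
pose F s := \int[leb]_(r in `[c, s]) g r.
have [dF F'] := @continuous_FTC1_closed R g c t (t + 1) ltac:(lra)
  (continuous_itv_integrable c (t + 1)) ct (@cg t).
have isF : is_derive t 1 F (g t) by apply: DeriveDef; [exact: dF|rewrite -derive1E; exact: F'].
apply: (@near_eq_is_derive _ _ _ (fun s => F s - F 0)).
  near=> s; rewrite (@prim_itv c)//.
  by near: s; exact: lt_nbhsr.
have := @is_deriveB _ _ _ F (cst (F 0)) t 1 _ _ isF (is_derive_cst _ _ _).
by rewrite subr0.
Unshelve. all: by end_near. Qed.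

Lemma prim_continuous : continuous prim.
Proof.
move=> t; apply: differentiable_continuous; apply/derivable1_diffP.
by have [] := is_derive_prim t.
Qed.

Lemma prim0 : prim 0 = 0.
Proof. by rewrite /prim lexx set_itv1 Rintegral_set1. Qed.

Lemma prim_lin (a b k eta : R) : a <= b -> (forall s, a <= s <= b -> `|g s - k| <= eta) ->
  `|prim b - prim a - k * (b - a)| <= eta * (b - a).
Proof.
move=> ab gk.
have [||c cab ->] := @MVT_segment R prim g a b ab.
- by move=> x _; exact: is_derive_prim.
- exact/continuous_subspaceT/prim_continuous.
rewrite -mulrBl normrM [`|b - a|]ger0_norm ?subr_ge0//.
by rewrite ler_wpM2r ?subr_ge0// gk// -in_itv.
Qed.

Lemma prim_lin_sym (a b k eta : R) :
  (forall s, (a <= s <= b) || (b <= s <= a) -> `|g s - k| <= eta) ->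
  `|prim b - prim a - k * (b - a)| <= eta * `|b - a|.
Proof.
move=> gk; have [ab|/ltW ba] := leP a b.
  rewrite [`|b - a|]ger0_norm ?subr_ge0//; apply: prim_lin => // s sab.
  by apply: gk; rewrite sab.
rewrite [`|b - a|]ler0_norm ?subr_le0// opprB -normrN.
have -> : - (prim b - prim a - k * (b - a)) = prim a - prim b - k * (a - b) by ring.
by apply: prim_lin => // s sba; apply: gk; rewrite sba orbT.
Qed.

Lemma prim_bound (M c t : R) : (forall s, - M <= s <= M -> `|g s| <= c) ->
  `|t| <= M -> `|prim t| <= c * M.
Proof.
move=> gc tM; have c0 : 0 <= c.
  by apply: le_trans (normr_ge0 (g 0)) _; apply: gc; rewrite oppr_le0 (le_trans _ tM).
have := @prim_lin_sym 0 t 0 c; rewrite prim0 !subr0 mul0r !subr0 => h.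
apply: (le_trans (h _)); last by rewrite ler_wpM2l.
move: tM; rewrite ler_norml => /andP[t1 t2] s.
by rewrite subr0 => /orP[] /andP[? ?]; apply: gc; apply/andP; split; lra.
Qed.

End Primitive.

(** * Superposition operators *)

(** [w] is approximated by [q n \o w], which rounds down to multiples of [1 / n.+1] and
    takes countably many values; on each of its level sets only one section of [f]
    occurs. *)
Lemma caratheodory_comp d (T : measurableType d) (R : realType) (D : set T)
    (f : T -> R -> R) (w : T -> R) : measurable D ->
  (forall t, measurable_fun D (f ^~ t)) -> (forall x, D x -> continuous (f x)) ->
  measurable_fun D w -> measurable_fun D (fun x => f x (w x)).
Proof.
move=> mD mf cf mw.
pose q n (t : R) : R := (Num.floor (t * n.+1%:R))%:~R / n.+1%:R.
apply: (measurable_fun_cvg (h := fun n x => f x (q n (w x)))).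
- move=> n _ B mB.
  pose A (k : int) : set R := `[k%:~R / n.+1%:R, (k + 1)%:~R / n.+1%:R[%classic.
  have n0 : 0 < n.+1%:R :> R by rewrite ltr0n.
  have AP k t : A k t <-> Num.floor (t * n.+1%:R) = k.
    rewrite /A /= in_itv/= ler_pdivrMr// ltr_pdivlMr//.
    by split=> [/floor_def//|<-]; rewrite floor_le floorD1_gt.
  have -> : D `&` (fun x => f x (q n (w x))) @^-1` B =
      \bigcup_k ((D `&` w @^-1` A k) `&` (D `&` f ^~ (k%:~R / n.+1%:R) @^-1` B)).
    apply/seteqP; split=> [x [Dx Bx]|x [k _ [[Dx Ax] [_ Bx]]]].
      by exists (Num.floor (w x * n.+1%:R)) => //; split; split => //; apply/AP.
    by split => //; rewrite /= /q; move/AP: Ax => ->.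
  apply: countable_bigcupT_measurable => // k; apply: measurableI.
    by apply: mw => //; exact: measurable_itv.
  exact: mf.
- move=> x Dx; apply: continuous_cvg; first exact: cf.
  apply/cvgrPdist_lt => e e0; near=> n.
  have n0 : 0 < n.+1%:R :> R by rewrite ltr0n.
  have := floor_le (w x * n.+1%:R); have := floorD1_gt (w x * n.+1%:R).
  rewrite intrD; set k := (Num.floor _)%:~R => h1 h2.
  have h3 : n.+1%:R^-1 < e by near: n; exact: (near_infty_natSinv_lt (PosNum e0)).
  rewrite /q -/k.
  have -> : w x - k / n.+1%:R = (w x * n.+1%:R - k) / n.+1%:R.
    by rewrite mulrBl mulfK// gt_eqF.
  rewrite normrM ger0_norm ?subr_ge0// ger0_norm ?invr_ge0 ?(ltW n0)//.
  apply: le_lt_trans h3; rewrite ler_piMl ?invr_ge0 ?(ltW n0)//; lra.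
Unshelve. all: by end_near. Qed.

(** Tonelli's theorem gives the measurability of the integrals of the positive and
    negative parts, whose difference is the integral by definition. *)
Lemma measurable_parameter_integral d (T : measurableType d) (R : realType) (D : set T)
    (f : T -> R -> R) (a b : R) : measurable D ->
  (forall t, measurable_fun D (f ^~ t)) -> (forall x, D x -> continuous (f x)) ->
  measurable_fun D (fun x => \int[@lebesgue_measure R]_(s in `[a, b]) f x s).
Proof.
move=> mD mf cf.
pose E : set (T * measurableTypeR R) := D `*` `[a, b]%classic.
have mE : measurable E by apply: measurableX => //; exact: measurable_itv.
have mP : measurable_fun E (fun z => f z.1 z.2).
  apply: (@measurable_funS _ _ _ _ (D `*` setT)).
  - exact: measurableX.
  - by move=> z [].
  apply: (@caratheodory_comp _ _ R (D `*` setT) (fun z t => f z.1 t) snd).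
  - exact: measurableX.
  - move=> t; apply: (measurable_comp (F := D)) (mf t) _ => //.
      by move=> _ [z [Dz _] <-].
    exact: measurable_funTS.
  - by move=> z [Dz _]; exact: cf.
  - exact: measurable_funTS.
pose Q := (fun z : T * measurableTypeR R => (f z.1 z.2)%:E) \_ E.
have mQ : measurable_fun setT Q.
  by apply: (measurable_restrictT _ mE).1; exact/measurable_EFinP.
have mp := @measurable_fun_fubini_tonelli_F _ _ _ _ R (@lebesgue_measure R)
  (Q ^\+)%E (measurable_funepos mQ) (fun z => funepos_ge0 Q z).
have mn := @measurable_fun_fubini_tonelli_F _ _ _ _ R (@lebesgue_measure R)
  (Q ^\-)%E (measurable_funeneg mQ) (fun z => funeneg_ge0 Q z).
have := measurableT_comp (@fine_measurable R setT measurableT) (emeasurable_funB mp mn).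
move=> /measurable_funTS => /(_ D); apply: eq_measurable_fun => x; rewrite inE => Dx.
rewrite /Rintegral integral_mkcond integralE /fubini_F /=.
have Qx s : Q (x, s) = ((EFin \o f x) \_ `[a, b]) s.
  rewrite /Q !patchE; congr (if _ then _ else _).
  by apply/idP/idP; rewrite !inE => // -[].
by congr (fine (_ - _)%E); apply: eq_integral => s _;
  rewrite ?funeposE ?funenegE Qx.
Qed.

Section Nemytskii.
Context d (T : measurableType d) (R : realType) (mu : {measure set T -> \bar R}).
Variables (D : set T) (f : T -> R -> R).
Hypotheses (mD : measurable D) (mf : forall t, measurable_fun D (f ^~ t))
  (cf : forall x, D x -> continuous (f x))
  (domf : forall M : R, 0 < M -> exists2 g : T -> R, mu.-integrable D (EFin \o g) &
     forall x t, D x -> - M <= t <= M -> `|f x t| <= g x).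

Lemma nemytskii_measurable u : measurable_fun D u ->
  measurable_fun D (fun x => f x (u x)).
Proof. exact: caratheodory_comp. Qed.

Lemma prim_measurable u : measurable_fun D u ->
  measurable_fun D (fun x => prim (f x) (u x)).
Proof.
apply: (@caratheodory_comp _ _ _ _ (fun x t => prim (f x) t)) => //.
  move=> t; have [t0|t0] := boolP (0 <= t).
    rewrite (_ : (fun x => _) = fun x => \int[@lebesgue_measure R]_(s in `[0, t]) f x s).
      exact: measurable_parameter_integral.
    by apply/funext => x; rewrite /prim t0.
  rewrite (_ : (fun x => _) = fun x => - \int[@lebesgue_measure R]_(s in `[t, 0]) f x s).
    by apply: measurableT_comp => //; exact: measurable_parameter_integral.
  by apply/funext => x; rewrite /prim (negbTE t0).
by move=> x Dx; apply: prim_continuous; exact: cf.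
Qed.

Lemma dominated_integrable (g h : T -> R) : measurable_fun D h ->
  mu.-integrable D (EFin \o g) -> (forall x, D x -> `|h x| <= g x) ->
  mu.-integrable D (EFin \o h).
Proof.
move=> mh ig hg; apply: le_integrable ig => //; first exact/measurable_EFinP.
by move=> x Dx; rewrite /= lee_fin (le_trans (hg x Dx))// ler_norm.
Qed.

Definition bounded_on (u : T -> R) (M : R) :=
  measurable_fun D u /\ forall x, D x -> `|u x| <= M.

Lemma nemytskii_integrable u M h B : bounded_on u M -> bounded_on h B ->
  mu.-integrable D (EFin \o (fun x => f x (u x) * h x)).
Proof.
move=> [mu_ uM] [mh hB].
have M1 : 0 < `|M| + 1 by have := normr_ge0 M; lra.
have [g ig gP] := domf M1.
apply: (@dominated_integrable (fun x => `|B| * g x)).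
- by apply: measurable_funM => //; exact: nemytskii_measurable.
- by have := integrableZl mD `|B| ig; apply: eq_integrable.
- move=> x Dx; rewrite normrM mulrC; apply: ler_pM => //.
    exact: le_trans (hB x Dx) (ler_norm _).
  apply: gP => //; rewrite -ler_norml; apply: le_trans (uM x Dx) _.
  by have := ler_norm M; lra.
Qed.

Lemma prim_integrable u M : bounded_on u M ->
  mu.-integrable D (EFin \o (fun x => prim (f x) (u x))).
Proof.
move=> [mu_ uM].
have M1 : 0 < `|M| + 1 by have := normr_ge0 M; lra.
have [g ig gP] := domf M1.
apply: (@dominated_integrable (fun x => (`|M| + 1) * g x)).
- exact: prim_measurable.
- by have := integrableZl mD (`|M| + 1) ig; apply: eq_integrable.
- move=> x Dx; rewrite mulrC; apply: (@prim_bound _ (f x)).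
  + exact: cf.
  + by move=> s sM; exact: gP.
  + by apply: le_trans (uM x Dx) _; have := ler_norm M; lra.
Qed.

Definition potential (u : T -> R) : R := \int[mu]_(x in D) prim (f x) (u x).
Definition dpotential (u h : T -> R) : R := \int[mu]_(x in D) (f x (u x) * h x).

Lemma bounded_onB u M v B : bounded_on u M -> bounded_on v B ->
  bounded_on (fun x => u x - v x) (M + B).
Proof.
move=> [mu_ uM] [mv vB]; split; first exact: measurable_funB.
by move=> x Dx; apply: le_trans (ler_normB _ _) _; rewrite lerD ?uM ?vB.
Qed.

(** Otherwise there are [v n] and [w n], tending uniformly to [u], whose difference
    quotients [g n x / s n] have integrals of absolute value above [e].  But these
    quotients tend to 0 pointwise, since [f x] is continuous, and are dominated by [2 * G x]. *)
Lemma potential_diff u M (e : R) : bounded_on u M -> 0 < e ->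
  exists2 r : R, 0 < r & forall v w Mv Mw (s : R), bounded_on v Mv -> bounded_on w Mw ->
    0 <= s ->
    (forall x, D x -> `|v x - u x| <= r) -> (forall x, D x -> `|w x - u x| <= r) ->
    (forall x, D x -> `|v x - w x| <= s) ->
    `|potential v - potential w - dpotential u (fun x => v x - w x)| <= e * s.
Proof.
move=> bu e0; apply: contrapT => nor.
have /choice[vws vwsP] : forall n : nat, exists z : ((T -> R) * (T -> R)) * R,
   [/\ (exists B, bounded_on z.1.1 B), (exists B, bounded_on z.1.2 B), 0 <= z.2,
     [/\ forall x, D x -> `|z.1.1 x - u x| <= n.+1%:R^-1,
       forall x, D x -> `|z.1.2 x - u x| <= n.+1%:R^-1
     & forall x, D x -> `|z.1.1 x - z.1.2 x| <= z.2] &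
     e * z.2 < `|potential z.1.1 - potential z.1.2 -
        dpotential u (fun x => z.1.1 x - z.1.2 x)|].
  move=> n; apply: contrapT => h; apply: nor; exists n.+1%:R^-1; first by rewrite invr_gt0.
  move=> v w Mv Mw s bv bw s0 vu wu vw; rewrite leNgt; apply/negP => lt.
  by apply: h; exists (v, w, s); split => //=; [exists Mv|exists Mw].
pose v n := (vws n).1.1; pose w n := (vws n).1.2; pose s n := (vws n).2.
have bv n : exists B, bounded_on (v n) B by case: (vwsP n).
have bw n : exists B, bounded_on (w n) B by case: (vwsP n).
have s0 n : 0 <= s n by case: (vwsP n).
have vu n x : D x -> `|v n x - u x| <= n.+1%:R^-1 by case: (vwsP n) => _ _ _ [] h _ _ _; exact: h.
have wu n x : D x -> `|w n x - u x| <= n.+1%:R^-1 by case: (vwsP n) => _ _ _ [] _ h _ _; exact: h.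
have vw n x : D x -> `|v n x - w n x| <= s n by case: (vwsP n) => _ _ _ [] _ _ h _; exact: h.
have big n : e * s n < `|potential (v n) - potential (w n) -
   dpotential u (fun x => v n x - w n x)| by case: (vwsP n).
pose g n x := prim (f x) (v n x) - prim (f x) (w n x) - f x (u x) * (v n x - w n x).
have ig n : mu.-integrable D (EFin \o g n).
  have [B hB] := bv n; have [B' hB'] := bw n.
  have i1 := prim_integrable hB; have i2 := prim_integrable hB'.
  have i3 := nemytskii_integrable bu (bounded_onB hB hB').
  have := integrableB mD (integrableB mD i1 i2) i3.
  by apply: eq_integrable.
have gE n : \int[mu]_(x in D) g n x = potential (v n) - potential (w n) -
   dpotential u (fun x => v n x - w n x).
  have [B hB] := bv n; have [B' hB'] := bw n.
  have i1 := prim_integrable hB; have i2 := prim_integrable hB'.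
  have i3 := nemytskii_integrable bu (bounded_onB hB hB').
  rewrite RintegralB//; last first.
    by have := integrableB mD i1 i2; apply: eq_integrable.
  by rewrite RintegralB.
have sgt0 n : 0 < s n.
  rewrite lt_neqAle s0 andbT; apply/negP => /eqP sn; have := big n.
  rewrite -gE -sn mulr0 normr_gt0 => /negP; apply; apply/eqP.
  transitivity (\int[mu]_(x in D) (0 : R)); last by rewrite Rintegral_cst// mul0r.
  apply: eq_Rintegral => x; rewrite inE => Dx.
  have := vw n x Dx; rewrite -sn normr_le0 subr_eq0 => /eqP vwx.
  by rewrite /g vwx !subrr mulr0 subr0.
have [mu_ uM] := bu.
have M1 : 0 < `|M| + 1 by have := normr_ge0 M; lra.
have [G iG GP] := domf M1.
have n1 n : n.+1%:R^-1 <= 1 :> R by rewrite invf_le1// ler1n.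
have lin n x eta : D x ->
   (forall t, `|t - u x| <= n.+1%:R^-1 -> `|f x t - f x (u x)| <= eta) ->
   `|g n x / s n| <= eta.
  move=> Dx h; rewrite normrM [`|_^-1|]ger0_norm ?invr_ge0//.
  rewrite ler_pdivrMr//.
  apply: le_trans (_ : eta * `|v n x - w n x| <= _); last first.
    rewrite ler_wpM2l ?vw//; apply: le_trans (normr_ge0 (f x (u x) - f x (u x))) _.
    by apply: h; rewrite subrr normr0 invr_ge0.
  apply: (@prim_lin_sym _ (f x)); first exact: cf.
  move=> t ht; apply: h; have := vu n x Dx; have := wu n x Dx.
  rewrite !ler_norml; move: n.+1%:R^-1 => q /andP[? ?] /andP[? ?].
  by case/orP: ht => /andP[? ?]; apply/andP; split; lra.
have := @dominated_convergence _ T R mu D mD (fun n => EFin \o (fun x => g n x / s n))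
  (fun=> 0%E) (fun x => (2 * G x)%:E).
case.
- move=> n; apply/measurable_EFinP; apply: measurable_funM => //.
  by apply/measurable_EFinP; exact: (measurable_int mu (ig n)).
- exact: measurable_cst.
- apply: aeW => x Dx.
  apply/cvg_EFin; first by apply: nearW.
  apply/cvgr0Pnorm_le => eta eta0 /=.
  have /cvgrPdist_le /(_ eta eta0) := @cf x Dx (u x).
  move=> /nbhs_ballP[r /= r0 rP]; near=> n.
  apply: lin => // t tu; rewrite distrC; apply: rP; rewrite -ball_normE /= distrC.
  apply: le_lt_trans tu _; near: n; exact: (near_infty_natSinv_lt (PosNum r0)).
- by have := integrableZl mD 2 iG; apply: eq_integrable.
- apply: aeW => x n Dx /=; rewrite lee_fin; apply: lin => // t tu.
  have h1 : `|u x| <= `|M| by apply: le_trans (uM x Dx) (ler_norm _).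
  apply: le_trans (ler_normB _ _) _; rewrite mulr_natl mulr2n; apply: lerD.
    apply: GP => //; move: h1 (le_trans tu (n1 n)); rewrite !ler_norml.
    by move=> /andP[? ?] /andP[? ?]; apply/andP; split; lra.
  apply: GP => //; move: h1; rewrite !ler_norml => /andP[? ?].
  by apply/andP; split; lra.
move=> _ _; rewrite integral0 => c0.
have /cvgrPdist_lt /(_ e e0) : \int[mu]_(x in D) (g n x / s n) @[n --> \oo] --> (0 : R).
  exact: (fine_cvg c0).
move=> [n _ /(_ n (leqnn n))]; rewrite /= sub0r normrN RintegralZr// gE.
rewrite normrM [`|_^-1|]ger0_norm ?invr_ge0// ltr_pdivrMr//.
by move=> /(lt_trans (big n)); rewrite ltxx.
Unshelve. all: by end_near. Qed.

End Nemytskii.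

(** * Low points of the functional *)

(** The hypothesis says that [prim g t] divided by the power [theta] of [t] is
    nondecreasing.  The excess of [theta] over 2 is then bounded below by
    [expR y >= 1 + y], which leaves a logarithmic gain over quadratic growth. *)
Lemma superquadratic_growth (R : realType) (g : R -> R) (theta M0 s : R) :
  continuous g -> 2 < theta -> 0 < M0 ->
  (forall t, M0 <= t -> 0 < theta * prim g t <= t * g t) -> M0 <= s ->
  prim g M0 * ((s / M0) ^+ 2 * (1 + (theta - 2) * ln (s / M0))) <= prim g s.
Proof.
move=> cg th2 M00 AR Ms.
have s0 : 0 < s by exact: lt_le_trans Ms.
pose K t : R := prim g t * expR (- theta * ln t).
pose dK t : R := prim g t * (expR (- theta * ln t) * (- theta * t^-1))
  + expR (- theta * ln t) * g t.
have isK (t : R) : 0 < t -> is_derive t 1 K (dK t).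
  move=> t0; have i1 := is_derive_prim cg t.
  have i2 : is_derive t 1 (fun t : R => - theta * ln t) (- theta * t^-1).
    exact: (@is_deriveZ _ _ _ (@ln R) (- theta) t 1 _ (is_derive1_ln t0)).
  have i3 := @is_derive1_comp R expR (fun t : R => - theta * ln t) t _ _
    (is_derive_expR (- theta * ln t)) i2.
  exact: (@is_deriveM _ _ _ _ _ _ _ _ i1 i3).
have KM : K M0 <= K s.
  have [||c /[!in_itv]/= /andP[c1 c2]] := @MVT_segment R K dK M0 s Ms.
  - by move=> t /[!in_itv]/= /andP[t1 _]; apply: isK; exact: lt_trans t1.
  - apply: continuous_in_subspaceT => t /[!inE]/=; rewrite in_itv/= => /andP[t1 _].
    apply: differentiable_continuous; apply/derivable1_diffP.
    by have [] := isK t (lt_le_trans M00 t1).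
  have c0 : 0 < c by exact: lt_le_trans c1.
  move=> KE; rewrite -subr_ge0 KE mulr_ge0 ?subr_ge0//.
  have -> : dK c = expR (- theta * ln c) / c * (c * g c - theta * prim g c).
    by rewrite /dK; field; rewrite gt_eqF.
  rewrite mulr_ge0 ?divr_ge0 ?expR_ge0 ?(ltW c0)// subr_ge0.
  by case/andP: (AR c c1).
pose L := ln (s / M0).
have LE : ln s = L + ln M0 by rewrite /L ln_div ?posrE// subrK.
have P0 : 0 < prim g M0.
  by case/andP: (AR M0 (lexx _)) => h _; move: h; rewrite pmulr_rgt0//; lra.
have h1 : prim g M0 * expR (theta * L) <= prim g s.
  have e0 : 0 < expR (- theta * ln s) by exact: expR_gt0.
  rewrite -(ler_pM2r e0) -mulrA -expRD.
  have -> : theta * L + - theta * ln s = - theta * ln M0 by rewrite LE; ring.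
  exact: KM.
apply: le_trans h1; rewrite ler_pM2l//.
have -> : theta * L = L + L + (theta - 2) * L by ring.
rewrite !expRD {2 3}/L lnK ?posrE ?divr_gt0// -expr2.
by rewrite ler_wpM2l ?sqr_ge0// expR_ge1Dx.
Qed.

Section Existence.
Context {R : realType} (p : 'I_3 -> plane R) (V D : set (plane R)).
Variables (mu : {measure set (plane R) -> \bar R}) (a : plane R -> R) (am ap : R).
Variable (f : plane R -> R -> R).
Hypotheses (hp : equilateral p) (hV : is_gasket p V) (mD : measurable D) (DV : D `<=` V)
  (muD : mu D = 1%E) (mu1 : forall x, mu [set x] = 0%E).
Hypotheses (am_gt0 : 0 < am) (a_ge : forall x, Vinf p x -> am <= a x)
  (a_le : forall x, Vinf p x -> a x <= ap).
Hypotheses (mf : forall t, measurable_fun D (f ^~ t))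
  (cf : forall x, D x -> continuous (f x))
  (domf : forall M : R, 0 < M -> exists2 g : plane R -> R, mu.-integrable D (EFin \o g) &
     forall x (t : R), D x -> - M <= t <= M -> `|f x t| <= g x).

Local Notation X := (plane R -> R^o).
Local Notation H := (H01 p V).
Local Notation N := (energyN p).
Local Notation S := (supnorm V).
Local Notation J := (potential mu D f).
Local Notation dJ := (dpotential mu D f).
Local Notation Ea := (weighted_form p a).

Let psi (u : X) : R := Ea u / 2.

Lemma gasket_measurable : measurable V.
Proof. by apply: closed_measurable_plane; exact: (gasket_closed hV). Qed.

Lemma H01_bounded_on (u : X) : H u -> bounded_on D u (S u).
Proof.
move=> Hu; split; last by move=> x /DV; exact: (le_supnorm hV Hu).
apply: (measurable_funS gasket_measurable) => //.
by case: Hu => cu _ _; apply: within_continuous_measurable => //; exact: gasket_measurable.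
Qed.

Let int_J (u : X) : H u -> mu.-integrable D (EFin \o (fun x => prim (f x) (u x))).
Proof. by move=> Hu; apply: (prim_integrable mD mf cf domf); exact: H01_bounded_on. Qed.

Let int_dJ (u h : X) : H u -> H h -> mu.-integrable D (EFin \o (fun x => f x (u x) * h x)).
Proof.
by move=> Hu Hh; apply: (nemytskii_integrable mD mf cf domf); exact: H01_bounded_on.
Qed.

Let dJD (u h k : X) : H u -> H h -> H k -> dJ u (h + k) = dJ u h + dJ u k.
Proof.
move=> Hu Hh Hk; rewrite /dpotential -RintegralD//; [|exact: int_dJ|exact: int_dJ].
by apply: eq_Rintegral => x _; rewrite -mulrDr.
Qed.

Let dJZ (u : X) (t : R) (h : X) : H u -> H h -> dJ u (t *: h) = t * dJ u h.
Proof.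
move=> Hu Hh; rewrite /dpotential -RintegralZl//; last exact: int_dJ.
by apply: eq_Rintegral => x _; rewrite mulrCA.
Qed.

Let cst1_bounded : bounded_on D (fun=> 1 : R) 1.
Proof. by split => [|x _]; [exact: measurable_cst|rewrite normr1]. Qed.

Let dJ_bounded (u : X) : H u -> exists L : R, forall h, H h -> `|dJ u h| <= L * S h.
Proof.
move=> Hu; exists (\int[mu]_(x in D) `|f x (u x)|) => h Hh.
have i1 : mu.-integrable D (EFin \o (fun x => f x (u x))).
  have := nemytskii_integrable mD mf cf domf (H01_bounded_on Hu) cst1_bounded.
  by apply: eq_integrable => // x _; rewrite /= mulr1.
have i2 := integrable_norm i1.
apply: le_trans (le_normr_Rintegral mD (int_dJ Hu Hh)) _.
rewrite -RintegralZr//; apply: le_Rintegral => //.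
- exact: (integrable_norm (int_dJ Hu Hh)).
- have := integrableZl mD (S h) i2.
  by apply: eq_integrable => // x _; rewrite /= mulrC.
- by move=> x Dx; rewrite normrM ler_wpM2l//; exact: (le_supnorm hV Hh (DV Dx)).
Qed.

Let J_diff (u : X) : H u -> forall e : R, 0 < e -> exists2 r : R, 0 < r &
  forall v w : X, H v -> H w -> S (v - u) < r -> S (w - u) < r ->
    `|J v - J w - dJ u (v - w)| <= e * S (v - w).
Proof.
move=> Hu e e0.
have [r r0 rP] := potential_diff mD mf cf domf (H01_bounded_on Hu) e0.
exists r => // v w Hv Hw vu wu.
have sub (y z : X) x : H y -> H z -> D x -> `|y x - z x| <= S (y - z).
  by move=> Hy Hz /DV Vx; exact: (le_supnorm hV (H01B Hy Hz) Vx).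
apply: (rP v w _ _ _ (H01_bounded_on Hv) (H01_bounded_on Hw)).
- exact: (supnorm_ge0 hV).
- by move=> x Dx; apply: le_trans (sub _ _ _ Hv Hu Dx) (ltW vu).
- by move=> x Dx; apply: le_trans (sub _ _ _ Hw Hu Dx) (ltW wu).
- by move=> x Dx; exact: sub.
Qed.

Variables (r alpha theta M0 : R).
Hypotheses (h1 : forall n : nat, exists2 delta : R, 0 < delta &
     forall x (t : R), D x -> 0 < `|t| < delta -> n%:R <= prim (f x) t / `|t| ^+ 2)
  (r_gt0 : 0 < r) (alpha_lt : alpha < am * r ^+ 2 / 162)
  (h2 : forall x (t : R), D x -> - r <= t <= r -> prim (f x) t <= alpha)
  (theta_gt2 : 2 < theta) (M0_gt0 : 0 < M0)
  (h3 : forall x (t : R), D x -> t <= - M0 \/ M0 <= t ->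
     0 < theta * prim (f x) t <= t * f x t).

Let fine_muD : fine (mu D) = 1. Proof. by rewrite muD. Qed.

(** Where [`|u x| <= M0] the inequality can fail, but by no more than a multiple of the
    dominating function [g]. *)
Let AR : exists CA, forall u : X, H u -> theta * J u <= dJ u u + CA.
Proof.
have [g ig gP] := domf M0_gt0.
have th2 := theta_gt2; have M00 := M0_gt0.
exists (\int[mu]_(x in D) ((theta + 1) * M0 * g x)) => u Hu.
have ig' : mu.-integrable D (EFin \o (fun x => (theta + 1) * M0 * g x)).
  by have := integrableZl mD ((theta + 1) * M0) ig; apply: eq_integrable.
have iu := int_J Hu; have iuu := int_dJ Hu Hu.
rewrite -RintegralZl// -RintegralD//; apply: le_Rintegral => //.
- by have := integrableZl mD theta iu; apply: eq_integrable.
- by have := integrableD mD iuu ig'; apply: eq_integrable.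
move=> x Dx; set t := u x.
have g0 : 0 <= g x.
  by apply: le_trans (normr_ge0 (f x 0)) (gP x 0 Dx _); apply/andP; split; lra.
have [tM|tM] := leP `|t| M0; last first.
  have ht : t <= - M0 \/ M0 <= t.
    by move: tM; rewrite ltNge ler_norml negb_and -!ltNge => /orP[]/ltW; [left|right].
  have /andP[_ h] := h3 Dx ht; rewrite mulrC in h; rewrite mulrC.
  apply: le_trans h _; rewrite [t * _]mulrC lerDl !mulr_ge0//; lra.
have b1 : `|prim (f x) t| <= g x * M0.
  by apply: (@prim_bound _ (f x) (@cf x Dx) M0) => // s sM; exact: gP.
have b2 : `|f x t * t| <= g x * M0.
  by rewrite normrM ler_pM// gP// -ler_norml.
move: b1 b2; rewrite !ler_norml => /andP[_ b1] /andP[b2 _].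
have : theta * prim (f x) t <= theta * (g x * M0) by rewrite ler_pM2l//; lra.
lra.
Qed.

(** On this ball [`|u x| <= 5 * N u <= r], by [sup_bound]. *)
Let J_le (u : X) : H u -> N u <= r / 9 -> J u <= alpha.
Proof.
move=> Hu Nu; have r0 := r_gt0.
have -> : alpha = \int[mu]_(_ in D) alpha by rewrite Rintegral_cst// fine_muD mulr1.
apply: le_Rintegral => //; first exact: int_J.
- apply: measurable_bounded_integrable => //; first by rewrite muD ltry.
  exact: bounded_cst.
- move=> x Dx; apply: h2 => //; rewrite -ler_norml.
  by apply: le_trans (sup_bound hV Hu (DV Dx)) _; lra.
Qed.

Let H0 : H (0 : X) := H01_0 p V.

Let J0 : J (0 : X) = 0.
Proof.
transitivity (\int[mu]_(x in D) (0 : R)); last by rewrite Rintegral_cst// mul0r.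
by apply: eq_Rintegral => x _; rewrite [LHS]prim0.
Qed.

(** The integrand vanishes at the three corners at most, which are null. *)
Let weight_pos (phi : X) (k : plane R -> R) : H phi -> (forall x, V x -> phi x = 0 -> V0 p x) ->
  (forall x, D x -> 0 < k x) -> mu.-integrable D (EFin \o (fun x => k x * phi x ^+ 2)) ->
  0 < \int[mu]_(x in D) (k x * phi x ^+ 2).
Proof.
move=> Hphi phi0 k0 ik.
have ge0 x : D x -> 0 <= k x * phi x ^+ 2.
  by move=> Dx; rewrite mulr_ge0 ?sqr_ge0// ltW// k0.
rewrite lt_neqAle Rintegral_ge0// andbT; apply/negP => /eqP int0.
have mk := measurable_int mu ik.
have : (\int[mu]_(x in D) `|(k x * phi x ^+ 2)%:E| = 0)%E.
  have <- : (\int[mu]_(x in D) (k x * phi x ^+ 2)%:E = 0)%E.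
    by rewrite -(fineK (integrable_fin_num mD ik)) -/(Rintegral _ _ _) -int0.
  by apply: eq_integral => x; rewrite inE => Dx; rewrite /= ger0_norm// ge0.
move/(ae_eq_integral_abs mu mD mk) => [Z [mZ Z0 ZP]].
have sub : D `<=` Z `|` (\bigcup_(i in [set: 'I_3]) [set p i]).
  move=> x Dx; have [Zx|nZx] := pselect (Z x); first by left.
  right; have : V0 p x; last by move=> [i _ <-]; exists i.
  apply: phi0; first exact: DV.
  have : D x -> (k x * phi x ^+ 2)%:E = 0%E.
    by apply: contrapT => h; apply: nZx; exact: ZP.
  move=> /(_ Dx) [] /eqP; rewrite mulf_eq0 (gt_eqF (k0 x Dx)) /= sqrf_eq0.
  by move=> /eqP.
have m1 i : measurable [set p i].
  apply: closed_measurable_plane; apply: accessible_closed_set1.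
  exact: (hausdorff_accessible (@norm_hausdorff _ _)).
have mU : measurable (\bigcup_(i in [set: 'I_3]) [set p i]).
  by apply: fin_bigcup_measurable => //; exact: finite_finset.
have U0 : mu (\bigcup_(i in [set: 'I_3]) [set p i]) = 0%E.
  have -> : \bigcup_(i in [set: 'I_3]) [set p i] =
      [set p ord0] `|` ([set p (lift ord0 ord0)] `|` [set p (lift ord0 (lift ord0 ord0))]).
    apply/seteqP; split => [x [i _ ->]|x [->|[->|->]]]; last first.
    + by exists (lift ord0 (lift ord0 ord0)).
    + by exists (lift ord0 ord0).
    + by exists ord0.
    by move: i; apply: I3_cases; [left|right; left|right; right].
  have U2 : mu ([set p (lift ord0 ord0)] `|` [set p (lift ord0 (lift ord0 ord0))]) = 0%E.
    by rewrite measureU0//; exact: mu1.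
  by rewrite measureU0//; exact: measurableU.
have : (mu D <= mu (Z `|` (\bigcup_(i in [set: 'I_3]) [set p i])))%E.
  by apply: le_measure => //; rewrite inE//; exact: measurableU.
by rewrite measureU0// Z0 muD lee_fin ler10.
Qed.

Let I (u : X) : R := psi u - J u.

Let bump : exists phi : X, [/\ H phi, forall x, 0 <= phi x
  & forall x, V x -> phi x = 0 -> V0 p x] := H01_positive hp hV.

Let sqr_bounded (phi : X) : H phi -> bounded_on D (fun x => phi x ^+ 2) (S phi ^+ 2).
Proof.
move=> /H01_bounded_on[m b]; split; first exact: measurable_funX.
by move=> x Dx; rewrite normrX ler_pXn2r ?nnegrE ?(supnorm_ge0 hV)// b.
Qed.

Let psiZ (t : R) (u : X) : H u -> psi (t *: u) = t ^+ 2 * psi u.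
Proof. by move=> Hu; rewrite /psi (weighted_form_Z am_gt0 a_ge a_le t Hu) mulrA. Qed.

Let psi_ge0 (u : X) : H u -> 0 <= psi u.
Proof.
move=> Hu; rewrite divr_ge0// (le_trans _ (weighted_form_ge am_gt0 a_ge a_le Hu))//.
by rewrite mulr_ge0 ?sqr_ge0// ltW.
Qed.

(** Near 0 the primitive is at least [n%:R * t ^+ 2] with [n] so large that the potential
    of a small multiple of the bump beats its energy. *)
Let below : exists u0 : X, [/\ H u0, N u0 < r / 9 & I u0 < 0].
Proof.
have [phi [Hphi phi_ge0 phi0]] := bump.
have i1 : mu.-integrable D (EFin \o (fun x => 1 * phi x ^+ 2)).
  apply: measurable_bounded_integrable => //; first by rewrite muD ltry.
    by apply: measurable_funM => //; case: (sqr_bounded Hphi).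
  exists (S phi ^+ 2); split; first exact: num_real.
  move=> B SB x Dx; rewrite /= mul1r; apply: le_trans (ltW SB).
  by case: (sqr_bounded Hphi) => _; exact.
have Qgt0 := weight_pos Hphi phi0 (fun x _ => ltr01) i1.
set Q := \int[mu]_(x in D) _ in Qgt0.
have P0 := psi_ge0 Hphi.
pose n := (Num.truncn (psi phi / Q)).+1.
have nQ : psi phi < n%:R * Q.
  by rewrite -ltr_pdivrMr//; exact: truncnS_gt.
have [de de0 deP] := h1 n.
have S1 : 0 < S phi + 1 by have := supnorm_ge0 hV phi; lra.
have N1 : 0 < N phi + 1 by have := energyN_ge0 p phi; lra.
pose t : R := Num.min (de / (S phi + 1)) (r / 9 / (N phi + 1)).
have t0 : 0 < t by rewrite lt_min !divr_gt0.
have t1 : t * (S phi + 1) <= de by rewrite -ler_pdivlMr// ge_min lexx.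
have t2 : t * (N phi + 1) <= r / 9 by rewrite -ler_pdivlMr// ge_min lexx orbT.
have Ht : H (t *: phi) by exact: H01Z.
exists (t *: phi); split => //.
  by rewrite (energyNZ t Hphi) gtr0_norm//; lra.
rewrite /I psiZ//.
have : t ^+ 2 * n%:R * Q <= J (t *: phi).
  rewrite -RintegralZl//; apply: le_Rintegral => //; last 2 first.
  - exact: int_J.
  - move=> x Dx; rewrite mul1r.
    have -> : (t *: phi) x = t * phi x by [].
    have [z|nz] := eqVneq (phi x) 0.
      by rewrite z mulr0 expr0n mulr0 prim0.
    have nt : t * phi x != 0 by rewrite mulf_neq0// gt_eqF.
    have := deP x (t * phi x) Dx; rewrite normr_gt0 nt /= => /(_ _).
    rewrite ler_pdivlMr ?exprn_gt0 ?normr_gt0// real_normK ?num_real//.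
    have -> : t ^+ 2 * n%:R * phi x ^+ 2 = n%:R * (t * phi x) ^+ 2 by ring.
    apply; apply: lt_le_trans t1; rewrite normrM gtr0_norm// ltr_pM2l//.
    by have := le_supnorm hV Hphi (DV Dx); lra.
  by have := integrableZl mD (t ^+ 2 * n%:R) i1; apply: eq_integrable.
have t20 : 0 < t ^+ 2 by rewrite exprn_gt0.
nra.
Qed.

(** By [superquadratic_growth] the primitive at [s >= 0] is at least
    [La * k x * s ^+ 2] up to an integrable function, for every constant [La]; it is
    chosen so that [La] times the integral of [k * phi ^+ 2] is [psi phi + 1]. *)
Let beyond : exists e0 : X, [/\ H e0, r / 9 < N e0 & I e0 < 0].
Proof.
have [phi [Hphi phi_ge0 phi0]] := bump.
have th2 := theta_gt2; have M00 := M0_gt0.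
have [g ig gP] := domf M0_gt0.
pose k x := prim (f x) M0.
have k0 x : D x -> 0 < k x.
  move=> Dx; have /andP[h _] := h3 Dx (or_intror (lexx M0)).
  by move: h; rewrite pmulr_rgt0//; lra.
have ik : mu.-integrable D (EFin \o k).
  apply: (@prim_integrable _ _ _ mu D f mD mf cf domf (fun=> M0) M0).
  by split=> [|x _]; [exact: measurable_cst|rewrite ger0_norm// ltW].
have [m2 b2] := sqr_bounded Hphi.
have ikp : mu.-integrable D (EFin \o (fun x => k x * phi x ^+ 2)).
  apply: (@dominated_integrable _ _ _ mu D mD (fun x => S phi ^+ 2 * k x)) => //.
  - by apply: measurable_funM => //; apply/measurable_EFinP; exact: (measurable_int mu ik).
  - by have := integrableZl mD (S phi ^+ 2) ik; apply: eq_integrable.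
  - move=> x Dx; rewrite normrM (gtr0_norm (k0 x Dx)) [leRHS]mulrC.
    by rewrite ler_wpM2l ?b2// ltW// k0.
have Qgt0 := weight_pos Hphi phi0 k0 ikp.
set Q := \int[mu]_(x in D) _ in Qgt0.
have P0 := psi_ge0 Hphi.
pose La : R := (psi phi + 1) / Q.
have La0 : 0 < La by rewrite divr_gt0//; lra.
(* For [s >= M0 * expR L] the logarithmic gain is at least [M0 ^+ 2 * La]. *)
pose L : R := M0 ^+ 2 * La / (theta - 2).
have th0 : 0 < theta - 2 by rewrite subr_gt0.
have L0 : 0 < L by rewrite divr_gt0// mulr_gt0// exprn_gt0.
pose ML : R := M0 * expR L.
have grow x (s : R) : D x -> ML <= s -> La * k x * s ^+ 2 <= prim (f x) s.
  move=> Dx Ms.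
  have e1 : 1 <= expR L by rewrite -expR0 ler_expR ltW.
  have Ms' : M0 <= s by apply: le_trans Ms; rewrite /ML ler_peMr// ltW.
  have s0 : 0 < s by exact: lt_le_trans Ms'.
  apply: le_trans (superquadratic_growth (@cf x Dx) th2 M00 _ Ms'); last first.
    by move=> t tM; apply: h3 => //; right.
  rewrite -/(k x).
  have lnL : L <= ln (s / M0).
    rewrite -(expRK L) ler_ln ?posrE ?expR_gt0 ?divr_gt0//.
    by rewrite ler_pdivlMr// mulrC.
  have -> : La * k x * s ^+ 2 = k x * ((s / M0) ^+ 2 * ((theta - 2) * L)).
    by rewrite /L; field; rewrite !gt_eqF//; lra.
  rewrite ler_wpM2l ?(ltW (k0 x Dx))// ler_wpM2l ?sqr_ge0//.
  have : (theta - 2) * L <= (theta - 2) * ln (s / M0) by rewrite ler_pM2l//; lra.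
  lra.
pose c x : R := La * ML ^+ 2 * k x + M0 * g x.
have ic : mu.-integrable D (EFin \o c).
  have := integrableD mD (integrableZl mD (La * ML ^+ 2) ik) (integrableZl mD M0 ig).
  by apply: eq_integrable.
have g_ge0 x : D x -> 0 <= g x.
  move=> Dx; apply: le_trans (normr_ge0 (f x 0)) (gP x 0 Dx _).
  by apply/andP; split; lra.
have lower x (s : R) : D x -> 0 <= s -> La * k x * s ^+ 2 - c x <= prim (f x) s.
  move=> Dx s0; have kx := k0 x Dx; have gx := g_ge0 x Dx.
  have Mg : 0 <= M0 * g x by rewrite mulr_ge0// ltW.
  have [sM|Ms] := leP s ML; last first.
    apply: le_trans (grow x s Dx (ltW Ms)); rewrite gerBl /c addr_ge0//.
    by rewrite mulr_ge0 ?(ltW kx)// mulr_ge0 ?sqr_ge0// ltW.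
  have h4 : La * k x * s ^+ 2 <= La * ML ^+ 2 * k x.
    have Lk : 0 <= La * k x by exact: mulr_ge0 (ltW La0) (ltW kx).
    rewrite [leRHS]mulrAC ler_wpM2l//.
    by rewrite ler_pXn2r ?nnegrE//; exact: le_trans sM.
  have h5 : - (M0 * g x) <= prim (f x) s.
    have [sM0|sM0] := leP s M0; last first.
      have /andP[h _] := h3 Dx (or_intror (ltW sM0)).
      have : 0 < prim (f x) s by move: h; rewrite pmulr_rgt0//; lra.
      lra.
    have : `|prim (f x) s| <= g x * M0.
      apply: (@prim_bound _ (f x) (@cf x Dx) M0) => [t tM|]; first exact: gP.
      by rewrite ger0_norm.
    by rewrite ler_norml mulrC => /andP[].
  by rewrite /c; lra.
pose Cc := \int[mu]_(x in D) c x.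
have bound (t : R) : 0 <= t -> t ^+ 2 * (psi phi + 1) - Cc <= J (t *: phi).
  move=> t0; have Ht : H (t *: phi) by exact: H01Z.
  have -> : t ^+ 2 * (psi phi + 1) = La * t ^+ 2 * Q.
    by rewrite /La; field; rewrite gt_eqF.
  have i2 : mu.-integrable D (EFin \o (fun x => La * t ^+ 2 * (k x * phi x ^+ 2))).
    by have := integrableZl mD (La * t ^+ 2) ikp; apply: eq_integrable.
  rewrite -RintegralZl// -RintegralB//; apply: le_Rintegral => //.
  - by have := integrableB mD i2 ic; apply: eq_integrable.
  - exact: int_J.
  - move=> x Dx; have := lower x (t * phi x) Dx (mulr_ge0 t0 (phi_ge0 x)).
    by have -> : La * k x * (t * phi x) ^+ 2 = La * t ^+ 2 * (k x * phi x ^+ 2) by ring.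
have Npos : 0 < N phi.
  rewrite lt_neqAle energyN_ge0 andbT eq_sym; apply/negP => /eqP Nphi.
  move: Qgt0; have -> : Q = \int[mu]_(x in D) (0 : R).
    apply: eq_Rintegral => x; rewrite inE => Dx.
    have := sup_bound hV Hphi (DV Dx); rewrite Nphi mulr0 normr_le0 => /eqP ->.
    by rewrite expr0n mulr0.
  by rewrite Rintegral_cst// mul0r ltxx.
pose t : R := `|Cc| + 1 + r / 9 / N phi.
have rN : 0 < r / 9 / N phi by rewrite !divr_gt0.
have Cc0 := normr_ge0 Cc.
have t1 : `|Cc| + 1 <= t by rewrite lerDl ltW.
have t0 : 0 <= t by lra.
exists (t *: phi); split.
- exact: H01Z.
- rewrite (energyNZ t Hphi) ger0_norm// -ltr_pdivrMr// /t; lra.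
- rewrite /I psiZ//; have := bound t t0; have := ler_norm Cc.
  nra.
Qed.

(** With [rho = r / 9] the barrier condition of [two_critical_points] reads
    [alpha < am / 2 * (r / 9) ^+ 2], and [2 * 9 ^ 2 = 162]. *)
Lemma two_critical_gasket : exists u v : X,
  [/\ critical H psi dJ u, critical H psi dJ v, psi u - J u < 0 & 0 < psi v - J v].
Proof.
have [u0 [Hu0 Nu0 Iu0]] := below; have [e0 [He0 Ne0 Ie0]] := beyond.
have [CA ARP] := AR.
have am2 : 0 < am / 2 by rewrite divr_gt0// am_gt0.
have five : 0 < 5 :> R by [].
apply: (@two_critical_points R X H N S psi J dJ (am / 2) (ap / 2) 5 _ _ _ _ _ _ _ _ _
  five _ _ am2 _ _ _ _ _ _ _ _ theta CA theta_gt2 ARP _ (r / 9) alpha _ _ J_le J0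
  u0 e0 Hu0 Nu0 Iu0 He0 Ne0 Ie0).
- exact: H0.
- exact: H01D.
- exact: H01Z.
- exact: energyN_ge0.
- exact: energyND.
- exact: energyNZ.
- exact: (supnorm_ge0 hV).
- exact: (supnormD hV).
- exact: (supnormZ hV).
- exact: (supnormN hV).
- exact: (H01_complete hV).
- move=> u v t Hu Hv t01; rewrite /psi.
  apply: le_trans (ler_wpM2r _ (weighted_form_cvx am_gt0 a_ge a_le Hu Hv t01)) _ => //.
  by rewrite le_eqVlt; apply/orP; left; apply/eqP; rewrite /psi; ring.
- exact: psiZ.
- move=> u Hu; have := weighted_form_ge am_gt0 a_ge a_le Hu; rewrite /psi.
  by rewrite -(ler_pM2r (_ : 0 < 2^-1 :> R))// mulrAC.
- move=> u Hu; have := weighted_form_le am_gt0 a_ge a_le Hu; rewrite /psi.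
  by rewrite -(ler_pM2r (_ : 0 < 2^-1 :> R))// [leRHS]mulrAC.
- exact: dJD.
- exact: dJZ.
- exact: dJ_bounded.
- exact: J_diff.
- exact: (H01_compact hV).
- by rewrite divr_gt0.
- by rewrite (_ : am / 2 * (r / 9) ^+ 2 = am * r ^+ 2 / 162)//; field.
Qed.

End Existence.

(** * From almost everywhere to everywhere *)

Section FullMeasure.
Context d (T : measurableType d) (R : realType) (mu : {measure set T -> \bar R}).

Lemma ae_null_set (V : set T) (P : nat -> T -> Prop) :
  (forall n, {ae mu, forall x, V x -> P n x}) ->
  exists N : set T, [/\ measurable N, mu N = 0%E & forall x n, (V `\` N) x -> P n x].
Proof.
move=> /ae_foralln [N [mN N0 NP]]; exists N; split => // x n [Vx nNx].
by apply: contrapT => nP; apply/nNx/NP => /= /(_ n Vx).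
Qed.

Lemma measure_setD_null (V N : set T) : measurable V -> measurable N -> mu N = 0%E ->
  mu (V `\` N) = mu V.
Proof.
move=> mV mN N0; have mD := measurableD mV mN.
apply/eqP; rewrite eq_le; apply/andP; split.
  by apply: le_measure; rewrite ?inE//; exact: subDsetl.
rewrite -[leRHS](measureU0 mD mN N0); apply: le_measure; rewrite ?inE//.
  exact: measurableU.
by move=> x Vx; have [Nx|nNx] := pselect (N x); [right|left].
Qed.

(** One null set can take care of countably many sections of [f] only; continuity
    yields the other ones. *)
Lemma measurable_fun_rat (D : set T) (f : T -> R -> R) (t : R) :
  (forall q : rat, measurable_fun D (f ^~ (ratr q))) ->
  (forall x, D x -> continuous (f x)) -> measurable_fun D (f ^~ t).
Proof.
move=> mf cf.
have /choice[q qP] (k : nat) : exists q : rat, t < ratr q < t + k.+1%:R^-1.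
  have [|q /[!in_itv]/= qP] := @rat_in_itvoo R t (t + k.+1%:R^-1); last by exists q.
  by rewrite ltrDl.
apply: (@measurable_fun_cvg _ _ _ D (fun k x => f x (ratr (q k)))) => [k|x Dx].
  exact: mf.
apply: (@cvg_comp _ _ _ (fun k => ratr (q k)) (f x) _ (nbhs t)); last exact: cf.
apply: (@squeeze_cvgr _ _ _ _ (cst t) (fun k : nat => t + k.+1%:R^-1)).
- by apply: nearW => k; case/andP: (qP k) => /ltW-> /ltW->.
- exact: cvg_cst.
- rewrite -[X in _ --> X]addr0; apply: cvgD; first exact: cvg_cst.
  exact: cvg_harmonic.
Qed.

End FullMeasure.

Section Solutions.
Context {R : realType} (p : 'I_3 -> plane R) (V N : set (plane R)).
Variables (mu : {measure set (plane R) -> \bar R}) (a : plane R -> R) (am ap : R).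
Variable (f : plane R -> R -> R).
Hypotheses (hV : is_gasket p V) (mN : measurable N) (N0 : mu N = 0%E).
Hypotheses (am_gt0 : 0 < am) (a_ge : forall x, Vinf p x -> am <= a x)
  (a_le : forall x, Vinf p x -> a x <= ap).
Local Notation D := (V `\` N).
Hypotheses (mf : forall t, measurable_fun D (f ^~ t))
  (cf : forall x, D x -> continuous (f x))
  (domf : forall M : R, 0 < M -> exists2 g : plane R -> R, mu.-integrable D (EFin \o g) &
     forall x (t : R), D x -> - M <= t <= M -> `|f x t| <= g x).
Local Notation psi := (fun u : plane R -> R^o => weighted_form p a u / 2).

Lemma critical_solution u :
  critical (H01 p V) psi (dpotential mu D f) u -> is_solution p V mu a f u.
Proof.
move=> [Hu uP]; split=> // v Hv.
rewrite (weighted_energy_fin am_gt0 a_ge a_le Hu) (weighted_energy_fin am_gt0 a_ge a_le Hv).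
rewrite (integral_null V _ mN N0).
have DV : D `<=` V by exact: subDsetl.
have mD : measurable D by apply: measurableD => //; exact: (gasket_measurable hV).
have i := nemytskii_integrable mD mf cf domf
  (H01_bounded_on hV DV Hu) (H01_bounded_on hV DV (H01B Hv Hu)).
rewrite -[X in (_ - X)%E](fineK (integrable_fin_num mD i)) -!EFinM -!EFinB lee_fin.
by have := uP v Hv; rewrite ![_ / 2]mulrC.
Qed.

Lemma potential_eq (u v : plane R -> R^o) : (forall x, V x -> u x = v x) ->
  potential mu D f u = potential mu D f v.
Proof. by move=> uv; apply: eq_Rintegral => x /[!inE] -[Vx _]; rewrite uv. Qed.

Lemma weighted_form_eq (u v : plane R -> R^o) : (forall x, V x -> u x = v x) ->
  weighted_form p a u = weighted_form p a v.
Proof.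
move=> uv; congr fine; rewrite /weighted_energy.
congr limn_esup; apply/funext => n; congr EFin; congr (_ * _).
by apply: eq_edge_sum => w w' i j; rewrite !uv//; exact: (gasket_vertex hV).
Qed.

End Solutions.

Theorem theorem16 (R : realType) (p : 'I_3 -> plane R) (V : set (plane R))
    (mu : {measure set (plane R) -> \bar R})
    (a : plane R -> R) (am ap : R) (f : plane R -> R -> R)
    (hp : equilateral p) (hV : is_gasket p V)
    (hmu : is_normalized_hausdorff V mu)
    (ha : forall x, Vinf p x -> 0 < a x)
    (ham0 : 0 < am)
    (ham : ereal_inf [set (a x)%:E | x in Vinf p] = am%:E)
    (hap : ereal_sup [set (a x)%:E | x in Vinf p] = ap%:E)
    (hf : L1_caratheodory mu V f)
    (h1 : forall K : R, exists2 delta : R, 0 < delta &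
       {ae mu, forall x, V x -> forall t : R, 0 < `|t| < delta ->
          K <= primitive f x t / `|t| ^+ 2})
    (h2 : exists r alpha : R, [/\ 0 < r, alpha < am * r ^+ 2 / 162 &
       {ae mu, forall x, V x -> forall t : R, - r <= t <= r ->
          primitive f x t <= alpha}])
    (h3 : exists theta M0 : R, [/\ 2 < theta, 0 < M0 &
       {ae mu, forall x, V x -> forall t : R, t <= - M0 \/ M0 <= t ->
          0 < theta * primitive f x t <= t * f x t}]) :
  exists u v : plane R -> R,
    [/\ is_solution p V mu a f u, is_solution p V mu a f v,
        exists2 x, V x & u x <> 0,
        exists2 x, V x & v x <> 0
      & exists2 x, V x & u x <> v x].
Proof.
have a_ge x : Vinf p x -> am <= a x.
  by move=> Vx; rewrite -lee_fin -ham; apply: ereal_inf_lbound; exists x.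
have a_le x : Vinf p x -> a x <= ap.
  by move=> Vx; rewrite -lee_fin -hap; apply: ereal_sup_ubound; exists x.
have mV := gasket_measurable hV.
have [meas_f cont_f dom_f] := hf.
have [r [alpha [r0 al ae2]]] := h2; have [theta [M0 [th M00 ae3]]] := h3.
(* Countably many conditions are collected off a single null set [N]: the sections of
   [f] at the rationals [q n], enumerated with repetitions, coincide with measurable
   functions [h n]; the growth bounds are used for the constants [n.+1] only, and the
   limit at 0 for the thresholds [n]. *)
pose q (n : nat) : rat := odflt 0 (unpickle n).
have /choice[h hP] n : exists h : plane R -> R, measurable_fun V h /\
    f ^~ (ratr (q n)) = h %[ae mu in V].
  by have [h mh fh] := meas_f (ratr (q n)); exists h.
have /choice[g gP] (n : nat) : exists g : plane R -> R, mu.-integrable V (EFin \o g) /\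
    {ae mu, forall x, V x -> forall t, - n.+1%:R <= t <= n.+1%:R -> `|f x t| <= g x}.
  by have [//|g [ig _ fg]] := dom_f n.+1%:R; exists g.
have /choice[de deP] (n : nat) : exists de : R, 0 < de /\
    {ae mu, forall x, V x -> forall t : R, 0 < `|t| < de ->
          n%:R <= primitive f x t / `|t| ^+ 2}.
  by have [de de0 aede] := h1 n%:R; exists de.
have [N [mN N0 good]] : exists N : set (plane R), [/\ measurable N, mu N = 0%E &
   forall x (n : nat), (V `\` N) x -> [/\ f x (ratr (q n)) = h n x,
     forall t, - n.+1%:R <= t <= n.+1%:R -> `|f x t| <= g n x,
     forall t : R, 0 < `|t| < de n -> n%:R <= primitive f x t / `|t| ^+ 2
   & [/\ continuous (f x), forall t : R, - r <= t <= r -> primitive f x t <= alpha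
       & forall t : R, t <= - M0 \/ M0 <= t ->
           0 < theta * primitive f x t <= t * f x t]]].
  apply: ae_null_set => n; have [_ e1] := hP n; have [_ e2] := gP n.
  have [_ e3] := deP n.
  apply: filterS2 (filterI (filterI e1 e2) (filterI e3 cont_f)) (filterI ae2 ae3).
  by move=> x [[? ?] [? ?]] [? ?] Vx; split; [auto..|split; auto].
pose D := V `\` N.
have mD : measurable D by exact: measurableD.
have DV : D `<=` V by exact: subDsetl.
have muD : mu D = 1%E by rewrite measure_setD_null//; case: hmu.
have cf x : D x -> continuous (f x) by move=> /(good x 0%N)[_ _ _ []].
have mf t : measurable_fun D (f ^~ t).
  apply: measurable_fun_rat => // {}t; have tE : q (pickle t) = t by rewrite /q pickleK.
  have [mh _] := hP (pickle t).
  apply: eq_measurable_fun (measurable_funS mV DV mh) => x /[!inE] Dx.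
  by have [<-] := good x (pickle t) Dx; rewrite tE.
have domf (M : R) : 0 < M -> exists2 k : plane R -> R, mu.-integrable D (EFin \o k) &
     forall x (t : R), D x -> - M <= t <= M -> `|f x t| <= k x.
  move=> M_gt0; pose n := Num.truncn M; exists (g n).
    by apply: integrableS (gP n).1.
  move=> x t Dx /andP[t1 t2]; have [_ b _ _] := good x n Dx; apply: b.
  have : M < n.+1%:R by exact: truncnS_gt.
  by move=> ?; apply/andP; split; lra.
have mu1 x : mu [set x] = 0%E by exact: (normalized_hausdorff_set1 x hmu).
have [|||u [v [cu cv Iu Iv]]] := @two_critical_gasket R p V D mu a am ap f hp hV mD DV muD
  mu1 ham0 a_ge a_le mf cf domf r alpha theta M0 _ r0 al _ th M00 _.
- move=> n; exists (de n); first by case: (deP n).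
  by move=> x t /(good x n)[_ _ b _]; exact: b.
- by move=> x t /(good x 0%N)[_ _ _ [_ b _]]; exact: b.
- by move=> x t /(good x 0%N)[_ _ _ [_ _ b]]; exact: b.
have sol w (cw : critical _ _ _ w) := critical_solution hV mN N0 ham0 a_ge a_le mf cf domf cw.
have Hu := cu.1; have Hv := cv.1.
pose I (w : plane R -> R^o) : R := weighted_form p a w / 2 - potential mu D f w.
have I0 : I (fun=> 0) = 0.
  have := weighted_form_Z ham0 a_ge a_le 0 (H01_0 p V); rewrite scale0r expr0n mul0r => e.
  rewrite /I [weighted_form _ _ _]e mul0r sub0r.
  rewrite (_ : potential _ _ _ _ = 0) ?oppr0//.
  transitivity (\int[mu]_(x in D) (0 : R)); last by rewrite Rintegral_cst// mul0r.
  by apply: eq_Rintegral => x _; exact: prim0.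
(* Functions that agree on [V] have the same value of [I]. *)
have sep (w z : plane R -> R^o) : I w != I z -> exists2 x, V x & w x <> z x.
  apply: contra_neqP => nwz.
  have wz x : V x -> w x = z x.
    by move=> Vx; apply: contrapT => wz; apply: nwz; exists x.
  by rewrite /I (weighted_form_eq a hV wz) (potential_eq N mu f wz).
exists u, v; split; [exact: sol|exact: sol|..].
- by apply: (sep _ (fun=> 0)); rewrite I0 lt_eqF.
- by apply: (sep _ (fun=> 0)); rewrite I0 gt_eqF.
- by apply: sep; rewrite lt_eqF// (lt_trans Iu).
Qed.
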